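(* Let $T>0$, $\alpha>\frac13$, and let $\zeta\in\mathcal C^{\alpha}([0,T];\mathbb R^d)$ be a path with $\zeta_0=0$ admitting a Lévy area $\zeta^2$ as described in the context. Let $\{\zeta^n;n\ge1\}$ be a sequence of differentiable paths converging to $\zeta$ in the $\alpha$-Hölder rough path norm. Let $\mathcal K\subset\mathcal P_2(U)$ be compact and $\varepsilon,L>0$. Assume $\sigma\in\mathcal C_b^{1,3}([0,T]\times\mathbb R^m;\mathbb R^{m,d})$ and $b\in\mathcal C_b^{0,1,1}([0,T]\times\mathbb R^m\times U;\mathbb R^m)$ with $b(u,x,a)$ uniformly continuous in $u$. Let $F:[0,T]\times\mathbb R^m\times\mathcal K\to\mathbb R$ be bounded, Lipschitz continuous in $x$ uniformly over $\gamma\in\mathcal K$, and Lipschitz in $\gamma\in\mathcal K$ with respect to $W_2$; let $G:\mathbb R^m\to\mathbb R$ be bounded and continuous. For $(s,y)\in[0,T]\times\mathbb R^m$ and $\gamma\in\mathcal V^{\varepsilon,L}([s,T])$ let $x^{s,y,\gamma,n}$ and $x^{s,y,\gamma}$ be the solutions on $[s,T]$ of $$x_t^{s,y,\gamma,n}=y+\int_s^t\int_Ub(r,x_r^{s,y,\gamma,n},a)\,\gamma_r(da)\,dr+\int_s^t\sigma(r,x_r^{s,y,\gamma,n})\,d\zeta^n_r,$$ $$x_t^{s,y,\gamma}=y+\int_s^t\int_Ub(r,x_r^{s,y,\gamma},a)\,\gamma_r(da)\,dr+\int_s^t\sigma(r,x_r^{s,y,\gamma})\,d\zeta_r,$$ and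 set $$V^n(s,y)=\sup_{\gamma\in\mathcal V^{\varepsilon,L}([s,T])}\Big\{\int_s^TF(r,x_r^{s,y,\gamma,n},\gamma_r)\,dr+G(x_T^{s,y,\gamma,n})\Big\},$$ $$V(s,y)=\sup_{\gamma\in\mathcal V^{\varepsilon,L}([s,T])}\Big\{\int_s^TF(r,x_r^{s,y,\gamma},\gamma_r)\,dr+G(x_T^{s,y,\gamma})\Big\}.$$ Then $V^n\to V$ locally uniformly on $[0,T]\times\mathbb R^m$ as $n\to\infty$.
   Context: Notation: $\delta f_{st}=f_t-f_s$ for paths, $\delta h_{sut}=h_{st}-h_{su}-h_{ut}$ for two-parameter functions. $\mathcal C_1^\mu(V)$: $\mu$-Hölder $V$-valued paths; $\mathcal C_2^\mu(V)$: continuous functions $h_{st}$, $s\le t$, vanishing for $s=t$, with $\sup|h_{st}|/|t-s|^\mu<\infty$. Repeated indices are summed. $\mathcal C_b^{k,l}$: functions $f(t,x)$ for which $\partial_t^i\partial_x^\beta f$ exist, are continuous and bounded for $i\le k$, $|\beta|\le l$. $b\in\mathcal C_b^{0,1,1}$: $b(t,x,a)$ is bounded and continuous, with bounded continuous first derivatives in $x$ and in $a$; in particular $a\mapsto b(t,x,a)$ is Lipschitz for the metric $d$ of $U$, uniformly in $(t,x)$. ''Uniformly continuous in $u$'' means: for each $x$, $\sup_{a\in U}|b(u_2,x,a)-b(u_1,x,a)|\to0$ as $|u_2-u_1|\to0$. Lipschitz constants of $F$ are uniform in $t$, and $F$ is measurable in $t$ so that the time integrals make sense. Assumption on $\zeta$: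 $\zeta\in\mathcal C_1^\alpha(\mathbb R^d)$, $\alpha>1/3$, $\zeta_0=0$, and there is $\zeta^2\in\mathcal C_2^{2\alpha}(\mathbb R^{d,d})$ with $\delta\zeta^{2;ij}_{sut}=\delta\zeta^i_{su}\,\delta\zeta^j_{ut}$ and $\zeta^{2;ij}_{st}+\zeta^{2;ji}_{st}=\delta\zeta^i_{st}\,\delta\zeta^j_{st}$. The rough path norm is $\|\zeta\|_\alpha=\mathcal N(\zeta;\mathcal C_1^\alpha)+\mathcal N(\zeta^2;\mathcal C_2^{2\alpha})$ (sum of the corresponding Hölder norms); convergence $\zeta^n\to\zeta$ means $\mathcal N(\zeta^n-\zeta;\mathcal C_1^\alpha)+\mathcal N(\zeta^{n,2}-\zeta^2;\mathcal C_2^{2\alpha})\to0$, where $\zeta^{n,2;ij}_{st}=\int_s^t\delta\zeta^{n,i}_{sr}\,d\zeta^{n,j}_r$. Solutions driven by $\zeta$ are in the rough path sense: for $\kappa\le\alpha$, $2\kappa+\alpha>1$, $\mathcal Q_\zeta^\kappa$ is the set of weakly controlled paths $z\in\mathcal C_1^\kappa$, $\delta z^i_{st}=z_s^{\zeta;ii_1}\delta\zeta^{i_1}_{st}+\rho^i_{st}$, $z^\zeta\in\mathcal C_1^\kappa$, $\rho\in\mathcal C_2^{2\kappa}$; and $\int_s^t\mu_u^i\,d\zeta_u^i=\lim\sum_q[\mu^i_{t_q}\delta\zeta^i_{t_qt_{q+1}}+\mu^{\zeta;ii_1}_{t_q}\zeta^{2;i_1i}_{t_qt_{q+1}}]$ over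 partitions of $[s,t]$ with mesh tending to $0$. The path $(\sigma^{ik}(s,x_s))_k$ is weakly controlled with derivative $\partial_{x_j}\sigma^{ik}(s,x_s)x_s^{\zeta;jl}$. For $\kappa\in(1/3,\alpha)$ the equation has a unique solution in $\mathcal Q_\zeta^\kappa([s,T];\mathbb R^m)$. Control space: $U\subseteq\mathbb R^k$ is equipped with a metric $d$; $\mathcal P_2(U)$ is the set of Borel probability measures on $U$ with finite second moments, with the Wasserstein-2 metric $W_2(m_1,m_2)=\inf_{m\in\Gamma(m_1,m_2)}(\int\int d^2(x,y)\,dm(x,y))^{1/2}$, $\Gamma(m_1,m_2)$ being the set of couplings. $\mathcal V^{\varepsilon,L}([s,T])=\{\gamma:[s,T]\to\mathcal K:\ W_2(\gamma_r,\gamma_t)\le L|t-r|^\varepsilon\ \text{for all } r,t\in[s,T]\}$. *)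

(* Defs.v *)
From HB Require Import structures.
From mathcomp Require Import all_boot all_order all_algebra.
From mathcomp Require Import all_classical all_reals all_analysis.

Set Implicit Arguments.
Unset Strict Implicit.
Unset Printing Implicit Defensive.

Import Order.TTheory GRing.Theory Num.Theory.
Import numFieldNormedType.Exports.

Local Open Scope classical_set_scope.
Local Open Scope ring_scope.

(* Norms of vectors and matrices are max norms, which only affects constants.
   The terms with s = t contribute 0, because x / 0 = 0. *)
Definition holder2_norm (R : realType) (V : normedModType R)
    (mu a b : R) (h : R -> R -> V) : \bar R :=
  ereal_sup [set (`|h p.1 p.2| / (p.2 - p.1) `^ mu)%:E |
             p in [set p : R * R | a <= p.1 <= p.2 /\ p.2 <= b]].

Definition holder1_norm (R : realType) (V : normedModType R)
    (mu a b : R) (f : R -> V) : \bar R :=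
  holder2_norm mu a b (fun s t => f t - f s).

Definition C1 (R : realType) (V : normedModType R)
    (mu a b : R) (f : R -> V) : Prop :=
  (holder1_norm mu a b f < +oo)%E.

Record C2 (R : realType) (V : normedModType R)
    (mu a b : R) (h : R -> R -> V) : Prop := {
  C2_continuous : {within [set p : R * R | a <= p.1 <= p.2 /\ p.2 <= b],
                    continuous (fun p => h p.1 p.2)} ;
  C2_diagonal : forall t, a <= t <= b -> h t t = 0 ;
  C2_bounded : (holder2_norm mu a b h < +oo)%E }.

Record rough_path (R : realType) (d : nat) (alpha T : R)
    (zeta : R -> 'cV[R]_d) (zeta2 : R -> R -> 'M[R]_d) : Prop := {
  rough_path_start : zeta 0 = 0 ;
  rough_path_C1 : C1 alpha 0 T zeta ;
  rough_path_C2 : C2 (2 * alpha) 0 T zeta2 ;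
  rough_path_chen : forall s u t (i j : 'I_d),
    0 <= s -> s <= u -> u <= t -> t <= T ->
    zeta2 s t i j - zeta2 s u i j - zeta2 u t i j
    = (zeta u - zeta s) i 0 * (zeta t - zeta u) j 0 ;
  rough_path_geometric : forall s t (i j : 'I_d),
    0 <= s -> s <= t -> t <= T ->
    zeta2 s t i j + zeta2 s t j i
    = (zeta t - zeta s) i 0 * (zeta t - zeta s) j 0 }.

Record controlled (R : realType) (m d : nat) (kappa a b : R)
    (zeta : R -> 'cV[R]_d) (z : R -> 'cV[R]_m) (z' : R -> 'M[R]_(m, d)) : Prop := {
  controlled_path : C1 kappa a b z ;
  controlled_derivative : C1 kappa a b z' ;
  controlled_remainder :
    C2 (2 * kappa) a b (fun s t => z t - z s - z' s *m (zeta t - zeta s)) }.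

(* One term of the compensated Riemann sum of the integral of the
   matrix-valued integrand Y against zeta;  Y' r i k l is the derivative of
   Y r i k in the direction l. *)
Definition rough_term (R : realType) (m d : nat)
    (zeta : R -> 'cV[R]_d) (zeta2 : R -> R -> 'M[R]_d)
    (Y : R -> 'M[R]_(m, d)) (Y' : R -> 'I_m -> 'M[R]_d) (u v : R) : 'cV[R]_m :=
  \col_i (\sum_(k < d) Y u i k * (zeta v - zeta u) k 0
          + \sum_(k < d) \sum_(l < d) Y' u i k l * zeta2 u v l k).

(* [is_rough_integral zeta zeta2 Y Y' s t I]: the compensated Riemann sums
   over the partitions s :: p of [s, t] tend to I as the mesh tends to 0. *)
Definition is_rough_integral (R : realType) (m d : nat)
    (zeta : R -> 'cV[R]_d) (zeta2 : R -> R -> 'M[R]_d)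
    (Y : R -> 'M[R]_(m, d)) (Y' : R -> 'I_m -> 'M[R]_d)
    (s t : R) (I : 'cV[R]_m) : Prop :=
  forall e : R, 0 < e -> exists2 h : R, 0 < h &
    forall p : seq R, itv_partition s t p ->
      (forall q, (q < size p)%N -> nth s (s :: p) q.+1 - nth s (s :: p) q < h) ->
      `|\sum_(0 <= q < size p)
          rough_term zeta zeta2 Y Y' (nth s (s :: p) q) (nth s (s :: p) q.+1)
        - I| < e.

(* Derivative relative to a set A: one-sided at the endpoints of an interval. *)
Definition derivable_in (R : realType) (V : normedModType R)
    (A : set R) (f : R -> V) (t : R) : Prop :=
  cvg ((fun u => (u - t)^-1 *: (f u - f t)) @ within A t^').

Definition derive_in (R : realType) (V : normedModType R)
    (A : set R) (f : R -> V) (t : R) : V :=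
  lim ((fun u => (u - t)^-1 *: (f u - f t)) @ within A t^').

(* The multi-index is given as the list of the directions of differentiation. *)
Definition partial_x (R : realType) (m : nat) (V : normedModType R)
    (f : R -> 'cV[R]_m -> V) (beta : seq 'I_m) : R -> 'cV[R]_m -> V :=
  foldr (fun j g t x => 'D_(delta_mx j 0) (g t) x) f beta.

Definition partial_t (R : realType) (m : nat) (V : normedModType R) (T : R)
    (i : nat) (f : R -> 'cV[R]_m -> V) : R -> 'cV[R]_m -> V :=
  iter i (fun g t x => derive_in `[0, T] (g^~ x) t) f.

Record Cb (R : realType) (m : nat) (V : normedModType R) (T : R) (k l : nat)
    (f : R -> 'cV[R]_m -> V) : Prop := {
  Cb_derivable_x : forall (beta : seq 'I_m) (j : 'I_m) t x,
    (size beta < l)%N -> 0 <= t <= T ->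
    derivable (partial_x f beta t) x (delta_mx j 0) ;
  Cb_derivable_t : forall (i : nat) (beta : seq 'I_m) t x,
    (i < k)%N -> (size beta <= l)%N -> 0 <= t <= T ->
    derivable_in `[0, T] ((partial_t T i (partial_x f beta))^~ x) t ;
  Cb_continuous : forall (i : nat) (beta : seq 'I_m),
    (i <= k)%N -> (size beta <= l)%N ->
    {within `[0, T] `*` [set: 'cV[R]_m],
      continuous (fun p => partial_t T i (partial_x f beta) p.1 p.2)} ;
  Cb_bounded : forall (i : nat) (beta : seq 'I_m),
    (i <= k)%N -> (size beta <= l)%N ->
    exists C : R, forall t x, 0 <= t <= T ->
      `|partial_t T i (partial_x f beta) t x| <= C }.

(* Type of the control spaces: U is a metric space (U, mdist), identified with
   a subset of R^k by an injection emb, so that its metric need not be the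
   Euclidean one.  The library needs a base point to equip U with its Borel
   sets. *)

#[short(type="pmetricType")]
HB.structure Definition PointedMetric (K : numDomainType) :=
  {M of Metric K M & Pointed M}.

(* Fréchet derivative at emb a, relative to the subset emb(U) of R^k.  D need
   not be unique, e.g. at an isolated point of emb(U). *)
Definition is_derivative_a (R : realType) (m k : nat) (U : pmetricType R)
    (emb : U -> 'cV[R]_k) (f : U -> 'cV[R]_m) (a : U) (D : 'M[R]_(m, k)) : Prop :=
  forall e : R, 0 < e -> exists2 h : R, 0 < h &
    forall a', `|emb a' - emb a| < h ->
      `|f a' - f a - D *m (emb a' - emb a)| <= e * `|emb a' - emb a|.

(* For an arbitrary U the bound on the derivative in a does not yield the
   Lipschitz property for mdist, which is part of the class. *)
Record Cb011 (R : realType) (m k : nat) (U : pmetricType R)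
    (emb : U -> 'cV[R]_k) (T : R) (b : R -> 'cV[R]_m -> U -> 'cV[R]_m) : Prop := {
  Cb011_continuous :
    {within `[0, T] `*` [set: 'cV[R]_m] `*` [set: U],
      continuous (fun p => b p.1.1 p.1.2 p.2)} ;
  Cb011_bounded : exists C : R, forall t x a, 0 <= t <= T -> `|b t x a| <= C ;
  Cb011_derivable_x : forall t x a (j : 'I_m), 0 <= t <= T ->
    derivable ((b t)^~ a) x (delta_mx j 0) ;
  Cb011_partial_x_continuous : forall j : 'I_m,
    {within `[0, T] `*` [set: 'cV[R]_m] `*` [set: U],
      continuous (fun p => 'D_(delta_mx j 0) ((b p.1.1)^~ p.2) p.1.2)} ;
  Cb011_partial_x_bounded : forall j : 'I_m, exists C : R, forall t x a,
    0 <= t <= T -> `|'D_(delta_mx j 0) ((b t)^~ a) x| <= C ;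
  Cb011_derivative_a : exists Db : R -> 'cV[R]_m -> U -> 'M[R]_(m, k),
    [/\ forall t x a, 0 <= t <= T -> is_derivative_a emb (b t x) a (Db t x a),
        {within `[0, T] `*` [set: 'cV[R]_m] `*` [set: U],
          continuous (fun p => Db p.1.1 p.1.2 p.2)} &
        exists C : R, forall t x a, 0 <= t <= T -> `|Db t x a| <= C] ;
  Cb011_lipschitz_a : exists C : R, forall t x a a', 0 <= t <= T ->
    `|b t x a - b t x a'| <= C * mdist a a' }.

Notation borel T := (g_sigma_algebraType (@open T)).

(* Couplings live on the Borel sets of U * U, for which mdist is measurable even
   if U is not separable. *)
Definition coupling (R : realType) (U : pmetricType R)
    (m1 m2 : probability (borel U) R) (m : probability (borel (U * U)%type) R) : Prop :=
  forall A : set U, measurable (A : set (borel U)) ->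
    m [set z | A z.1] = m1 A /\ m [set z | A z.2] = m2 A.

Definition W2 (R : realType) (U : pmetricType R)
    (m1 m2 : probability (borel U) R) : \bar R :=
  ereal_inf [set ((\int[m]_z (mdist z.1 z.2 ^+ 2)%:E) `^ 2^-1)%E |
             m in coupling m1 m2].

Record P2 (R : realType) (U : pmetricType R) := MkP2 {
  P2_law :> probability (borel U) R ;
  P2_moment : exists a0 : U, (\int[P2_law]_a (mdist a0 a ^+ 2)%:E < +oo)%E }.

HB.instance Definition _ (R : realType) (U : pmetricType R) :=
  gen_eqMixin (P2 U).
HB.instance Definition _ (R : realType) (U : pmetricType R) :=
  gen_choiceMixin (P2 U).

(* The topology of P2 is given by the W2-open sets, which satisfy the axioms of
   a topology without recourse to the triangle inequality. *)
Definition W2_open (R : realType) (U : pmetricType R) : set_system (P2 U) :=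
  [set A | forall mu : P2 U, A mu -> exists2 e : R, 0 < e &
             forall nu : P2 U, (W2 mu nu < e%:E)%E -> A nu].

Lemma W2_openT (R : realType) (U : pmetricType R) : W2_open [set: P2 U].
Proof. by move=> mu _; exists 1. Qed.

Lemma W2_openI (R : realType) (U : pmetricType R) : setI_closed (@W2_open R U).
Proof.
move=> A B oA oB mu [/oA[e e0 eA] /oB[f f0 fB]].
exists (Num.min e f); first by rewrite lt_min e0.
move=> nu; rewrite EFin_min lt_min => /andP[? ?].
by split; [exact: eA|exact: fB].
Qed.

Lemma W2_open_bigU (R : realType) (U : pmetricType R) (I : Type)
    (f : I -> set (P2 U)) :
  (forall i, W2_open (f i)) -> W2_open (\bigcup_i f i).
Proof.
move=> of_ mu [i _ /of_[e e0 eA]]; exists e => // nu /eA fnu.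
by exists i.
Qed.

HB.instance Definition _ (R : realType) (U : pmetricType R) :=
  isOpenTopological.Build (P2 U) (@W2_openT R U) (@W2_openI R U) (@W2_open_bigU R U).

Definition mx_integral (dd : measure_display) (X : measurableType dd)
    (R : realType) (p q : nat) (mu : {measure set X -> \bar R}) (A : set X)
    (f : X -> 'M[R]_(p, q)) : 'M[R]_(p, q) :=
  \matrix_(i, j) \int[mu]_(r in A) f r i j.

Definition drift (R : realType) (m : nat) (U : pmetricType R)
    (b : R -> 'cV[R]_m -> U -> 'cV[R]_m) (gamma : R -> P2 U)
    (x : R -> 'cV[R]_m) (s t : R) : 'cV[R]_m :=
  mx_integral lebesgue_measure `[s, t]
    (fun r => mx_integral (gamma r) [set: borel U] (b r (x r))).

(* A differentiable path z on [0, T] such that dz_r = z'_r dr makes sense as an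
   integrator of continuous functions. *)
Record differentiable_path (R : realType) (d : nat) (T : R)
    (z : R -> 'cV[R]_d) : Prop := {
  differentiable_path_derivable : forall t, 0 <= t <= T ->
    derivable_in `[0, T] z t ;
  differentiable_path_integrable : forall j : 'I_d,
    lebesgue_measure.-integrable `[0, T]
      (fun r => (derive_in `[0, T] z r j 0)%:E) }.

Definition iterated_integral (R : realType) (d : nat) (T : R)
    (z : R -> 'cV[R]_d) (s t : R) : 'M[R]_d :=
  mx_integral lebesgue_measure `[s, t]
    (fun r => (z r - z s) *m (derive_in `[0, T] z r)^T).

Definition smooth_solution (R : realType) (m d : nat) (U : pmetricType R) (T : R)
    (b : R -> 'cV[R]_m -> U -> 'cV[R]_m) (sigma : R -> 'cV[R]_m -> 'M[R]_(m, d))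
    (z : R -> 'cV[R]_d) (s : R) (y : 'cV[R]_m) (gamma : R -> P2 U)
    (x : R -> 'cV[R]_m) : Prop :=
  {within `[s, T], continuous x} /\
  forall t, s <= t <= T ->
    x t = y + drift b gamma x s t
        + mx_integral lebesgue_measure `[s, t]
            (fun r => sigma r (x r) *m derive_in `[0, T] z r).

(* Solution on [s, T] of the rough equation.  The equation is an identity
   between controlled paths, and a rough integral has its integrand as
   derivative: hence x is controlled with derivative sigma r (x r).  (For an
   arbitrary derivative of x the equation would not have a unique solution,
   e.g. if zeta = 0 and zeta2 is a nonzero pure area.) *)
Definition rough_solution (R : realType) (m d : nat) (U : pmetricType R)
    (kappa T : R) (b : R -> 'cV[R]_m -> U -> 'cV[R]_m)
    (sigma : R -> 'cV[R]_m -> 'M[R]_(m, d))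
    (zeta : R -> 'cV[R]_d) (zeta2 : R -> R -> 'M[R]_d)
    (s : R) (y : 'cV[R]_m) (gamma : R -> P2 U) (x : R -> 'cV[R]_m) : Prop :=
  let x' := fun r => sigma r (x r) in
  controlled kappa s T zeta x x' /\
  forall t, s <= t <= T -> exists2 I : 'cV[R]_m,
    is_rough_integral zeta zeta2 (fun r => sigma r (x r))
      (fun r i => \matrix_(k, l)
         \sum_(j < m) 'D_(delta_mx j 0) (sigma r) (x r) i k * x' r j l) s t I
    & x t = y + drift b gamma x s t + I.

Definition admissible (R : realType) (U : pmetricType R) (K : set (P2 U))
    (eps L s T : R) : set (R -> P2 U) :=
  [set gamma | (forall r, s <= r <= T -> K (gamma r)) /\
     forall r t, s <= r <= T -> s <= t <= T ->
       (W2 (gamma r) (gamma t) <= (L * `|t - r| `^ eps)%:E)%E].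

(* [X s y gamma] is the state path started from y at time s, with control gamma. *)
Definition value (R : realType) (m : nat) (U : pmetricType R) (K : set (P2 U))
    (eps L T : R) (F : R -> 'cV[R]_m -> P2 U -> R) (G : 'cV[R]_m -> R)
    (X : R -> 'cV[R]_m -> (R -> P2 U) -> R -> 'cV[R]_m)
    (s : R) (y : 'cV[R]_m) : R :=
  sup [set \int[lebesgue_measure]_(r in `[s, T]) F r (X s y gamma r) (gamma r)
           + G (X s y gamma T) | gamma in admissible K eps L s T].

(* Main.v *)
Require Import Defs.
From HB Require Import structures.
From mathcomp Require Import all_boot all_order all_algebra.
From mathcomp Require Import all_classical all_reals all_analysis.
From mathcomp Require Import ring lra measurable_realfun.

Set Implicit Arguments.
Unset Strict Implicit.
Unset Printing Implicit Defensive.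

Import Order.TTheory GRing.Theory Num.Theory.
Import numFieldNormedType.Exports.

Local Open Scope classical_set_scope.
Local Open Scope ring_scope.

(** The control enters the state equation only through the drift, whose size and
    Lipschitz constant do not depend on the control.  Hence the distance between
    the states driven by zeta^n and by zeta is bounded by a constant times the
    rough path distance of the drivers, where the constant depends neither on
    the control nor on the initial condition ([states_close]).  Everything else
    follows: F is Lipschitz in the state, G is uniformly continuous on bounded
    sets, and the suprema of two families of payoffs that differ by at most e
    differ by at most e.

    The comparison of the states treats both equations in the same way.  Let
    psi_{st}(x) be the second-order step
    sigma(s, x) (z_t - z_s) + (D sigma sigma)(s, x) z2_{st}.  Chen's relation
    makes psi an almost flow: composing two steps differs from one long step by
    O(|t - s|^(3k)), where 3k > 1 ([rough_step_defect], [driver_flow_close]), and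
    drivers at distance e give almost flows at distance O(e).  A solution x
    satisfies x_t - x_s = psi_{st}(x_s) + D_{st} + o, where D is the integral of
    the drift and o stands for a term whose sums over fine partitions tend to 0
    ([sum_negligible]).  For the rough equation this is the definition of the
    rough integral, combined with the sewing estimate
    ([step_error_negligible]); for the smooth one it is a Taylor expansion, in
    which time is measured by the integral of 1 + |z'| because z' is only
    integrable ([smooth_error_negligible]).

    The defect of psi bounds the error r_{st} = |x_t - x_s - psi_{st}(x_s)| in
    terms of its values on the two halves of [s, t], up to a factor
    1 + C |t - s|^k on the first half and to O(|t - s|^(3k)).  Descending to fine
    partitions gives r_{st} = O(|t - s|) ([descent], [step_error_linear]).  The
    same argument for the difference of the errors of two solutions that remain
    at distance N gives (N + e) O(|t - s|) ([step_error_stability]).  On a short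
    interval the contribution of N is absorbed, and finitely many intervals of a
    length that does not depend on the data cover [s, T]
    ([coupled_solutions_close]).

    Two points of measure theory remain.  The paths zeta^n are differentiable
    everywhere, with a derivative that is only integrable; that such a derivative
    integrates to the increments of the path is [integral_of_derivative].  The
    integral of F is meaningful because r |-> F r (x r) (gamma r) is a pointwise
    limit of measurable functions that freeze the state and the control on the
    cells of a grid ([running_payoff_measurable]). *)

(** * Dyadic sums and the descent inequality *)

Lemma eventually_lt_exp2 (R : realType) (x h : R) : 0 < h -> exists j0, forall j, (j0 <= j)%N -> x < h * 2 ^+ j.
Proof.
move=> h0; exists (Num.truncn (x / h)).+1 => j j0j.
rewrite -ltr_pdivrMl // mulrC (lt_le_trans (truncnS_gt _)) //.
rewrite (@le_trans _ _ j%:R) ?ler_nat //.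
by rewrite -natrX ler_nat ltnW // ltn_expl.
Qed.

Section dyadic.
Context {R : realType}.
Implicit Types (s t u v a b : R).

Fixpoint dyadic_sum (V : zmodType) (g : R -> R -> V) (j : nat) s t : V :=
  if j is j'.+1 then
    dyadic_sum g j' s ((s + t) / 2) + dyadic_sum g j' ((s + t) / 2) t
  else g s t.

Lemma midpoint_bounds s t : s <= t -> s <= (s + t) / 2 /\ (s + t) / 2 <= t.
Proof. by move=> st; split; lra. Qed.

Lemma powR_half (x p : R) : 0 <= x -> (x / 2) `^ p = x `^ p * 2^-1 `^ p.
Proof. by move=> x0; rewrite powRM. Qed.

Lemma powR_half_lt1 (p : R) : 0 < p -> (2^-1 : R) `^ p < 1.
Proof.
move=> p0; have := @gt0_ltr_powR R p p0 2^-1 1; rewrite powR1.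
by apply; rewrite ?nnegrE ?ler01 ?invr_ge0 ?ler0n //; lra.
Qed.

Lemma powR_half_lt_half (p : R) : 1 < p -> 2 * (2^-1 : R) `^ p < 1.
Proof.
move=> p1; have := @powR_half_lt1 (p - 1) ltac:(lra).
rewrite powRB; last by apply/implyP => _; lra.
by rewrite powRr1 ?invrK; lra.
Qed.

Lemma ler_dyadic_sum (g g' : R -> R -> R) (a b : R) j s t :
  (forall s t, a <= s -> s <= t -> t <= b -> g s t <= g' s t) ->
  a <= s -> s <= t -> t <= b -> dyadic_sum g j s t <= dyadic_sum g' j s t.
Proof.
move=> gg'; elim: j s t => [|j IH] s t as_ st tb /=; first exact: gg'.
by have [sc ct] := midpoint_bounds st; apply: lerD; apply: IH => //; lra.
Qed.

Lemma dyadic_sumD (g g' : R -> R -> R) j s t :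
  dyadic_sum (fun s t => g s t + g' s t) j s t
  = dyadic_sum g j s t + dyadic_sum g' j s t.
Proof. by elim: j s t => [|j IH] s t //=; rewrite !IH; lra. Qed.

Lemma dyadic_sum_increment (V : zmodType) (w : R -> V) j s t :
  dyadic_sum (fun s t => w t - w s) j s t = w t - w s.
Proof.
elim: j s t => [|j IH] s t //=; rewrite !IH addrC.
by rewrite addrA subrK.
Qed.

(** A bound by o(w t - w s) for some monotone w, which is enough for the sums of g
    over fine partitions to vanish.  A bound by o(t - s) would not do: along a
    differentiable path the errors are controlled by the integral of the speed,
    which need not be Lipschitz in time. *)
Definition sum_negligible a b (g : R -> R -> R) : Prop :=
  exists2 w : R -> R,
    (forall s t, a <= s -> s <= t -> t <= b -> w s <= w t) &
    forall eta, 0 < eta -> exists2 h : R, 0 < h &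
      forall s t, a <= s -> s <= t -> t <= b -> t - s <= h ->
        g s t <= eta * (w t - w s).

(** The increments of w over the cells add up to w t - w s. *)
Lemma negligible_dyadic_sum a b (g : R -> R -> R) s t (e : R) :
  sum_negligible a b g -> a <= s -> s <= t -> t <= b -> 0 < e ->
  exists j0, forall j, (j0 <= j)%N -> dyadic_sum g j s t <= e.
Proof.
move=> [w wmono gw] as_ st tb e0.
have wst : 0 <= w t - w s by rewrite subr_ge0 wmono.
have eta0 : 0 < e / (w t - w s + 1) by apply: divr_gt0 => //; lra.
have [h h0 gh] := gw _ eta0.
have [j0 Hj0] := eventually_lt_exp2 (t - s) h0; exists j0 => j /Hj0/ltW small.
have claim i u v : a <= u -> u <= v -> v <= b -> v - u <= h * 2 ^+ i ->
    dyadic_sum g i u v <= e / (w t - w s + 1) * (w v - w u).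
  elim: i u v => [|i IH] u v au uv vb /=; first by rewrite mulr1; apply: gh.
  rewrite exprS => uvh; have [uc cv] := midpoint_bounds uv.
  have := IH u ((u + v) / 2) au uc ltac:(lra) ltac:(nra).
  have := IH ((u + v) / 2) v ltac:(lra) cv vb ltac:(nra).
  lra.
apply: (le_trans (claim _ _ _ as_ st tb small)).
rewrite mulrAC ler_pdivrMr; last lra.
by rewrite ler_wpM2l ?ltW //; lra.
Qed.

Lemma powR_negligible a b (C p : R) : 1 < p -> a <= b -> 0 <= C ->
  sum_negligible a b (fun s t => C * (t - s) `^ p).
Proof.
move=> p1 ab C0; exists id => // eta eta0.
exists ((eta / (C + 1)) `^ (p - 1)^-1); first by rewrite powR_gt0 // divr_gt0 //; lra.
move=> s t as_ st tb sth; rewrite -[p in X in X <= _](subrK 1) powRD; last first.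
  by apply/implyP; rewrite subrK => /eqP; lra.
rewrite powRr1 ?subr_ge0 // mulrA ler_wpM2r ?subr_ge0 //.
have : (t - s) `^ (p - 1) <= eta / (C + 1).
  have -> : eta / (C + 1) = ((eta / (C + 1)) `^ (p - 1)^-1) `^ (p - 1).
    rewrite -powRrM mulVf ?powRr1 ?divr_ge0 //; lra.
  by rewrite ge0_ler_powR ?nnegrE ?powR_ge0 //; lra.
rewrite ler_pdivlMr; last lra.
have := powR_ge0 (t - s) (p - 1); nra.
Qed.

Section descent.
Variables (a b k th C1 C2 : R) (r : R -> R -> R).
Hypotheses (k_gt0 : 0 < k) (th_gt1 : 1 < th) (C1_ge0 : 0 <= C1) (C2_ge0 : 0 <= C2).
Hypothesis r_ge0 : forall s t, a <= s -> s <= t -> t <= b -> 0 <= r s t.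
Hypothesis r_step : forall s t, a <= s -> s <= t -> t <= b ->
  r s t <= (1 + C1 * (t - s) `^ k) * r s ((s + t) / 2) + r ((s + t) / 2) t
           + C2 * (t - s) `^ th.

(** Bounds the product of the factors 1 + C1 h^k over h = x, x/2, x/4, and so on:
    the numbers C1 h^k form a geometric series of sum C1 x^k / (1 - 2^-k). *)
Definition descent_weight (x : R) := expR (C1 / (1 - 2^-1 `^ k) * x `^ k).
(** Sum of a geometric series: the dyadic level j has 2^j cells, each of which
    contributes C2 (h / 2^j)^th, and 2 * 2^-th < 1. *)
Definition descent_const := C2 / (1 - 2 * (2^-1) `^ th).

Lemma descent_const_ge0 : 0 <= descent_const.
Proof. by rewrite divr_ge0 //; have := powR_half_lt_half th_gt1; lra. Qed.

Lemma descent_weight_step (x : R) : 0 <= x ->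
  (1 + C1 * x `^ k) * descent_weight (x / 2) <= descent_weight x.
Proof.
move=> x0; rewrite /descent_weight powR_half //.
have q1 := powR_half_lt1 k_gt0; set q := 2^-1 `^ k in q1 *.
have -> : C1 / (1 - q) * x `^ k = C1 * x `^ k + C1 / (1 - q) * (x `^ k * q).
  by field; lra.
by rewrite expRD; apply: ler_wpM2r; [exact: expR_ge0|exact: expR_ge1Dx].
Qed.

Lemma descent_weight_ge1 (x : R) : 1 <= descent_weight x.
Proof.
apply: le_trans (expR_ge1Dx _); rewrite lerDl mulr_ge0 ?powR_ge0 // divr_ge0 //.
have := powR_half_lt1 k_gt0; lra.
Qed.

(** Iterating the inequality at midpoints reduces r to its sum over dyadic cells.
    Only the first half is multiplied by 1 + C1 h^k, but bounding both halves by
    this factor costs nothing, since the product over all levels is finite. *)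
Lemma descent j s t : a <= s -> s <= t -> t <= b ->
  r s t <= descent_weight (t - s)
           * (descent_const * (t - s) `^ th + dyadic_sum r j s t).
Proof.
have q1 := powR_half_lt_half th_gt1.
have M0 := descent_const_ge0.
have r_ds i u v : a <= u -> u <= v -> v <= b -> 0 <= dyadic_sum r i u v.
  elim: i u v => [|i IH] u v au uv vb /=; first exact: r_ge0.
  by have [? ?] := midpoint_bounds uv; rewrite addr_ge0 // IH //; lra.
elim: j s t => [|j IH] s t as_ st tb /=.
  rewrite -[leLHS]mul1r ler_pM ?descent_weight_ge1 ?r_ge0 //.
  by rewrite lerDr mulr_ge0 // powR_ge0.
have [sc ct] := midpoint_bounds st; set c := (s + t) / 2 in sc ct *.
have csE : c - s = (t - s) / 2 by rewrite /c; lra.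
have tcE : t - c = (t - s) / 2 by rewrite /c; lra.
have := IH s c as_ sc ltac:(lra); have := IH c t ltac:(lra) ct tb.
have D1 := r_ds j s c as_ sc ltac:(lra); have D2 := r_ds j c t ltac:(lra) ct tb.
rewrite csE tcE powR_half; last lra.
set W := descent_weight _; set D := dyadic_sum r j s c in D1 *.
set D' := dyadic_sum r j c t in D2 *.
set p := 2^-1 `^ th in q1 *; set X := (t - s) `^ th.
have X0 : 0 <= X by exact: powR_ge0.
move=> rct rsc; apply: (le_trans (r_step as_ st tb)); rewrite -/c -/X.
set B := 1 + _; have B1 : 1 <= B by rewrite lerDl mulr_ge0 // powR_ge0.
have W1 : 1 <= W := descent_weight_ge1 _.
set W' := descent_weight (t - s).
have BW : B * W <= W' by apply: descent_weight_step; lra.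
have p0 : 0 <= p := powR_ge0 _ _.
apply: (@le_trans _ _ (B * W * (descent_const * (X * p) + D)
   + B * W * (descent_const * (X * p) + D') + C2 * X)).
  have Y0 : 0 <= descent_const * (X * p) + D'.
    by apply: addr_ge0 => //; exact: mulr_ge0 M0 (mulr_ge0 X0 p0).
  rewrite lerD2r; apply: lerD; first by rewrite -mulrA; apply: ler_wpM2l => //; lra.
  apply: (le_trans rct); apply: ler_wpM2r => //.
  by rewrite -[leLHS]mul1r; apply: ler_wpM2r; lra.
have -> : C2 = descent_const * (1 - 2 * p).
  by rewrite /descent_const -/p mulfVK //; lra.
have W'1 : 1 <= W' := descent_weight_ge1 _.
apply: (@le_trans _ _ (W' * (descent_const * (X * p) + D)
   + W' * (descent_const * (X * p) + D') + W' * (descent_const * (1 - 2 * p) * X))).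
  have M1 : 0 <= descent_const * (1 - 2 * p) * X.
    by apply: mulr_ge0 => //; apply: mulr_ge0 => //; lra.
  have Y0 : 0 <= descent_const * (X * p) + D.
    by apply: addr_ge0 => //; exact: mulr_ge0 M0 (mulr_ge0 X0 p0).
  have Y0' : 0 <= descent_const * (X * p) + D'.
    by apply: addr_ge0 => //; exact: mulr_ge0 M0 (mulr_ge0 X0 p0).
  apply: lerD; first by apply: lerD; apply: ler_wpM2r.
  exact: ler_peMl.
by rewrite le_eqVlt; apply/orP; left; apply/eqP; ring.
Qed.

(** On small cells r is linear up to a negligible term.  The linear terms add up
    to the total length, and the negligible ones vanish as the level increases. *)
Lemma descent_bound (C3 : R) (g : R -> R -> R) s t : sum_negligible a b g ->
  (forall s t, a <= s -> s <= t -> t <= b -> r s t <= C3 * (t - s) + g s t) ->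
  a <= s -> s <= t -> t <= b ->
  r s t <= descent_weight (t - s) * (descent_const * (t - s) `^ th + C3 * (t - s)).
Proof.
move=> gneg rg as_ st tb; apply/ler_addgt0Pr => e e0.
have W0 : 0 < descent_weight (t - s) := expR_gt0 _.
have [j0 /(_ _ (leqnn _)) gj] :=
  negligible_dyadic_sum gneg as_ st tb (divr_gt0 e0 W0).
apply: (le_trans (descent j0 as_ st tb)).
have -> : e = descent_weight (t - s) * (e / descent_weight (t - s)).
  by rewrite mulrC mulfVK // gt_eqF.
rewrite -mulrDr ler_pM2l // -addrA lerD2l.
have : dyadic_sum r j0 s t <= dyadic_sum (fun s t => C3 * (t - s) + g s t) j0 s t.
  exact: (@ler_dyadic_sum _ _ a b).
move=> /le_trans; apply; rewrite dyadic_sumD lerD //.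
have := dyadic_sum_increment (fun t => C3 * t) j0 s t.
have -> : (fun s t => C3 * (t - s)) = (fun s t => C3 * t - C3 * s).
  by apply/funext => x; apply/funext => y; rewrite mulrBr.
by move=> ->; rewrite mulrBr.
Qed.

End descent.

(** Passing from level j to level j + 1 inserts 2^j midpoints, each of which costs
    C2 (h / 2^j)^th. *)
Lemma sewing_bound (V : normedZmodType R) (f : R -> R -> V) a b (th C2 : R) j s t :
  1 < th -> 0 <= C2 ->
  (forall s t, a <= s -> s <= t -> t <= b ->
    `|f s t - f s ((s + t) / 2) - f ((s + t) / 2) t| <= C2 * (t - s) `^ th) ->
  a <= s -> s <= t -> t <= b ->
  `|f s t - dyadic_sum f j s t| <= descent_const th C2 * (t - s) `^ th.
Proof.
move=> th1 C20 df; have q1 := powR_half_lt_half th1.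
have M0 := descent_const_ge0 th1 C20.
elim: j s t => [|j IH] s t as_ st tb /=.
  by rewrite subrr normr0 mulr_ge0 // powR_ge0.
have [sc ct] := midpoint_bounds st; set c := (s + t) / 2 in sc ct *.
have csE : c - s = (t - s) / 2 by rewrite /c; lra.
have tcE : t - c = (t - s) / 2 by rewrite /c; lra.
have := IH s c as_ sc ltac:(lra); have := IH c t ltac:(lra) ct tb.
rewrite csE tcE powR_half; last lra.
have := df s t as_ st tb; rewrite -/c.
set x := f s c; set y := f c t; set z := f s t.
set D := dyadic_sum f j s c; set D' := dyadic_sum f j c t.
set X := _ `^ th; set p := _ `^ th in q1 *.
move=> h1 h2 h3.
have -> : z - (D + D') = (z - x - y) + (x - D) + (y - D').
  rewrite opprD -[z in LHS](subrK x) -[z - x in LHS](subrK y) -!addrA.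
  by congr (_ + (_ + (_ + _))); rewrite addrCA; congr (_ + _); rewrite addrCA.
apply: (le_trans (ler_normD _ _)).
have := ler_normD (z - x - y) (x - D).
have X0 : 0 <= X := powR_ge0 _ _.
have : C2 = descent_const th C2 * (1 - 2 * p).
  by rewrite /descent_const -/p mulfVK //; lra.
nra.
Qed.

End dyadic.

(** * Almost flows and the paths that follow them *)

Ltac mx_ring := apply/matrixP => ? ?; rewrite !mxE; ring.

Lemma ler_add_interchange (R : realDomainType) (x y p q z w1 w2 n h : R) :
  p <= z * x + w1 * n * h -> q <= w2 * n * h ->
  x + y + (p + q) <= (1 + z) * x + y + (w1 + w2) * n * h.
Proof. lra. Qed.

Lemma absorb_half (R : realFieldType) (n N A P e : R) :
  n <= N -> N <= A + P * (A + e) + (N + e) / 2 -> n + e <= 2 * (1 + P) * (A + e).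
Proof. lra. Qed.

Section almost_flow.
Context {R : realType} {m : nat}.
Notation V := 'cV[R]_m.
Implicit Types (psi : R -> R -> V -> V) (x : R -> V) (D : R -> R -> V).

(** It vanishes if psi, the increment of a one-step scheme, composes as the
    increment of a flow does. *)
Definition flow_defect psi s u t p := psi s u p + psi u t (p + psi s u p) - psi s t p.

Definition step_error psi x s t := x t - x s - psi s t (x s).

Record almost_flow (k C a b : R) psi : Prop := {
  almost_flow_bound : forall s t p, a <= s -> s <= t -> t <= b ->
    `|psi s t p| <= C * (t - s) `^ k ;
  almost_flow_lipschitz : forall s t p q, a <= s -> s <= t -> t <= b ->
    `|psi s t p - psi s t q| <= C * (t - s) `^ k * `|p - q| ;
  almost_flow_defect : forall s u t p, a <= s -> s <= u -> u <= t -> t <= b ->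
    `|flow_defect psi s u t p| <= C * (t - s) `^ (3 * k) }.

(** The base points p and p' are allowed to differ, so that the distance of two
    flows can be evaluated along two different paths. *)
Record close_flows (k C e a b : R) psi psi' : Prop := {
  close_flows_step : forall s t p p', a <= s -> s <= t -> t <= b ->
    `|psi s t p - psi' s t p'| <= C * (t - s) `^ k * (`|p - p'| + e) ;
  close_flows_increment : forall s t p p' q q', a <= s -> s <= t -> t <= b ->
    `|(psi s t (p + q) - psi s t p) - (psi' s t (p' + q') - psi' s t p')|
    <= C * (t - s) `^ k * (`|q - q'| + (`|p - p'| + e) * `|q'|) ;
  close_flows_defect : forall s u t p p',
    a <= s -> s <= u -> u <= t -> t <= b ->
    `|flow_defect psi s u t p - flow_defect psi' s u t p'|
    <= C * (t - s) `^ (3 * k) * (`|p - p'| + e) }.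

(** D s t is the contribution of the drift to the increment of x. *)
Record flow_solution (C3 a b : R) psi x D : Prop := {
  flow_solution_drift : forall s t, a <= s -> s <= t -> t <= b ->
    `|D s t| <= C3 * (t - s) ;
  flow_solution_error : sum_negligible a b (fun s t => `|step_error psi x s t - D s t|) }.

Lemma almost_flow_sub (k C a b a' b' : R) psi :
  a <= a' -> b' <= b -> almost_flow k C a b psi -> almost_flow k C a' b' psi.
Proof.
move=> aa bb [P1 P2 P3]; split.
- by move=> s t p /(le_trans aa) as_ st /le_trans/(_ bb) tb; exact: P1.
- by move=> s t p q /(le_trans aa) as_ st /le_trans/(_ bb) tb; exact: P2.
- by move=> s u t p /(le_trans aa) as_ su ut /le_trans/(_ bb) tb; exact: P3.
Qed.

Lemma close_flows_sub (k C e a b a' b' : R) psi psi' :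
  a <= a' -> b' <= b -> close_flows k C e a b psi psi' -> close_flows k C e a' b' psi psi'.
Proof.
move=> aa bb [P1 P2 P3]; split.
- by move=> s t p p' /(le_trans aa) as_ st /le_trans/(_ bb) tb; exact: P1.
- by move=> s t p p' q q' /(le_trans aa) as_ st /le_trans/(_ bb) tb; exact: P2.
- by move=> s u t p p' /(le_trans aa) as_ su ut /le_trans/(_ bb) tb; exact: P3.
Qed.

(** The additivity of the error fails by two effects: the step from u starts at
    x u rather than at the end of the step from s, and psi does not compose. *)
Lemma step_error_cocycle psi x s u t :
  step_error psi x s t - step_error psi x s u - step_error psi x u t
  = (psi u t ((x s + psi s u (x s)) + step_error psi x s u)
     - psi u t (x s + psi s u (x s))) + flow_defect psi s u t (x s).
Proof.
have -> : x s + psi s u (x s) + step_error psi x s u = x u.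
  by rewrite /step_error; mx_ring.
by rewrite /step_error /flow_defect; mx_ring.
Qed.

Lemma ler_powR_base (x y p : R) : 0 <= p -> 0 <= x -> x <= y -> x `^ p <= y `^ p.
Proof. by move=> p0 x0 xy; rewrite ge0_ler_powR ?nnegrE // (le_trans x0). Qed.

Lemma ler_powR_horizon (T h p q : R) : 0 <= h <= T -> 0 < q <= p ->
  h `^ p <= T `^ (p - q) * h `^ q.
Proof.
move=> /andP[h0 hT] /andP[q0 qp].
have -> : h `^ p = h `^ (p - q) * h `^ q.
  by rewrite -powRD subrK //; apply/implyP => /eqP ?; exfalso; lra.
rewrite ler_wpM2r ?powR_ge0 // ge0_ler_powR ?nnegrE //; lra.
Qed.

Lemma small_powR (L eps w : R) : 0 < eps -> 0 <= L -> 0 < w ->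
  exists2 h : R, 0 < h & forall r, 0 <= r -> r < h -> L * r `^ eps < w.
Proof.
move=> eps0 L0 w0; exists ((w / (L + 1)) `^ eps^-1).
  by rewrite powR_gt0 // divr_gt0 //; lra.
move=> r r0 rh; have : r `^ eps < w / (L + 1).
  have -> : w / (L + 1) = ((w / (L + 1)) `^ eps^-1) `^ eps.
    by rewrite -powRrM mulVf ?gt_eqF // powRr1 // divr_ge0; lra.
  by apply: gt0_ltr_powR => //; rewrite nnegrE ?powR_ge0.
rewrite ltr_pdivlMr; last lra.
have := powR_ge0 r eps; lra.
Qed.

Lemma negligibleD (a b : R) (g g' : R -> R -> R) :
  sum_negligible a b g -> sum_negligible a b g' ->
  sum_negligible a b (fun s t => g s t + g' s t).
Proof.
move=> [w wm gw] [w' wm' gw']; exists (fun t => w t + w' t).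
  by move=> s t *; rewrite lerD ?wm ?wm'.
move=> eta eta0; have [h h0 H] := gw _ eta0; have [h' h'0 H'] := gw' _ eta0.
exists (Num.min h h'); first by rewrite lt_min h0.
move=> s t as_ st tb; rewrite le_min => /andP[hh hh'].
have := H s t as_ st tb hh; have := H' s t as_ st tb hh'; lra.
Qed.

Lemma negligible_sub (a b a' b' : R) (g : R -> R -> R) : a <= a' -> b' <= b ->
  sum_negligible a b g -> sum_negligible a' b' g.
Proof.
move=> aa bb [w wm gw]; exists w.
  by move=> s t *; apply: wm => //; lra.
move=> eta eta0; have [h h0 H] := gw _ eta0; exists h => // s t *.
by apply: H => //; lra.
Qed.

Lemma ler_negligible (a b : R) (g g' : R -> R -> R) :
  (forall s t, a <= s -> s <= t -> t <= b -> g s t <= g' s t) ->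
  sum_negligible a b g' -> sum_negligible a b g.
Proof.
move=> gg' [w wm gw]; exists w => // eta eta0; have [h h0 H] := gw _ eta0.
by exists h => // s t as_ st tb hh; apply: le_trans (gg' _ _ _ _ _) (H _ _ _ _ _ _).
Qed.

Variables (k T : R).
Hypotheses (k_gt : 3^-1 < k) (k_le : k <= 2 / 5) (T_gt0 : 0 < T).

(** On a bounded horizon the term of order 3k > 1 is dominated by a linear one.
    The constant is independent of the interval and proportional to e. *)
Lemma descent_bound_linear (C1 C2 C3 : R) :
  0 <= C1 -> 0 <= C2 -> 0 <= C3 -> exists2 C : R, 0 <= C &
  forall (a b e : R) (r g : R -> R -> R), 0 <= e -> b - a <= T ->
  (forall s t, a <= s -> s <= t -> t <= b -> 0 <= r s t) ->
  (forall s t, a <= s -> s <= t -> t <= b ->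
    r s t <= (1 + C1 * (t - s) `^ k) * r s ((s + t) / 2) + r ((s + t) / 2) t
           + C2 * e * (t - s) `^ (3 * k)) ->
  sum_negligible a b g ->
  (forall s t, a <= s -> s <= t -> t <= b -> r s t <= C3 * e * (t - s) + g s t) ->
  forall s t, a <= s -> s <= t -> t <= b -> r s t <= C * e * (t - s).
Proof.
move=> C10 C20 C30.
have [k13 k25 T0] := And3 k_gt k_le T_gt0.
have k0 : 0 < k by lra.
have th1 : 1 < 3 * k by lra.
have q1 := powR_half_lt_half th1.
exists (expR (C1 / (1 - 2^-1 `^ k) * T `^ k)
        * (descent_const (3 * k) C2 * T `^ (3 * k - 1) + C3)).
  apply: mulr_ge0 (expR_ge0 _) _; apply: addr_ge0 => //.
  exact: mulr_ge0 (descent_const_ge0 _ _) (powR_ge0 _ _).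
move=> a b e r g e0 baT r0 rstep gneg rg s t as_ st tb.
have C2e : 0 <= C2 * e by rewrite mulr_ge0.
have ts0 : 0 <= t - s by rewrite subr_ge0.
have tsT : t - s <= T by apply: le_trans baT; apply: lerB.
apply: (le_trans (descent_bound k0 th1 C10 C2e r0 rstep gneg rg as_ st tb)).
rewrite -[leRHS]mulrA -[leRHS]mulrA; apply: ler_pM; first exact: expR_ge0.
- apply: addr_ge0.
    exact: mulr_ge0 (descent_const_ge0 _ _) (powR_ge0 _ _).
  by rewrite !mulr_ge0 ?subr_ge0.
- rewrite ler_expR ler_wpM2l //.
    by rewrite divr_ge0 //; have := powR_half_lt1 k0; lra.
  exact: ler_powR_base (ltW k0) ts0 tsT.
have := @ler_powR_horizon T (t - s) (3 * k) 1; rewrite powRr1 //.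
rewrite ts0 tsT ltr01 (ltW th1) => /(_ isT isT) pT.
rewrite [leRHS]mulrDl; apply: lerD; last by rewrite mulrA.
have -> : descent_const (3 * k) (C2 * e) = descent_const (3 * k) C2 * e.
  by rewrite /descent_const mulrAC.
set M := descent_const _ _.
have M0 : 0 <= M * e by apply: mulr_ge0 => //; exact: descent_const_ge0.
apply: (@le_trans _ _ (M * e * (T `^ (3 * k - 1) * (t - s)))); first exact: ler_wpM2l.
by rewrite le_eqVlt; apply/orP; left; apply/eqP; ring.
Qed.

(** The error has exactly the form required by the descent: the first term of
    the cocycle is a Lipschitz bound for the step from the midpoint, with
    constant of order |t - s|^k, and the second is the defect. *)
Lemma step_error_linear (C C3 : R) : 0 <= C -> 0 <= C3 ->
  exists2 CR : R, 0 <= CR & forall a b psi x D, b - a <= T ->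
    almost_flow k C a b psi -> flow_solution C3 a b psi x D ->
    forall s t, a <= s -> s <= t -> t <= b ->
      `|step_error psi x s t| <= CR * (t - s).
Proof.
move=> C0 C30; have [CR CR0 H] := descent_bound_linear C0 C0 C30.
have k0 : 0 <= k by have := k_gt; lra.
exists CR => // a b psi x D baT [Pb Pl Pd] [Db Dn] s t as_ st tb.
rewrite -[CR]mulr1; apply: (H a b 1 (fun s t => `|step_error psi x s t|) _ ler01 baT _ _ Dn) => //; last first.
  move=> u v au uv vb; rewrite mulr1.
  have := ler_normD (D u v) (step_error psi x u v - D u v).
  by rewrite [D u v + _]addrC subrK; have := Db u v au uv vb; lra.
move=> u v au uv vb; rewrite mulr1; have [uc cv] := midpoint_bounds uv.
set c := (u + v) / 2 in uc cv *.
have -> : step_error psi x u v = step_error psi x u c + step_error psi x c v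
  + ((step_error psi x u v - step_error psi x u c - step_error psi x c v)).
  by mx_ring.
rewrite step_error_cocycle; set p := x u + _; set r := step_error psi x u c.
have h1 := Pl c v (p + r) p (le_trans au uc) cv vb.
have h2 := Pd u c v (x u) au uc cv vb.
have cvk : (v - c) `^ k <= (v - u) `^ k.
  by apply: ler_powR_base; [exact: k0|rewrite subr_ge0|exact: lerB].
apply: (le_trans (ler_normD _ _)); apply: (le_trans (lerD (ler_normD _ _) (ler_normD _ _))).
have e1 : p + r - p = r by rewrite addrAC subrr add0r.
rewrite e1 in h1.
have h3 : C * (v - c) `^ k * `|r| <= C * (v - u) `^ k * `|r|.
  by rewrite ler_wpM2r // ler_wpM2l.
rewrite -[C in C * (v - u) `^ (3 * k)]mulr1 -[C in C * 1]add0r.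
by apply: ler_add_interchange; rewrite ?mul0r ?addr0 ?mulr1 //; exact: le_trans h1 h3.
Qed.

(** The descent is applied to the difference of the two errors.  By the linear
    bound, the quadratic term of [close_flows_increment] is of order k + 1, which
    is at least 3k. *)
Lemma step_error_stability (C C3 : R) : 0 <= C -> 0 <= C3 ->
  exists2 C7 : R, 0 <= C7 & forall a b e N psi psi' x x' D D',
    0 <= e -> 0 <= N -> b - a <= T ->
    almost_flow k C a b psi' -> close_flows k C e a b psi psi' ->
    flow_solution C3 a b psi x D -> flow_solution C3 a b psi' x' D' ->
    (forall r, a <= r <= b -> `|x r - x' r| <= N) ->
    (forall s t, a <= s -> s <= t -> t <= b -> `|D s t - D' s t| <= C3 * N * (t - s)) ->
    forall s t, a <= s -> s <= t -> t <= b ->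
      `|step_error psi x s t - step_error psi' x' s t| <= C7 * (N + e) * (t - s).
Proof.
move=> C0 C30; have [CR CR0 HR] := step_error_linear C0 C30.
have [k13 k25 T0] := And3 k_gt k_le T_gt0.
have k0 : 0 <= k by lra.
have k1 : 0 < k + 1 by lra.
have k3 : 0 < 3 * k <= k + 1 by lra.
have Tk0 := powR_ge0 T k; have TP0 := powR_ge0 T (k + 1 - 3 * k).
have C20 : 0 <= C * (2 + C * T `^ k) * CR * T `^ (k + 1 - 3 * k) + C.
  by rewrite addr_ge0 // !mulr_ge0 // addr_ge0 // mulr_ge0.
have [C7 C70 H] := descent_bound_linear C0 C20 C30.
exists C7 => // a b e N psi psi' x x' D D' e0 N0 baT F' [Cs Ci Cd] S S' xN DN s t as_ st tb.
have R'b := HR a b psi' x' D' baT F' S'.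
have [Db Dn] := S; have [D'b D'n] := S'.
have Ne0 : 0 <= N + e by lra.
apply: (H a b (N + e) (fun s t => `|step_error psi x s t - step_error psi' x' s t|)
  _ Ne0 baT _ _ (negligibleD Dn D'n)) => //; last first.
  move=> u v au uv vb.
  have -> : `|step_error psi x u v - step_error psi' x' u v| = `|(D u v - D' u v)
      + ((step_error psi x u v - D u v) - (step_error psi' x' u v - D' u v))|.
    by congr `|_|; mx_ring.
  apply: (le_trans (ler_normD _ _)); apply: lerD; last exact: ler_normB.
  apply: (le_trans (DN _ _ au uv vb)); rewrite ler_wpM2r ?subr_ge0 //.
  by rewrite ler_wpM2l // lerDl.
move=> u v au uv vb; have [uc cv] := midpoint_bounds uv.
set c := (u + v) / 2 in uc cv *.
have cb : c <= b := le_trans cv vb.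
have ac : a <= c := le_trans au uc.
have cuT : c - u <= T by apply: le_trans baT; apply: lerB.
have vuT : v - u <= T by apply: le_trans baT; apply: lerB.
have cu0 : 0 <= c - u by rewrite subr_ge0.
have vc0 : 0 <= v - c by rewrite subr_ge0.
have vcu : v - c <= v - u by apply: lerB.
have vu0 : 0 <= v - u := le_trans vc0 vcu.
have cvu : c - u <= v - u by apply: lerB.
have xu : `|x u - x' u| <= N by apply: xN; rewrite au (le_trans uv vb).
have cvk := ler_powR_base k0 vc0 vcu.
have hz : (v - u) `^ (k + 1) <= T `^ (k + 1 - 3 * k) * (v - u) `^ (3 * k).
  apply: ler_powR_horizon; first by rewrite vu0.
  exact: k3.
rewrite powRD in hz; last by rewrite (gt_eqF k1).
rewrite powRr1 // in hz.
have -> : step_error psi x u v - step_error psi' x' u v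
  = (step_error psi x u c - step_error psi' x' u c)
  + (step_error psi x c v - step_error psi' x' c v)
  + ((step_error psi x u v - step_error psi x u c - step_error psi x c v)
     - (step_error psi' x' u v - step_error psi' x' u c - step_error psi' x' c v)).
  by mx_ring.
rewrite (step_error_cocycle psi x u c v) (step_error_cocycle psi' x' u c v); set p := x u + _; set p' := x' u + _.
set r := step_error psi x u c; set r' := step_error psi' x' u c.
have -> : psi c v (p + r) - psi c v p + flow_defect psi u c v (x u)
    - (psi' c v (p' + r') - psi' c v p' + flow_defect psi' u c v (x' u))
  = (psi c v (p + r) - psi c v p - (psi' c v (p' + r') - psi' c v p'))
    + (flow_defect psi u c v (x u) - flow_defect psi' u c v (x' u)) by mx_ring.
have h1 := Ci c v p p' r r' ac cv vb.
have h2 := Cd u c v (x u) (x' u) au uc cv vb.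
have h4 := Cs u c (x u) (x' u) au uc cb.
have rb := R'b u c au uc cb; rewrite -/r' in rb.
have pp : `|p - p'| + e <= (2 + C * T `^ k) * (N + e).
  have -> : p - p' = (x u - x' u) + (psi u c (x u) - psi' u c (x' u)).
    by rewrite /p /p'; mx_ring.
  have n1 := ler_normD (x u - x' u) (psi u c (x u) - psi' u c (x' u)).
  have n2 : C * (c - u) `^ k * (`|x u - x' u| + e) <= C * T `^ k * (N + e).
    apply: ler_pM; rewrite ?mulr_ge0 ?powR_ge0 ?addr_ge0 ?lerD2r //.
    by apply: ler_wpM2l => //; exact: ler_powR_base.
  have n3 := le_trans n1 (lerD xu (le_trans h4 n2)).
  apply: le_trans (lerD n3 (lexx e)) _.
  by rewrite addrAC mulrDl lerD2r mulr_natl mulr2n lerDl.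
have vk0 := powR_ge0 (v - u) k; have vk30 := powR_ge0 (v - u) (3 * k).
apply: (le_trans (ler_normD _ _)); apply: (le_trans (lerD (ler_normD _ _) (ler_normD _ _))).
have h1' : C * (v - c) `^ k * (`|r - r'| + (`|p - p'| + e) * `|r'|) <=
    C * (v - u) `^ k * `|r - r'|
    + C * (2 + C * T `^ k) * CR * T `^ (k + 1 - 3 * k) * (N + e) * (v - u) `^ (3 * k).
  apply: (@le_trans _ _ (C * (v - u) `^ k * (`|r - r'| + (`|p - p'| + e) * `|r'|))).
    by apply: ler_wpM2r; [rewrite addr_ge0 // mulr_ge0 // addr_ge0 | exact: ler_wpM2l].
  rewrite mulrDr lerD2l.
  apply: (@le_trans _ _ (C * (v - u) `^ k * ((2 + C * T `^ k) * (N + e) * (CR * (v - u))))).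
    rewrite ler_wpM2l ?mulr_ge0 // ler_pM ?addr_ge0 //.
    by apply: (le_trans rb); rewrite ler_wpM2l.
  set A := (v - u) `^ k in hz *; set B := T `^ (k + 1 - 3 * k) in hz *.
  set Y := (v - u) `^ (3 * k) in hz *; set Z := 2 + _.
  apply: (@le_trans _ _ (C * Z * CR * (N + e) * (A * (v - u)))).
    by rewrite le_eqVlt; apply/orP; left; apply/eqP; ring.
  apply: (@le_trans _ _ (C * Z * CR * (N + e) * (B * Y))).
    by rewrite ler_wpM2l // !mulr_ge0 // addr_ge0 // mulr_ge0.
  by rewrite le_eqVlt; apply/orP; left; apply/eqP; ring.
have h2' : C * (v - u) `^ (3 * k) * (`|x u - x' u| + e) <= C * (N + e) * (v - u) `^ (3 * k).
  by rewrite mulrAC ler_wpM2r // ler_wpM2l // lerD2r.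
apply: ler_add_interchange; first exact: le_trans h1 h1'.
exact: le_trans h2 h2'.
Qed.

(** The drift contributions may depend on the whole paths; only their Lipschitz
    dependence on the sup distance is recorded. *)
Record coupled_solutions (C C3 e a b : R) psi psi' x x' D D' : Prop := {
  coupled_flow : almost_flow k C a b psi ;
  coupled_flow' : almost_flow k C a b psi' ;
  coupled_close : close_flows k C e a b psi psi' ;
  coupled_solution : flow_solution C3 a b psi x D ;
  coupled_solution' : flow_solution C3 a b psi' x' D' ;
  coupled_drift : forall s t N, a <= s -> s <= t -> t <= b ->
    (forall r, s <= r <= t -> `|x r - x' r| <= N) ->
    `|D s t - D' s t| <= C3 * N * (t - s) }.

Lemma coupled_solutions_sub (C C3 e a b a' b' : R) psi psi' x x' D D' :
  a <= a' -> b' <= b -> coupled_solutions C C3 e a b psi psi' x x' D D' ->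
  coupled_solutions C C3 e a' b' psi psi' x x' D D'.
Proof.
move=> aa bb [F F' Q [S1 S2] [S1' S2'] H].
have le1 s : a' <= s -> a <= s by exact: le_trans.
have le2 s : s <= b' -> s <= b by move=> /le_trans; exact.
split; [exact: almost_flow_sub F|exact: almost_flow_sub F'|exact: close_flows_sub Q| | |].
- by split; [move=> s t /le1 as_ st /le2 tb; exact: S1|exact: negligible_sub S2].
- by split; [move=> s t /le1 as_ st /le2 tb; exact: S1'|exact: negligible_sub S2'].
- by move=> s t N /le1 as_ st /le2 tb; exact: H.
Qed.

(** The sup distance N of the paths on [a, b] is at most a multiple of the initial
    distance and of e, plus C7 (N + e) (b - a).  If b - a is small with respect to
    1 / C7, the last term is at most (N + e) / 2, and N is absorbed.  The bounds on
    the step errors give beforehand that N is finite. *)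
Lemma coupled_solutions_window (C C3 : R) : 0 <= C -> 0 <= C3 ->
  exists h K : R, [/\ 0 < h, 1 <= K &
    forall a b e psi psi' x x' D D', 0 <= e -> b - a <= T -> b - a <= h ->
    coupled_solutions C C3 e a b psi psi' x x' D D' ->
    forall t, a <= t <= b -> `|x t - x' t| + e <= K * (`|x a - x' a| + e)].
Proof.
move=> C0 C30; have [CR CR0 HR] := step_error_linear C0 C30.
have [C7 C70 H7] := step_error_stability C0 C30.
have [k13 k25 T0] := And3 k_gt k_le T_gt0.
have Tk0 := powR_ge0 T k; have CTk0 : 0 <= C * T `^ k by rewrite mulr_ge0.
(* On a window of this length C7 (b - a) <= 1/2. *)
have k0 : 0 <= k by lra.
have C7h : C7 * (2 * (C7 + 1))^-1 <= 2^-1 by rewrite ler_pdivrMr; lra.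
exists (2 * (C7 + 1))^-1, (2 * (1 + C * T `^ k)); split; [|lra|].
  by rewrite invr_gt0; lra.
move=> a b e psi psi' x x' D D' e0 baT bah [F F' Q S S' DD] t /andP[at_ tb].
have ab : a <= b by lra.
have moves (psi0 : R -> R -> V -> V) x0 D0 r : almost_flow k C a b psi0 ->
    flow_solution C3 a b psi0 x0 D0 -> a <= r -> r <= b ->
    `|x0 r - x0 a| <= C * T `^ k + CR * T.
  move=> F0 S0 ar rb; have ra0 : 0 <= r - a by rewrite subr_ge0.
  have raT : r - a <= T by apply: le_trans baT; apply: lerB.
  have h1 := HR _ _ _ _ _ baT F0 S0 a r (lexx _) ar rb.
  have h2 := almost_flow_bound F0 (x0 a) (lexx a) ar rb.
  have -> : x0 r - x0 a = psi0 a r (x0 a) + step_error psi0 x0 a r.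
    by rewrite /step_error; mx_ring.
  rewrite (le_trans (ler_normD _ _)) // lerD //.
    apply: (le_trans h2); apply: ler_wpM2l => //; exact: ler_powR_base.
  by apply: (le_trans h1); apply: ler_wpM2l.
pose A := [set `|x r - x' r| | r in [set r | a <= r <= b]].
have hsA : has_sup A.
  split; first by exists `|x a - x' a|, a => //=; rewrite lexx.
  exists (`|x a - x' a| + 2 * (C * T `^ k + CR * T)) => _ [r /andP[ar rb] <-].
  have -> : x r - x' r = (x a - x' a) + ((x r - x a) - (x' r - x' a)) by mx_ring.
  have := moves _ _ _ _ F S ar rb; have := moves _ _ _ _ F' S' ar rb.
  have := ler_normD (x a - x' a) ((x r - x a) - (x' r - x' a)).
  have := ler_normB (x r - x a) (x' r - x' a); lra.
have xN r : a <= r <= b -> `|x r - x' r| <= sup A.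
  by move=> arb; apply: ub_le_sup; [exact: hsA.2|exists r].
have N0 : 0 <= sup A by apply: le_trans (xN a _) => //; lra.
set N := sup A in xN N0.
have step r : a <= r <= b ->
    `|x r - x' r| <= `|x a - x' a| + C * T `^ k * (`|x a - x' a| + e) + (N + e) / 2.
  move=> /andP[ar rb].
  have h1 := H7 a b e N psi psi' x x' D D' e0 N0 baT F' Q S S' xN _ a r (lexx _) ar rb.
  have {h1} := h1 _; have dd : forall s t, a <= s -> s <= t -> t <= b ->
      `|D s t - D' s t| <= C3 * N * (t - s).
    by move=> u v au uv vb; apply: DD => // z ?; apply: xN; lra.
  move=> /(_ dd) h1.
  have -> : x r - x' r = (x a - x' a) + (psi a r (x a) - psi' a r (x' a))
      + (step_error psi x a r - step_error psi' x' a r).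
    by rewrite /step_error; mx_ring.
  apply: (le_trans (ler_normD _ _)); apply: lerD.
    apply: (le_trans (ler_normD _ _)); rewrite lerD2l.
    apply: (le_trans (close_flows_step Q _ _ _ _ _)) => //.
    apply: ler_wpM2r; first exact: addr_ge0.
    apply: ler_wpM2l => //; apply: ler_powR_base => //; first by rewrite subr_ge0.
    by apply: le_trans baT; apply: lerB.
  apply: (le_trans h1).
  have ra : C7 * (r - a) <= 2^-1.
    apply: (@le_trans _ _ (C7 * (2 * (C7 + 1))^-1)).
      by apply: ler_wpM2l => //; apply: le_trans bah; apply: lerB.
    exact: C7h.
  have Ne : 0 <= N + e := addr_ge0 N0 e0.
  by have := ler_wpM2r Ne ra; rewrite mulrAC [2^-1 * _]mulrC.
have NA : N <= `|x a - x' a| + C * T `^ k * (`|x a - x' a| + e) + (N + e) / 2.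
  by apply: ge_sup => [|_ [r ? <-]]; [case: hsA|exact: step].
by apply: absorb_half NA; apply: xN; rewrite at_.
Qed.

(** The bound of one window is chained; the number of windows depends on T only. *)
Theorem coupled_solutions_close (C C3 : R) : 0 <= C -> 0 <= C3 ->
  exists2 K : R, 0 <= K &
    forall a b e psi psi' x x' D D', 0 <= e -> b - a <= T -> x a = x' a ->
    coupled_solutions C C3 e a b psi psi' x x' D D' ->
    forall t, a <= t <= b -> `|x t - x' t| <= K * e.
Proof.
move=> C0 C30; have [h [K [h0 K1 H]]] := coupled_solutions_window C0 C30.
have K0 : 0 <= K by lra.
exists (K ^+ (Num.truncn (T / h)).+1); first exact: exprn_ge0.
move=> a b e psi psi' x x' D D' e0 baT xa CS t /andP[at_ tb].
have claim n r : a <= r -> r <= b -> r - a <= n%:R * h -> `|x r - x' r| + e <= K ^+ n * e.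
  elim: n r => [|n IH] r ar rb.
    rewrite mul0r => ra; have -> : r = a by apply/eqP; rewrite eq_le; lra.
    by rewrite xa subrr normr0 add0r expr0 mul1r.
  rewrite -natr1 mulrDl mul1r => ran; rewrite exprS.
  have [rn|/ltW rn] := leP (r - a) (n%:R * h).
    apply: (le_trans (IH _ ar rb rn)); rewrite ler_wpM2r //.
    by apply: ler_peMl => //; exact: exprn_ge0.
  have n0 : 0 <= n%:R * h by rewrite mulr_ge0 // ltW.
  set u := a + n%:R * h.
  have au : a <= u by rewrite /u; lra.
  have ur : u <= r by rewrite /u; lra.
  have := IH u au (le_trans ur rb) ltac:(rewrite /u; lra).
  have := H u r e psi psi' x x' D D' e0 ltac:(rewrite /u; lra) ltac:(rewrite /u; lra)
     (coupled_solutions_sub au rb CS) r ltac:(lra).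
  move=> /le_trans h1 h2; apply: h1; rewrite -mulrA ler_wpM2l //.
have := claim (Num.truncn (T / h)).+1 t at_ tb _.
have : T <= (Num.truncn (T / h)).+1%:R * h.
  by rewrite -ler_pdivrMr // ltW // truncnS_gt.
move=> Tn /(_ ltac:(lra)); lra.
Qed.

End almost_flow.

(** * Taylor expansions from partial derivatives *)

Lemma ler_norm_sum_ord (R : numDomainType) (V : normedZmodType R) n (F : 'I_n -> V) (c : R) :
  (forall i, `|F i| <= c) -> `|\sum_i F i| <= n%:R * c.
Proof.
move=> Fc; apply: (le_trans (ler_norm_sum _ _ _)).
apply: (@le_trans _ _ (\sum_(j < n) c)); first exact: ler_sum.
by rewrite sumr_const card_ord mulr_natl.
Qed.

Section matrix_norm.
Context {R : realType} {p q : nat}.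
Implicit Types (A : 'M[R]_(p, q)).

Lemma ler_mx_entry A i j : `|A i j| <= `|A|.
Proof.
rewrite [leRHS]/Num.Def.normr /= mx_normrE.
exact: (le_bigmax _ (fun ij : 'I_p * 'I_q => `|A ij.1 ij.2|) (i, j)).
Qed.

Lemma ler_mx_norm A c : 0 <= c -> (forall i j, `|A i j| <= c) -> `|A| <= c.
Proof.
move=> c0 Ac; rewrite [leLHS]/Num.Def.normr /= mx_normrE.
by apply: bigmax_le => // -[i j] _; exact: Ac.
Qed.

End matrix_norm.

Section directional.
Context {R : realType} {m p q : nat}.
Notation V := 'cV[R]_m.
Notation W := 'M[R]_(p, q).
Implicit Types (f : V -> W) (x y v : V).

Lemma mean_value_bound (g dg : R -> R) (a b K : R) : a <= b ->
  (forall t, a < t < b -> is_derive t 1 g (dg t)) ->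
  {within `[a, b], continuous g} ->
  (forall t, a <= t <= b -> `|dg t| <= K) -> `|g b - g a| <= K * (b - a).
Proof.
move=> ab gd gc gK.
have [t /[!in_itv]/= tab ->] := MVT_segment ab (fun t tab => gd t (tab : a < t < b)) gc.
by rewrite normrM ler_pM // ?gK // ger0_norm // subr_ge0.
Qed.

Lemma derivable_line f x v (t : R) i j : derivable f (x + t *: v) v ->
  is_derive t 1 (fun t => f (x + t *: v) i j) ('D_v f (x + t *: v) i j).
Proof.
move=> df; have dfij : derivable (fun y => f y i j) (x + t *: v) v.
  by move/derivable_mxP: df; apply.
have E : (fun h : R => h^-1 *: ((fun t => f (x + t *: v) i j) (h *: 1 + t)
    - (fun t => f (x + t *: v) i j) t))
  = (fun h : R => h^-1 *: ((fun y => f y i j) (h *: v + (x + t *: v))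
      - (fun y => f y i j) (x + t *: v))).
  apply/funext => h /=; congr (_ *: (f _ i j - _)).
  by rewrite addrCA [h *: 1]mulr1 scalerDl.
apply: DeriveDef; first by rewrite /derivable /= E.
by rewrite derive_mx // mxE /derive /= E.
Qed.

Lemma directional_bound f x v (A : W) (tau K : R) : 0 <= K ->
  (forall t : R, `|t| <= `|tau| -> derivable f (x + t *: v) v) ->
  (forall t : R, `|t| <= `|tau| -> `|'D_v f (x + t *: v) - A| <= K) ->
  `|f (x + tau *: v) - f x - tau *: A| <= K * `|tau|.
Proof.
move=> K0 df dK; apply: ler_mx_norm => [|i j]; first by rewrite mulr_ge0.
pose g (t : R) := f (x + t *: v) i j - t * A i j.
have gd (t : R) : `|t| <= `|tau| -> is_derive t 1 g ('D_v f (x + t *: v) i j - A i j).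
  move=> ttau; have h1 := derivable_line i j (df _ ttau).
  have h2 : is_derive t 1 (fun t : R => t * A i j) (A i j).
    have -> : (fun t : R => t * A i j) = (A i j \*: id) :> (R -> R).
      by apply/funext => z /=; rewrite mulrC.
    by apply: is_derive_eq; rewrite /GRing.scale /= mulr1.
  exact: is_deriveB.
have gK (t : R) : `|t| <= `|tau| -> `|'D_v f (x + t *: v) i j - A i j| <= K.
  by move=> /dK; apply: le_trans; have := ler_mx_entry ('D_v f (x + t *: v) - A) i j; rewrite !mxE.
have gc (t : R) : `|t| <= `|tau| -> {for t, continuous g}.
  move=> ttau; apply/differentiable_continuous/derivable1_diffP.
  by have := gd _ ttau; case.
have -> : (f (x + tau *: v) - f x - tau *: A) i j = g tau - g 0.
  by rewrite /g scale0r addr0 mul0r subr0 !mxE; ring.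
have [t0|t0] := leP 0 tau.
- rewrite (ger0_norm t0) -[tau in leRHS]subr0.
  apply: (@mean_value_bound g (fun t => 'D_v f (x + t *: v) i j - A i j) 0 tau K t0).
  + by move=> t /andP[? ?]; apply: gd; rewrite (ger0_norm t0) ger0_norm ltW.
  + apply: continuous_in_subspaceT => t /[!inE] /= /[!in_itv] /= /andP[? ?].
    by apply: gc; rewrite (ger0_norm t0) ger0_norm.
  + by move=> t /andP[? ?]; apply: gK; rewrite (ger0_norm t0) ger0_norm.
- rewrite distrC (ltr0_norm t0) -[- tau]add0r;
  apply: (@mean_value_bound g (fun t => 'D_v f (x + t *: v) i j - A i j) tau 0 K (ltW t0)).
  + by move=> t /andP[? ?]; apply: gd; rewrite (ltr0_norm t0) ltr0_norm ?lerN2 ?ltW.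
  + apply: continuous_in_subspaceT => t /[!inE] /= /[!in_itv] /= /andP[? ?].
    by apply: gc; rewrite (ltr0_norm t0) ler0_norm ?lerN2.
  + by move=> t /andP[? ?]; apply: gK; rewrite (ltr0_norm t0) ler0_norm ?lerN2.
Qed.

Definition e_ (j : 'I_m) : V := delta_mx j 0.

Definition prefix_mx (n : nat) v : V := \col_i (if (i < n)%N then v i 0 else 0).

Lemma prefix_mx0 v : prefix_mx 0 v = 0.
Proof. by apply/matrixP => i j; rewrite !mxE. Qed.

Lemma prefix_mx_full v : prefix_mx m v = v.
Proof. by apply/matrixP => i j; rewrite !mxE ltn_ord (ord1 j). Qed.

Lemma prefix_mxS v (j : 'I_m) : prefix_mx j.+1 v = prefix_mx j v + v j 0 *: e_ j.
Proof.
apply/matrixP => i i'; rewrite !mxE ltnS leq_eqVlt (ord1 i') eqxx andbT /=.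
have [->|ij] := eqVneq i j; first by rewrite ltnn add0r eqxx mulr1.
by rewrite (negbTE (ij : (i : nat) != j)) mulr0 addr0.
Qed.

Lemma prefix_mx_norm n v (j : 'I_m) (t : R) : `|t| <= `|v j 0| -> (n <= j)%N ->
  `|prefix_mx n v + t *: e_ j| <= `|v|.
Proof.
move=> tv nj; apply: ler_mx_norm => // i i'; rewrite !mxE (ord1 i') eqxx andbT.
have [-> /=|ij /=] := eqVneq i j.
  by rewrite ltnNge nj /= add0r mulr1 (le_trans tv) // ler_mx_entry.
rewrite mulr0 addr0; case: ifP => _; first exact: ler_mx_entry.
by rewrite normr0.
Qed.

(** One coordinate is moved at a time, so that only partial derivatives occur. *)
Lemma taylor1_bound f (Df : 'I_m -> W) y v (K : R) : 0 <= K ->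
  (forall j z, derivable f z (e_ j)) ->
  (forall j z, `|z| <= `|v| -> `|'D_(e_ j) f (y + z) - Df j| <= K) ->
  `|f (y + v) - f y - \sum_j v j 0 *: Df j| <= m%:R * K * `|v|.
Proof.
move=> K0 fd fK.
have claim n : (n <= m)%N -> `|f (y + prefix_mx n v) - f y
    - \sum_(j < m | (j < n)%N) v j 0 *: Df j| <= n%:R * K * `|v|.
  elim: n => [_|n IH nm].
    by rewrite prefix_mx0 addr0 subrr big_pred0 ?subr0 ?normr0 ?mul0r // => j; rewrite ltn0.
  pose j := Ordinal nm; have -> : n.+1 = j.+1 by [].
  rewrite prefix_mxS (bigD1 j) //=.
  have -> : \sum_(i < m | (i < n.+1)%N && (i != j)) v i 0 *: Df i
      = \sum_(i < m | (i < n)%N) v i 0 *: Df i.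
    apply: eq_bigl => i; rewrite ltnS leq_eqVlt -val_eqE /=.
    by case: (eqVneq (i : nat) n) => [->|] /=; rewrite ?ltnn ?andbF ?andbT.
  set S := \sum_(i < m | _) _; set w := prefix_mx n v.
  have -> : f (y + (w + v j 0 *: e_ j)) - f y - (v j 0 *: Df j + S)
    = (f (y + w) - f y - S)
      + (f (y + w + v j 0 *: e_ j) - f (y + w) - v j 0 *: Df j).
    by rewrite addrA; mx_ring.
  apply: (le_trans (ler_normD _ _)).
  rewrite -natr1 mulrDl mulrDl mul1r lerD //; first by rewrite IH // ltnW.
  apply: (@le_trans _ _ (K * `|v j 0|)); last by rewrite ler_wpM2l // ler_mx_entry.
  apply: directional_bound => // t tv; rewrite -addrA.
  by apply: fK; exact: prefix_mx_norm.
have := claim m (leqnn _); rewrite prefix_mx_full.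
by under eq_bigl do rewrite ltn_ord.
Qed.

Lemma lipschitz_of_partials f (Df : 'I_m -> V -> W) (K : R) : 0 <= K ->
  (forall j z, is_derive z (e_ j) f (Df j z)) -> (forall j z, `|Df j z| <= K) ->
  forall x y, `|f x - f y| <= m%:R * K * `|x - y|.
Proof.
move=> K0 fd fK x y.
have := @taylor1_bound f (fun=> 0) y (x - y) K K0 _ _.
rewrite [y + _]addrC subrK big1 => [|j _]; last by rewrite scaler0.
rewrite subr0; apply=> j z; first by case: (fd j z).
by rewrite subr0; case: (fd j (y + z)) => _ ->.
Qed.

Definition lin_part (Df : 'I_m -> V -> W) x v : W := \sum_j v j 0 *: Df j x.

Definition taylor_rem f (Df : 'I_m -> V -> W) x v : W := f (x + v) - f x - lin_part Df x v.

Lemma lin_part_bound (B : 'I_m -> V -> W) y (c : V) (K : R) : (forall j, `|B j y| <= K) ->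
  `|lin_part B y c| <= m%:R * (`|c| * K).
Proof.
move=> BK; apply: ler_norm_sum_ord => j; rewrite normrZ; apply: ler_pM => //; exact: ler_mx_entry.
Qed.

Lemma lin_partZ (Df : 'I_m -> V -> W) y (c : R) v :
  lin_part Df y (c *: v) = c *: lin_part Df y v.
Proof.
by rewrite /lin_part scaler_sumr; apply: eq_bigr => j _; rewrite !mxE scalerA.
Qed.

Lemma lin_partB (Df : 'I_m -> V -> W) y v w :
  lin_part Df y (v - w) = lin_part Df y v - lin_part Df y w.
Proof.
by rewrite /lin_part -sumrB; apply: eq_bigr => j _; rewrite !mxE scalerBl.
Qed.

Lemma derive_shift f v z w D : is_derive (z + w) v f D ->
  is_derive z v (fun y => f (y + w)) D.
Proof.
have E : (fun h : R => h^-1 *: ((fun y => f (y + w)) (h *: v + z) - (fun y => f (y + w)) z))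
   = (fun h : R => h^-1 *: (f (h *: v + (z + w)) - f (z + w))).
  by apply/funext => h /=; rewrite addrA.
by case=> d1 d2; apply: DeriveDef; rewrite /derivable /derive /= E.
Qed.

Lemma derive_increment f v z w D D' : is_derive (z + w) v f D -> is_derive z v f D' ->
  is_derive z v (fun y => f (y + w) - f y) (D - D').
Proof.
move=> /derive_shift d1 d2.
have -> : (fun y => f (y + w) - f y) = (fun y => f (y + w)) - f by [].
exact: is_deriveB d1 d2.
Qed.

Lemma taylor_rem_arith (L L2 a d n n' : R) : 0 <= L -> 0 <= L2 -> 0 <= a ->
  0 <= d -> 0 <= n -> 0 <= n' -> d <= n + n' ->
  L2 * a + L * d ^+ 2 + d * (L * n') <= (2 * L + L2) * (a + d * (n + n')).
Proof.
move=> L0 L20 a0 d0 n0 n'0 dn.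
have h1 : L * d ^+ 2 <= L * (d * (n + n')) by rewrite ler_wpM2l // expr2 ler_wpM2l.
have h2 : 0 <= L * a by rewrite mulr_ge0.
have h3 : 0 <= L2 * (d * (n + n')) by rewrite !mulr_ge0 // addr_ge0.
have h4 : 0 <= L * (d * n) by rewrite !mulr_ge0.
lra.
Qed.

Section partials.
Variables (f : V -> W) (Df : 'I_m -> V -> W) (L : R).
Hypothesis L_ge0 : 0 <= L.
Hypothesis f_derive : forall j z, is_derive z (e_ j) f (Df j z).
Hypothesis Df_lipschitz : forall j x y, `|Df j x - Df j y| <= L * `|x - y|.

Lemma taylor2_bound y v : `|taylor_rem f Df y v| <= m%:R * L * `|v| ^+ 2.
Proof.
rewrite expr2 mulrA -[m%:R * L * _]mulrA.
apply: taylor1_bound => [|j z|j z zv]; first by rewrite mulr_ge0.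
  by case: (f_derive j z).
have [_ ->] := f_derive j (y + z).
by apply: (le_trans (Df_lipschitz _ _ _)); rewrite addrC addKr ler_wpM2l.
Qed.

(** By the second-order bound on the Taylor remainder, which involves partial
    derivatives only. *)
Lemma derive_of_partials y v : is_derive y v f (lin_part Df y v).
Proof.
suff cv : h^-1 *: (f (h *: v + y) - f y) @[h --> 0^'] --> lin_part Df y v.
  by apply: DeriveDef; [apply/cvg_ex; exists (lin_part Df y v) | apply/cvg_lim].
apply/cvgrPdist_le => /= e e0.
pose C := m%:R * L * `|v| ^+ 2 + 1.
have C0 : 0 < C by rewrite ltr_wpDl // !mulr_ge0 // exprn_ge0.
near=> h.
have h0 : h != 0 by near: h; exact: nbhs_dnbhs_neq.
have hC : `|h| <= e / C by near: h; apply: dnbhs0_le; exact: divr_gt0.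
have := taylor2_bound y (h *: v).
rewrite /taylor_rem lin_partZ; move: (lin_part Df y v) => S H.
rewrite distrC [h *: v + y]addrC.
have -> : h^-1 *: (f (y + h *: v) - f y) - S
   = h^-1 *: (f (y + h *: v) - f y - h *: S).
  by rewrite [RHS]scalerBr scalerA mulVf // scale1r.
rewrite normrZ normfV ler_pdivrMl ?normr_gt0 //.
apply: (le_trans H); rewrite normrZ exprMn.
apply: (@le_trans _ _ (`|h| * (`|h| * C))).
  by rewrite mulrCA expr2 -mulrA ler_wpM2l // ler_wpM2l // /C lerDl.
rewrite ler_wpM2l // -ler_pdivlMr //.
Unshelve. all: by end_near. Qed.

Lemma increment_bound x y w :
  `|f (x + w) - f x - (f (y + w) - f y)| <= m%:R * L * `|w| * `|x - y|.
Proof.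
rewrite -[m%:R * L * _]mulrA.
apply: (@lipschitz_of_partials (fun y => f (y + w) - f y)
  (fun j z => Df j (z + w) - Df j z)) => [|j z|j z].
- by rewrite mulr_ge0.
- exact: derive_increment.
- by apply: (le_trans (Df_lipschitz _ _ _)); rewrite addrC addKr.
Qed.

Variable L2 : R.
Hypothesis L2_ge0 : 0 <= L2.
Hypothesis Df_increment : forall j x y w,
  `|Df j (x + w) - Df j x - (Df j (y + w) - Df j y)| <= L2 * `|w| * `|x - y|.

(** In y, the function f (y + x - x') - f y has small partial derivatives, so
    that its Taylor remainder is controlled without symmetry of the second
    derivatives. *)
Lemma taylor_rem_base x x' v :
  `|taylor_rem f Df x v - taylor_rem f Df x' v| <= m%:R * L2 * `|x - x'| * `|v| ^+ 2.
Proof.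
pose F y := f (y + (x - x')) - f y.
have x'x : x' + (x - x') = x by rewrite addrC subrK.
have x'vx : x' + v + (x - x') = x + v by rewrite addrAC x'x.
have dF z : is_derive z v F (lin_part Df (z + (x - x')) v - lin_part Df z v).
  exact: derive_increment (derive_of_partials _ _) (derive_of_partials _ _).
have -> : taylor_rem f Df x v - taylor_rem f Df x' v
    = F (x' + 1 *: v) - F x' - 1 *: (lin_part Df x v - lin_part Df x' v).
  rewrite /F /taylor_rem !scale1r x'vx x'x.
  move: (lin_part Df x v) (lin_part Df x' v) (f (x + v)) (f x) (f (x' + v)) (f x').
  by move=> a1 a2 a3 a4 a5 a6; mx_ring.
have K0 : 0 <= m%:R * L2 * `|x - x'| * `|v| ^+ 2 by rewrite !mulr_ge0 // exprn_ge0.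
suff H : forall t : R, `|t| <= `|1 : R| -> `|'D_v F (x' + t *: v)
    - (lin_part Df x v - lin_part Df x' v)| <= m%:R * L2 * `|x - x'| * `|v| ^+ 2.
  have := @directional_bound F x' v _ 1 _ K0 (fun t _ => @ex_derive _ _ _ _ _ _ _ (dF _)) H.
  by rewrite normr1 mulr1.
move=> t; rewrite normr1 => t1; have [_ ->] := dF (x' + t *: v).
have -> : x' + t *: v + (x - x') = x + t *: v by rewrite addrAC x'x.
pose B j (_ : V) := Df j (x + t *: v) - Df j x - (Df j (x' + t *: v) - Df j x').
have -> : lin_part Df (x + t *: v) v - lin_part Df (x' + t *: v) v
    - (lin_part Df x v - lin_part Df x' v) = lin_part B x v.
  rewrite /lin_part -!sumrB; apply: eq_bigr => j _; rewrite /B.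
  move: (Df j (x + t *: v)) (Df j (x' + t *: v)) (Df j x) (Df j x') (v j 0).
  by move=> a1 a2 a3 a4 c; mx_ring.
apply: (le_trans (@lin_part_bound B x v (L2 * `|v| * `|x - x'|) _)) => [j|].
  apply: (le_trans (Df_increment _ _ _ _)); rewrite ler_wpM2r // ler_wpM2l // normrZ.
  by rewrite ler_piMl.
by rewrite le_eqVlt; apply/orP; left; apply/eqP; ring.
Qed.

(** Changing the base point uses the increments of Df.  Changing the increment
    from v' to v leaves the remainder at x' + v' and the variation of Df between
    x' and x' + v'. *)
Lemma taylor_rem_lipschitz x x' v v' :
  `|taylor_rem f Df x v - taylor_rem f Df x' v'|
    <= m%:R * (2 * L + L2) * (`|x - x'| * `|v| ^+ 2 + `|v - v'| * (`|v| + `|v'|)).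
Proof.
have h1 := taylor_rem_base x x' v.
have h2 := taylor2_bound (x' + v') (v - v').
pose B j (_ : V) := Df j (x' + v') - Df j x'.
have -> : taylor_rem f Df x v - taylor_rem f Df x' v'
  = (taylor_rem f Df x v - taylor_rem f Df x' v) + taylor_rem f Df (x' + v') (v - v')
    + lin_part B x' (v - v').
  have -> : lin_part B x' (v - v')
      = lin_part Df (x' + v') (v - v') - (lin_part Df x' v - lin_part Df x' v').
    rewrite -lin_partB /lin_part -!sumrB; apply: eq_bigr => j _.
    by rewrite scalerBr.
  have E : x' + v' + (v - v') = x' + v by mx_ring.
  rewrite /taylor_rem E.
  move: (lin_part Df x v) (lin_part Df x' v) (lin_part Df x' v') (lin_part Df (x' + v') (v - v')).
  move: (f (x + v)) (f x) (f (x' + v)) (f x') (f (x' + v')).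
  by move=> a1 a2 a3 a4 a5 a6 a7 a8 a9; mx_ring.
have h3 : `|lin_part B x' (v - v')| <= m%:R * (`|v - v'| * (L * `|v'|)).
  apply: lin_part_bound => j.
  by apply: (le_trans (Df_lipschitz _ _ _)); rewrite addrC addKr.
apply: (le_trans (ler_normD _ _)); apply: (le_trans (lerD (ler_normD _ _) (lexx _))).
apply: (le_trans (lerD (lerD h1 h2) h3)) => {h1 h2 h3}.
have vv := ler_normB v v'; rewrite -!mulrA -!mulrDr ler_wpM2l //.
apply: taylor_rem_arith vv => //.
Qed.

End partials.

End directional.

(** * Derivatives relative to an interval *)

Section relative_derivative.
Context {R : realType}.

Lemma derive_in_approx (V : normedModType R) (A : set R) (f : R -> V) (t e : R) :
  derivable_in A f t -> 0 < e -> exists2 h : R, 0 < h & forall u, A u -> `|u - t| < h ->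
    `|f u - f t - (u - t) *: derive_in A f t| <= e * `|u - t|.
Proof.
move=> /cvgrPdist_le /(_ e) H e0; have {H} := H e0; rewrite near_withinE.
rewrite /dnbhs near_withinE => /nbhs_ballP[h /= h0 hf].
exists h => // u Au uth; have [->|ut] := eqVneq u t.
  by rewrite !subrr scale0r subr0 !normr0 mulr0.
have := hf u; rewrite /ball /= distrC => /(_ uth ut Au); rewrite distrC.
have ut0 : u - t != 0 by rewrite subr_eq0.
move=> Hu; rewrite mulrC -ler_pdivrMl ?normr_gt0 // -normfV -normrZ.
by rewrite scalerBr scalerA mulVf // scale1r.
Qed.

Lemma within_continuous_dist (V W : normedModType R) (A : set V) (f : V -> W) :
  {within A, continuous f} <-> forall x, A x -> forall e : R, 0 < e ->
    exists2 h : R, 0 < h & forall y, A y -> `|y - x| < h -> `|f y - f x| < e.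
Proof.
split=> [/subspace_continuousP fc x Ax e e0|fc].
  have /cvgrPdist_lt /(_ e e0) := fc x Ax.
  rewrite near_withinE => /nbhs_ballP[h /= h0 hf]; exists h => // y Ay yx.
  rewrite distrC; apply: hf => //.
  by have := @ball_normE _ V => <-; rewrite /ball_ /= distrC.
apply/subspace_continuousP => x Ax; apply/cvgrPdist_lt => e e0.
rewrite near_withinE; have [h h0 hf] := fc x Ax e e0; apply/nbhs_ballP; exists h => //= y.
by have := @ball_normE _ V => <-; rewrite /ball_ /= distrC => yx Ay; rewrite distrC hf.
Qed.

Lemma within_continuous_entry (V : normedModType R) p q (A : set V) (f : V -> 'M[R]_(p, q)) i j :
  {within A, continuous f} -> {within A, continuous (fun x => f x i j)}.
Proof.
move=> /within_continuous_dist fc; apply/within_continuous_dist => x Ax e e0.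
have [h h0 hf] := fc x Ax e e0; exists h => // y Ay yx; apply: le_lt_trans (hf y Ay yx).
by have := ler_mx_entry (f y - f x) i j; rewrite !mxE.
Qed.

Lemma derivable_in_continuous (V : normedModType R) (A : set R) (f : R -> V) :
  (forall t, A t -> derivable_in A f t) -> {within A, continuous f}.
Proof.
move=> fd; apply/within_continuous_dist => t At e e0.
have [h h0 hf] := derive_in_approx (fd t At) ltr01.
pose M := `|derive_in A f t| + 1; have M0 : 0 < M by rewrite ltr_wpDl.
exists (Num.min h (e / (2 * M))); first by rewrite lt_min h0 divr_gt0 // mulr_gt0.
move=> u Au; rewrite lt_min => /andP[uh ue].
have := hf u Au uh; rewrite mul1r => H.
have := ler_normD (f u - f t - (u - t) *: derive_in A f t) ((u - t) *: derive_in A f t).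
rewrite subrK normrZ => H2; apply: (le_lt_trans H2).
apply: (@le_lt_trans _ _ (`|u - t| * M)); first by rewrite /M mulrDr mulr1 addrC lerD.
rewrite ltr_pdivlMr in ue; last by rewrite mulr_gt0.
by apply: le_lt_trans ue; rewrite ler_wpM2l //; lra.
Qed.

Lemma derivable_in_is_derive (p q : nat) (A : set R) (f : R -> 'M[R]_(p, q)) (t r : R) i j :
  0 < r -> (forall u, `|u - t| < r -> A u) ->
  derivable_in A f t -> is_derive t 1 (fun u => f u i j) (derive_in A f t i j).
Proof.
move=> r0 rA fd.
suff cv : h^-1 *: (f (h *: 1 + t) i j - f t i j) @[h --> (0 : R)^'] --> derive_in A f t i j.
  by apply: DeriveDef; [apply/cvg_ex; eexists; exact: cv | exact/cvg_lim].
apply/cvgrPdist_le => e e0; have [h h0 hf] := derive_in_approx fd e0.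
near=> u.
have u0 : u != 0 by near: u; exact: nbhs_dnbhs_neq.
have ur : `|u| < r by near: u; exact: dnbhs0_lt.
have uh : `|u| < h by near: u; exact: dnbhs0_lt.
have Eu : u *: 1 + t - t = u by rewrite addrK [_ *: _]mulr1.
have := hf (u *: 1 + t); rewrite Eu => /(_ (rA _ _) uh); rewrite Eu => /(_ ur) H.
have := le_trans (ler_mx_entry _ i j) H; rewrite !mxE.
move=> H2.
have -> : derive_in A f t i j - u^-1 *: (f (u *: 1 + t) i j - f t i j)
  = - (u^-1 * (f (u *: 1 + t) i j - f t i j - u * derive_in A f t i j)).
  by rewrite -[u^-1 *: _]/(u^-1 * _); field.
rewrite normrN.
by rewrite normrM normfV ler_pdivrMl ?normr_gt0 // [leRHS]mulrC.
Unshelve. all: by end_near. Qed.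

Lemma lipschitz_of_derive_in (p q : nat) (a b C : R) (f : R -> 'M[R]_(p, q)) :
  (forall t, a <= t <= b -> derivable_in `[a, b] f t) ->
  (forall t, a <= t <= b -> `|derive_in `[a, b] f t| <= C) ->
  forall s t, a <= s <= b -> a <= t <= b -> `|f t - f s| <= C * `|t - s|.
Proof.
move=> fd fC.
have main s t : a <= s -> s <= t -> t <= b -> `|f t - f s| <= C * (t - s).
  move=> as_ st tb.
  have C0 : 0 <= C by apply: le_trans (fC s _); [exact: normr_ge0|lra].
  apply: ler_mx_norm => [|i j]; first by rewrite mulr_ge0 // subr_ge0.
  rewrite !mxE.
  apply: (@mean_value_bound _ (fun u => f u i j) (fun u => derive_in `[a, b] f u i j)) => //.
  - move=> u /andP[su ut]; apply: (@derivable_in_is_derive _ _ _ _ _ (Num.min (u - s) (t - u))).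
    + by rewrite lt_min !subr_gt0 su.
    + move=> v; rewrite lt_min => /andP[]; rewrite !ltr_norml /= in_itv /=; lra.
    + by apply: fd; lra.
  - apply: (continuous_subspaceW (B := `[a, b]%classic)).
      by move=> u; rewrite /= !in_itv /=; lra.
    apply: within_continuous_entry.
    by apply: derivable_in_continuous => u; rewrite /= in_itv; exact: fd.
  - move=> u ?; apply: le_trans (ler_mx_entry _ _ _) (fC _ _); lra.
move=> s t /andP[as_ sb] /andP[at_ tb].
have [st|/ltW ts] := leP s t.
  by rewrite ger0_norm ?subr_ge0 //; exact: main.
by rewrite distrC [`|t - s|]distrC ger0_norm ?subr_ge0 //; exact: main.
Qed.

End relative_derivative.

(** * Coefficients with bounded derivatives *)

Lemma finite_uniform_bound (R : realType) (I : finType) (P : I -> R -> Prop) :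
  (forall i C C', C <= C' -> P i C -> P i C') ->
  (forall i, exists C, P i C) -> exists2 C, 0 <= C & forall i, P i C.
Proof.
move=> Pmono PC; have [c cP] := choice PC.
exists (\sum_i `|c i|); first by rewrite sumr_ge0.
move=> i; apply: Pmono (cP i); rewrite (bigD1 i) //= (le_trans (ler_norm _)) //.
by rewrite lerDl sumr_ge0.
Qed.

Section smooth_coefficient.
Context {R : realType} {m p q : nat}.
Notation V := 'cV[R]_m.
Variables (T : R) (f : R -> V -> 'M[R]_(p, q)).
Hypothesis T_gt0 : 0 < T.
Hypothesis f_Cb : Cb T 1 3 f.
Implicit Types beta : seq 'I_m.

Lemma Cb_is_derive beta t (j : 'I_m) x : (size beta < 3)%N -> 0 <= t <= T ->
  is_derive x (e_ j) (partial_x f beta t) (partial_x f (j :: beta) t x).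
Proof. by move=> b3 t0; apply: DeriveDef => //; exact: (Cb_derivable_x f_Cb). Qed.

Lemma Cb_bounded_x beta : (size beta <= 3)%N -> exists2 C, 0 <= C &
  forall t x, 0 <= t <= T -> `|partial_x f beta t x| <= C.
Proof.
move=> b3; have [C HC] := Cb_bounded f_Cb (leq0n 1) b3.
by exists `|C| => // t x t0; apply: le_trans (HC _ _ t0) (ler_norm _).
Qed.

Lemma Cb_partials_bounded beta : (size beta < 3)%N -> exists2 C, 0 <= C &
  forall (j : 'I_m) t x, 0 <= t <= T -> `|partial_x f (j :: beta) t x| <= C.
Proof.
move=> b3; apply: (@finite_uniform_bound R 'I_m (fun j C => forall t x, 0 <= t <= T ->
    `|partial_x f (j :: beta) t x| <= C)) => [j C C' CC' H t x t0|j].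
  exact: le_trans (H t x t0) CC'.
by have [C _ HC] := @Cb_bounded_x (j :: beta) b3; exists C.
Qed.

Lemma Cb_lipschitz_x beta : (size beta < 3)%N -> exists2 C, 0 <= C &
  forall t x y, 0 <= t <= T ->
    `|partial_x f beta t x - partial_x f beta t y| <= C * `|x - y|.
Proof.
move=> b3; have [C C0 HC] := Cb_partials_bounded b3.
exists (m%:R * C); first by rewrite mulr_ge0.
move=> t x y t0; apply: (@lipschitz_of_partials _ _ _ _ _
  (fun j => partial_x f (j :: beta) t)) => // [j z|j z]; first exact: Cb_is_derive.
exact: HC.
Qed.

Lemma Cb_partials_lipschitz beta : (size beta < 2)%N -> exists2 C, 0 <= C &
  forall (j : 'I_m) t x y, 0 <= t <= T ->
    `|partial_x f (j :: beta) t x - partial_x f (j :: beta) t y| <= C * `|x - y|.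
Proof.
move=> b2; apply: (@finite_uniform_bound R 'I_m (fun j C => forall t x y, 0 <= t <= T ->
    `|partial_x f (j :: beta) t x - partial_x f (j :: beta) t y| <= C * `|x - y|)).
  by move=> j C C' CC' H t x y t0; apply: le_trans (H t x y t0) _; rewrite ler_wpM2r.
by move=> j; have [C _ HC] := @Cb_lipschitz_x (j :: beta) b2; exists C.
Qed.

Lemma Cb_lipschitz_t beta : (size beta <= 3)%N -> exists2 C, 0 <= C &
  forall s t x, 0 <= s <= T -> 0 <= t <= T ->
    `|partial_x f beta t x - partial_x f beta s x| <= C * `|t - s|.
Proof.
move=> b3; have [C HC] := Cb_bounded f_Cb (leqnn 1) b3; exists `|C| => // s t x s0 t0.
apply: (@lipschitz_of_derive_in _ _ _ 0 T `|C| (fun t => partial_x f beta t x)) => // u u0.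
  exact: (Cb_derivable_t f_Cb (i := 0%N)).
exact: le_trans (HC u x u0) (ler_norm _).
Qed.

Lemma Cb_partials_lipschitz_t beta : (size beta < 3)%N -> exists2 C, 0 <= C &
  forall (j : 'I_m) s t x, 0 <= s <= T -> 0 <= t <= T ->
    `|partial_x f (j :: beta) t x - partial_x f (j :: beta) s x| <= C * `|t - s|.
Proof.
move=> b3; apply: (@finite_uniform_bound R 'I_m (fun j C => forall s t x,
    0 <= s <= T -> 0 <= t <= T ->
    `|partial_x f (j :: beta) t x - partial_x f (j :: beta) s x| <= C * `|t - s|)).
  by move=> j C C' CC' H s t x s0 t0; apply: le_trans (H s t x s0 t0) _; rewrite ler_wpM2r.
by move=> j; have [C _ HC] := @Cb_lipschitz_t (j :: beta) b3; exists C.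
Qed.

(** The mean value inequality in x for f t - f s, whose partial derivatives are
    of order |t - s|. *)
Lemma Cb_mixed beta : (size beta < 3)%N -> exists2 C, 0 <= C &
  forall s t x y, 0 <= s <= T -> 0 <= t <= T ->
    `|partial_x f beta t x - partial_x f beta s x
      - (partial_x f beta t y - partial_x f beta s y)| <= C * `|t - s| * `|x - y|.
Proof.
move=> b3; have [C C0 HC] := Cb_partials_lipschitz_t b3.
exists (m%:R * C); first by rewrite mulr_ge0.
move=> s t x y s0 t0; rewrite -[m%:R * C * _]mulrA.
apply: (@lipschitz_of_partials _ _ _ _ (partial_x f beta t - partial_x f beta s)
  (fun j z => partial_x f (j :: beta) t z - partial_x f (j :: beta) s z)) => [|j z|j z].
- by rewrite mulr_ge0.
- by apply: is_deriveB; exact: Cb_is_derive.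
- exact: HC.
Qed.

Lemma Cb_increment beta : (size beta < 2)%N -> exists2 C, 0 <= C &
  forall t x y v, 0 <= t <= T ->
    `|partial_x f beta t (x + v) - partial_x f beta t x
      - (partial_x f beta t (y + v) - partial_x f beta t y)| <= C * `|v| * `|x - y|.
Proof.
move=> b2; have [C C0 HC] := Cb_partials_lipschitz b2.
exists (m%:R * C); first by rewrite mulr_ge0.
move=> t x y v t0; apply: (increment_bound (Df := fun j => partial_x f (j :: beta) t)) => //.
  by move=> j z; apply: Cb_is_derive => //; exact: ltnW.
by move=> j z z'; exact: HC.
Qed.

Lemma Cb_partials_increment : exists2 C, 0 <= C & forall (j : 'I_m) t x y v, 0 <= t <= T ->
    `|partial_x f [:: j] t (x + v) - partial_x f [:: j] t x
      - (partial_x f [:: j] t (y + v) - partial_x f [:: j] t y)| <= C * `|v| * `|x - y|.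
Proof.
apply: (@finite_uniform_bound R 'I_m (fun j C => forall t x y v, 0 <= t <= T ->
    `|partial_x f [:: j] t (x + v) - partial_x f [:: j] t x
      - (partial_x f [:: j] t (y + v) - partial_x f [:: j] t y)| <= C * `|v| * `|x - y|)).
  move=> j C C' CC' H t x y v t0; apply: le_trans (H t x y v t0) _.
  by rewrite !ler_wpM2r.
by move=> j; have [C _ HC] := @Cb_increment [:: j] isT; exists C.
Qed.

Lemma Cb_taylor : exists2 C, 0 <= C & forall t, 0 <= t <= T ->
  let rem := taylor_rem (f t) (fun j => partial_x f [:: j] t) in
  (forall x v, `|rem x v| <= C * `|v| ^+ 2) /\
  (forall x x' v v', `|rem x v - rem x' v'|
     <= C * (`|x - x'| * `|v| ^+ 2 + `|v - v'| * (`|v| + `|v'|))).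
Proof.
have [L L0 HL] := @Cb_partials_lipschitz [::] isT.
have [L2 L20 HL2] := Cb_partials_increment.
have fd t j z : 0 <= t <= T -> is_derive z (e_ j) (f t) (partial_x f [:: j] t z).
  exact: (@Cb_is_derive [::]).
exists (m%:R * (2 * L + L2)); first by rewrite !mulr_ge0 // addr_ge0 // mulr_ge0.
move=> t t0; split=> [x v|x x' v v'].
  apply: (le_trans (@taylor2_bound _ _ _ _ (f t) _ L L0 _ _ x v)) => [j z|j z z'|].
  - exact: fd.
  - exact: HL.
  by rewrite ler_wpM2r ?exprn_ge0 // ler_wpM2l //; lra.
apply: taylor_rem_lipschitz => // [j z|j z z'|j z z' w]; first exact: fd.
  exact: HL.
exact: HL2.
Qed.

End smooth_coefficient.

(** * Estimates stable under sums and products *)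

Lemma ler_norm_mul (R : numDomainType) (a b A B : R) :
  `|a| <= A -> `|b| <= B -> `|a * b| <= A * B.
Proof. by move=> aA bB; rewrite normrM ler_pM. Qed.

Section near_pairs.
Context {R : realType}.

(** A bound together with a bound on a difference is stable under products.  One
    computation thus gives both the size of the defect of a flow and the distance
    of the defects of two flows. *)
Definition near_pair (V : normedZmodType R) (c dl : R) (v v' : V) : Prop :=
  [/\ `|v| <= c, `|v'| <= c & `|v - v'| <= c * dl].

Variable dl : R.
Hypothesis dl_ge0 : 0 <= dl.

Lemma near_pair_ge0 (V : normedZmodType R) (c : R) (v v' : V) : near_pair c dl v v' -> 0 <= c.
Proof. by case=> vc _ _; exact: le_trans vc. Qed.

Lemma near_pair_le (V : normedZmodType R) (c c' : R) (v v' : V) :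
  c <= c' -> near_pair c dl v v' -> near_pair c' dl v v'.
Proof.
move=> cc' [h1 h2 h3]; split; first exact: le_trans cc'.
  exact: le_trans cc'.
by apply: (le_trans h3); rewrite ler_wpM2r.
Qed.

Lemma near_pairD (V : normedZmodType R) (c c' : R) (v v' w w' : V) :
  near_pair c dl v v' -> near_pair c' dl w w' -> near_pair (c + c') dl (v + w) (v' + w').
Proof.
move=> [h1 h2 h3] [g1 g2 g3]; split.
- by rewrite (le_trans (ler_normD _ _)) // lerD.
- by rewrite (le_trans (ler_normD _ _)) // lerD.
- by rewrite opprD addrACA mulrDl (le_trans (ler_normD _ _)) // lerD.
Qed.

Lemma near_pair_sum (V : normedZmodType R) (c : R) (n : nat) (F F' : 'I_n -> V) :
  (forall i, near_pair c dl (F i) (F' i)) ->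
  near_pair (n%:R * c) dl (\sum_i F i) (\sum_i F' i).
Proof.
move=> FF; split; first by apply: ler_norm_sum_ord => i; case: (FF i).
  by apply: ler_norm_sum_ord => i; case: (FF i).
by rewrite -sumrB -mulrA; apply: ler_norm_sum_ord => i; case: (FF i).
Qed.

Lemma near_pairM (c c' a a' b b' : R) : near_pair c dl a a' -> near_pair c' dl b b' ->
  near_pair (2 * c * c') dl (a * b) (a' * b').
Proof.
move=> aa bb; have c0 := near_pair_ge0 aa; have c'0 := near_pair_ge0 bb.
case: aa bb => [h1 h2 h3] [g1 g2 g3].
have cc : 0 <= c * c' by rewrite mulr_ge0.
split; [| |].
- by have := ler_norm_mul h1 g1; lra.
- by have := ler_norm_mul h2 g2; lra.
- have -> : a * b - a' * b' = (a - a') * b + a' * (b - b') by ring.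
  have := ler_norm_mul h3 g1; have := ler_norm_mul h2 g3.
  have := ler_normD ((a - a') * b) (a' * (b - b')); lra.
Qed.

Lemma near_pair_entry (p q : nat) (c : R) (A A' : 'M[R]_(p, q)) i j :
  near_pair c dl A A' -> near_pair c dl (A i j) (A' i j).
Proof.
move=> [h1 h2 h3]; split; first exact: le_trans (ler_mx_entry _ _ _) h1.
  exact: le_trans (ler_mx_entry _ _ _) h2.
by apply: le_trans h3; have := ler_mx_entry (A - A') i j; rewrite !mxE.
Qed.

Lemma near_pair_mx (p q : nat) (c : R) (A A' : 'M[R]_(p, q)) : 0 <= c ->
  (forall i j, near_pair c dl (A i j) (A' i j)) -> near_pair c dl A A'.
Proof.
move=> c0 AA; split; [| |].
- by apply: ler_mx_norm => // i j; case: (AA i j).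
- by apply: ler_mx_norm => // i j; case: (AA i j).
- apply: ler_mx_norm => [|i j]; first by rewrite mulr_ge0.
  by rewrite !mxE; case: (AA i j).
Qed.

End near_pairs.

Section regular.
Context {R : realType} {m : nat}.
Notation V := 'cV[R]_m.
Variable T : R.

(** The estimates needed for the coefficients of a step: Lipschitz bounds and
    second differences in x, in t, and mixed.  They form a class stable under
    products, which contains the derivatives of order at most 1 of sigma. *)
Record regular (C : R) (f : R -> V -> R) : Prop := {
  regular_bound : forall (t : R) x, 0 <= t <= T -> `|f t x| <= C ;
  regular_lip : forall (t : R) x y, 0 <= t <= T -> `|f t x - f t y| <= C * `|x - y| ;
  regular_incr : forall (t : R) x x' v v', 0 <= t <= T ->
    `|f t (x + v) - f t x - (f t (x' + v') - f t x')|
      <= C * (`|v - v'| + `|x - x'| * `|v'|) ;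
  regular_time : forall (s t : R) x, 0 <= s <= T -> 0 <= t <= T ->
    `|f t x - f s x| <= C * `|t - s| ;
  regular_mixed : forall (s t : R) x y, 0 <= s <= T -> 0 <= t <= T ->
    `|f t x - f s x - (f t y - f s y)| <= C * `|t - s| * `|x - y| }.

Lemma regular_le C C' f : C <= C' -> regular C f -> regular C' f.
Proof.
move=> CC [h1 h2 h3 h4 h5]; split.
- by move=> t x t0; exact: le_trans (h1 _ _ t0) CC.
- by move=> t x y t0; apply: le_trans (h2 _ _ _ t0) _; rewrite ler_wpM2r.
- move=> t x x' v v' t0; apply: le_trans (h3 _ _ _ _ _ t0) _; apply: ler_wpM2r => //.
- by move=> s t x s0 t0; apply: le_trans (h4 _ _ _ s0 t0) _; rewrite ler_wpM2r.
- by move=> s t x y s0 t0; apply: le_trans (h5 _ _ _ _ s0 t0) _; rewrite !ler_wpM2r.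
Qed.

Lemma regularD C C' f g : regular C f -> regular C' g ->
  regular (C + C') (fun t x => f t x + g t x).
Proof.
move=> [f1 f2 f3 f4 f5] [g1 g2 g3 g4 g5]; split.
- by move=> t x t0; rewrite (le_trans (ler_normD _ _)) // lerD // ?f1 ?g1.
- move=> t x y t0; rewrite opprD addrACA mulrDl.
  by rewrite (le_trans (ler_normD _ _)) // lerD ?f2 ?g2.
- move=> t x x' v v' t0; rewrite mulrDl.
  have -> : f t (x + v) + g t (x + v) - (f t x + g t x) -
     (f t (x' + v') + g t (x' + v') - (f t x' + g t x'))
   = (f t (x + v) - f t x - (f t (x' + v') - f t x'))
     + (g t (x + v) - g t x - (g t (x' + v') - g t x')) by ring.
  by rewrite (le_trans (ler_normD _ _)) // lerD ?f3 ?g3.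
- move=> s t x s0 t0; rewrite opprD addrACA mulrDl.
  by rewrite (le_trans (ler_normD _ _)) // lerD ?f4 ?g4.
- move=> s t x y s0 t0; rewrite !mulrDl.
  have -> : f t x + g t x - (f s x + g s x) - (f t y + g t y - (f s y + g s y))
   = (f t x - f s x - (f t y - f s y)) + (g t x - g s x - (g t y - g s y)) by ring.
  by rewrite (le_trans (ler_normD _ _)) // lerD ?f5 ?g5.
Qed.

Lemma regular0 : regular 0 (fun _ _ => 0).
Proof. by split=> *; rewrite ?subrr ?normr0 ?mul0r. Qed.

Lemma regular_sum C n (F : 'I_n -> R -> V -> R) : (forall i, regular C (F i)) ->
  regular (n%:R * C) (fun t x => \sum_i F i t x).
Proof.
elim: n F => [|n IH] F HF.
  have -> : (fun t x => \sum_(i < 0) F i t x) = (fun _ _ => 0).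
    by apply/funext => t; apply/funext => x; rewrite big_ord0.
  by rewrite mul0r; exact: regular0.
have -> : (fun t x => \sum_(i < n.+1) F i t x)
   = (fun t x => F ord0 t x + \sum_(i < n) F (lift ord0 i) t x).
  by apply/funext => t; apply/funext => x; rewrite big_ord_recl.
rewrite -nat1r mulrDl mul1r; apply: regularD => //; exact: IH.
Qed.

Lemma regularM C C' f g : 0 <= C -> 0 <= C' -> regular C f -> regular C' g ->
  regular (5 * C * C') (fun t x => f t x * g t x).
Proof.
move=> C0 C'0 [f1 f2 f3 f4 f5] [g1 g2 g3 g4 g5].
have CC : 0 <= C * C' by rewrite mulr_ge0.
have inc (h : R -> V -> R) D t x v : (forall (t : R) x y, 0 <= t <= T -> `|h t x - h t y| <= D * `|x - y|) ->
    0 <= t <= T -> `|h t (x + v) - h t x| <= D * `|v|.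
  by move=> H t0; have := H t (x + v) x t0; rewrite [x + v]addrC addrK.
split.
- move=> t x t0; have := ler_norm_mul (f1 t x t0) (g1 t x t0); lra.
- move=> t x y t0.
  have -> : f t x * g t x - f t y * g t y = (f t x - f t y) * g t x + f t y * (g t x - g t y) by ring.
  have := ler_norm_mul (f2 t x y t0) (g1 t x t0).
  have := ler_norm_mul (f1 t y t0) (g2 t x y t0).
  have := ler_normD ((f t x - f t y) * g t x) (f t y * (g t x - g t y)).
  have : 0 <= C * C' * `|x - y| by rewrite mulr_ge0.
  lra.
- move=> t x x' v v' t0.
  set Fx := f t (x + v) - f t x; set Fx' := f t (x' + v') - f t x'.
  set Gx := g t (x + v) - g t x; set Gx' := g t (x' + v') - g t x'.
  have -> : f t (x + v) * g t (x + v) - f t x * g t x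
      - (f t (x' + v') * g t (x' + v') - f t x' * g t x')
    = (Fx - Fx') * g t (x + v) + Fx' * (g t (x + v) - g t (x' + v))
      + Fx' * (g t (x' + v) - g t (x' + v')) + f t x * (Gx - Gx') + (f t x - f t x') * Gx'.
    by rewrite /Fx /Fx' /Gx /Gx'; ring.
  have k1 := ler_norm_mul (f3 t x x' v v' t0) (g1 t (x + v) t0).
  have e1 : x + v - (x' + v) = x - x' by mx_ring.
  have e2 : x' + v - (x' + v') = v - v' by mx_ring.
  have k2 := ler_norm_mul (inc f C t x' v' f2 t0) (g2 t (x + v) (x' + v) t0).
  have F2 : `|Fx'| <= 2 * C.
    have := ler_normB (f t (x' + v')) (f t x').
    have := f1 t (x' + v') t0; have := f1 t x' t0; rewrite -/Fx'; lra.
  have k3 := ler_norm_mul F2 (g2 t (x' + v) (x' + v') t0).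
  have k4 := ler_norm_mul (f1 t x t0) (g3 t x x' v v' t0).
  have k5 := ler_norm_mul (f2 t x x' t0) (inc g C' t x' v' g2 t0).
  rewrite e1 in k2; rewrite e2 in k3.
  apply: (le_trans (le_trans _ (lerD (lerD (lerD (lerD k1 k2) k3) k4) k5))).
    by do 4![apply: (le_trans (ler_normD _ _)); rewrite lerD2r].
  have : 0 <= C * C' * (`|v - v'| + `|x - x'| * `|v'|) by apply: mulr_ge0.
  lra.
- move=> s t x s0 t0.
  have -> : f t x * g t x - f s x * g s x = (f t x - f s x) * g t x + f s x * (g t x - g s x) by ring.
  have := ler_norm_mul (f4 s t x s0 t0) (g1 t x t0).
  have := ler_norm_mul (f1 s x s0) (g4 s t x s0 t0).
  have := ler_normD ((f t x - f s x) * g t x) (f s x * (g t x - g s x)).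
  have : 0 <= C * C' * `|t - s| by rewrite mulr_ge0.
  lra.
- move=> s t x y s0 t0.
  have -> : f t x * g t x - f s x * g s x - (f t y * g t y - f s y * g s y)
    = (f t x - f s x - (f t y - f s y)) * g t x + (f t y - f s y) * (g t x - g t y)
    + f s x * (g t x - g s x - (g t y - g s y)) + (f s x - f s y) * (g t y - g s y) by ring.
  have k1 := ler_norm_mul (f5 s t x y s0 t0) (g1 t x t0).
  have k2 := ler_norm_mul (f4 s t y s0 t0) (g2 t x y t0).
  have k3 := ler_norm_mul (f1 s x s0) (g5 s t x y s0 t0).
  have k4 := ler_norm_mul (f2 s x y s0) (g4 s t y s0 t0).
  apply: (le_trans (le_trans _ (lerD (lerD (lerD k1 k2) k3) k4))).
    by do 3![apply: (le_trans (ler_normD _ _)); rewrite lerD2r].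
  have : 0 <= C * C' * `|t - s| * `|x - y| by rewrite !mulr_ge0.
  lra.
Qed.

End regular.

(** * The second-order step *)

Section rough_step.
Context {R : realType} {m d : nat}.
Notation V := 'cV[R]_m.
Variables (T : R) (sigma : R -> V -> 'M[R]_(m, d)).

(** Entry (i, k) of the derivative of sigma in the direction of the l-th column
    of sigma. *)
Definition dsigma_sigma (t : R) (x : V) (i : 'I_m) (k l : 'I_d) : R :=
  \sum_j partial_x sigma [:: j] t x i k * sigma t x j l.

(** Second-order Euler step: z and Z are the increments of the driver and of its
    iterated integrals. *)
Definition rough_step (s : R) (x : V) (z : 'cV[R]_d) (Z : 'M[R]_d) : V :=
  \col_i (\sum_k sigma s x i k * z k 0
          + \sum_k \sum_l dsigma_sigma s x i k l * Z l k).

Record coefficient_bounds (C : R) : Prop := {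
  bounds_sigma : forall i k, regular T C (fun t x => sigma t x i k) ;
  bounds_dsigma : forall j i k, regular T C (fun t x => partial_x sigma [:: j] t x i k) ;
  bounds_dsigma_sigma : forall i k l, regular T C (fun t x => dsigma_sigma t x i k l) ;
  bounds_taylor : forall t, 0 <= t <= T ->
    let rem := taylor_rem (sigma t) (fun j => partial_x sigma [:: j] t) in
    (forall x v, `|rem x v| <= C * `|v| ^+ 2) /\
    (forall x x' v v', `|rem x v - rem x' v'|
     <= C * (`|x - x'| * `|v| ^+ 2 + `|v - v'| * (`|v| + `|v'|))) }.

Lemma Cb_regular beta i k : 0 < T -> Cb T 1 3 sigma -> (size beta < 2)%N ->
  exists2 C, 0 <= C & regular T C (fun t x => partial_x sigma beta t x i k).
Proof.
move=> T0 sC b2; have b3 : (size beta < 3)%N by exact: leq_trans b2 _.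
have [C1 C10 H1] := Cb_bounded_x sC (ltnW b3).
have [C2 C20 H2] := Cb_lipschitz_x sC b3.
have [C3 C30 H3] := Cb_increment sC b2.
have [C4 C40 H4] := Cb_lipschitz_t sC (ltnW b3).
have [C5 C50 H5] := Cb_mixed sC b3.
have entry (A : 'M[R]_(m, d)) c : `|A| <= c -> `|A i k| <= c.
  exact: le_trans (ler_mx_entry _ _ _).
exists (C1 + C2 + C3 + C4 + C5); first lra.
split.
- by move=> t x t0; have := entry _ _ (H1 t x t0); lra.
- move=> t x y t0; have := entry _ _ (H2 t x y t0); rewrite !mxE.
  move/le_trans; apply; rewrite ler_wpM2r //; lra.
- move=> t x x' v v' t0; set f := partial_x sigma beta t.
  have -> : f (x + v) i k - f x i k - (f (x' + v') i k - f x' i k)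
     = (f (x + v) i k - f (x + v') i k)
       + (f (x + v') i k - f x i k - (f (x' + v') i k - f x' i k)) by ring.
  have := entry _ _ (H2 t (x + v) (x + v') t0); have := entry _ _ (H3 t x x' v' t0).
  rewrite !mxE -/f; have -> : x + v - (x + v') = v - v' by mx_ring.
  move=> h1 h2; apply: (le_trans (ler_normD _ _)); rewrite mulrDr.
  apply: lerD; first by apply: (le_trans h2); rewrite ler_wpM2r //; lra.
  apply: (le_trans h1); rewrite -mulrA [`|v'| * _]mulrC ler_wpM2r ?mulr_ge0 //; lra.
- move=> s t x s0 t0; have := entry _ _ (H4 s t x s0 t0); rewrite !mxE.
  move/le_trans; apply; rewrite ler_wpM2r //; lra.
- move=> s t x y s0 t0; have := entry _ _ (H5 s t x y s0 t0); rewrite !mxE.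
  move/le_trans; apply; rewrite !ler_wpM2r //; lra.
Qed.

Lemma Cb_coefficient_bounds : 0 < T -> Cb T 1 3 sigma ->
  exists2 C, 0 <= C & coefficient_bounds C.
Proof.
move=> T0 sC.
have [C1 C10 H1] : exists2 C, 0 <= C & forall ik : 'I_m * 'I_d,
    regular T C (fun t x => sigma t x ik.1 ik.2).
  apply: (@finite_uniform_bound R _ (fun ik C => regular T C (fun t x => sigma t x ik.1 ik.2))).
    by move=> ik C C' CC; exact: regular_le.
  by move=> [i k]; have [C _ HC] := @Cb_regular [::] i k T0 sC isT; exists C.
have [C2 C20 H2] : exists2 C, 0 <= C & forall jik : 'I_m * 'I_m * 'I_d,
    regular T C (fun t x => partial_x sigma [:: jik.1.1] t x jik.1.2 jik.2).
  apply: (@finite_uniform_bound R _ (fun jik C => regular T C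
     (fun t x => partial_x sigma [:: jik.1.1] t x jik.1.2 jik.2))).
    by move=> ik C C' CC; exact: regular_le.
  by move=> [[j i] k]; have [C _ HC] := @Cb_regular [:: j] i k T0 sC isT; exists C.
have [C3 C30 H3] := Cb_taylor sC.
have C40 : 0 <= m%:R * (5 * C2 * C1) by rewrite !mulr_ge0.
exists (C1 + C2 + C3 + m%:R * (5 * C2 * C1)); first lra.
split.
- by move=> i k; apply: regular_le (H1 (i, k)); lra.
- by move=> j i k; apply: regular_le (H2 (j, i, k)); lra.
- move=> i k l; apply: (@regular_le _ _ _ (m%:R * (5 * C2 * C1))); first lra.
  apply: regular_sum => j; apply: regularM => //; first exact: (H2 (j, i, k)).
  exact: (H1 (j, l)).
- move=> t t0; have [h1 h2] := H3 t t0; split.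
    by move=> x v; apply: le_trans (h1 x v) _; rewrite ler_wpM2r ?exprn_ge0 //; lra.
  move=> x x' v v'; apply: le_trans (h2 x x' v v') _; rewrite ler_wpM2r //; lra.
Qed.

(** Here eta stands for |t - s|^k, bounded by H.  The path increments
    are of order eta, the areas of order eta^2, the steps of order eta and their
    defects of order eta^3. *)
Section estimates.
Variables (C M H eta : R).
Hypotheses (C_ge0 : 0 <= C) (M_ge0 : 0 <= M) (H_ge0 : 0 <= H).
Hypotheses (eta_ge0 : 0 <= eta) (eta_le : eta <= H).
Hypothesis sigma_bounds : coefficient_bounds C.

Lemma regular_near (f : R -> V -> R) (c dl t : R) x x' : 0 <= t <= T -> regular T c f ->
  `|x - x'| <= dl -> near_pair c dl (f t x) (f t x').
Proof.
move=> t0 fr xx; have c0 : 0 <= c by exact: le_trans (normr_ge0 _) (regular_bound fr x t0).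
split; [exact: (regular_bound fr)|exact: (regular_bound fr)|].
by apply: (le_trans (regular_lip fr _ _ t0)); rewrite ler_wpM2l.
Qed.

Definition area_const := d%:R * (d%:R * (2 * C * M)).
Definition step_const := d%:R * (2 * C * M) + area_const * H.

Lemma area_const_ge0 : 0 <= area_const.
Proof. by rewrite /area_const; do !apply: mulr_ge0. Qed.

Lemma step_const_ge0 : 0 <= step_const.
Proof.
rewrite /step_const; apply: addr_ge0; first by do !apply: mulr_ge0.
exact: mulr_ge0 area_const_ge0 H_ge0.
Qed.

Lemma near_area (dl s : R) (x x' : V) (Z Z' : 'M[R]_d) i : 0 <= dl -> 0 <= s <= T ->
  `|x - x'| <= dl -> near_pair (M * eta ^+ 2) dl Z Z' ->
  near_pair (area_const * eta ^+ 2) dl (\sum_k \sum_l dsigma_sigma s x i k l * Z l k)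
    (\sum_k \sum_l dsigma_sigma s x' i k l * Z' l k).
Proof.
move=> dl0 s0 xx ZZ; rewrite /area_const.
have -> : d%:R * (d%:R * (2 * C * M)) * eta ^+ 2
  = d%:R * (d%:R * (2 * C * (M * eta ^+ 2))) by ring.
apply: near_pair_sum => k; apply: near_pair_sum => l.
apply: near_pairM => //; last exact: near_pair_entry.
exact: (regular_near s0 (bounds_dsigma_sigma sigma_bounds i k l)).
Qed.

Lemma near_step (dl s : R) (x x' : V) (z z' : 'cV[R]_d) (Z Z' : 'M[R]_d) :
  0 <= dl -> 0 <= s <= T -> `|x - x'| <= dl ->
  near_pair (M * eta) dl z z' -> near_pair (M * eta ^+ 2) dl Z Z' ->
  near_pair (step_const * eta) dl (rough_step s x z Z) (rough_step s x' z' Z').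
Proof.
move=> dl0 s0 xx zz ZZ.
have a0 := area_const_ge0.
apply: near_pair_mx => [//||i j].
  exact: mulr_ge0 step_const_ge0 eta_ge0.
rewrite !mxE /step_const mulrDl; apply: near_pairD.
  rewrite -mulrA; apply: near_pair_sum => k; rewrite -mulrA.
  rewrite -!mulrA mulrA; apply: near_pairM => //; last exact: near_pair_entry.
  exact: (regular_near s0 (bounds_sigma sigma_bounds i k)).
apply: near_pair_le (near_area i dl0 s0 xx ZZ) => //.
by rewrite expr2 mulrA ler_wpM2r // ler_wpM2l.
Qed.

Lemma step_increment (e s : R) (x x' v v' : V) (z z' : 'cV[R]_d) (Z Z' : 'M[R]_d) :
  0 <= e -> 0 <= s <= T -> near_pair (M * eta) e z z' -> near_pair (M * eta ^+ 2) e Z Z' ->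
  `|rough_step s (x + v) z Z - rough_step s x z Z
    - (rough_step s (x' + v') z' Z' - rough_step s x' z' Z')|
  <= step_const * eta * (`|v - v'| + (`|x - x'| + e) * `|v'|).
Proof.
move=> e0 s0 zz ZZ.
set Q := `|v - v'| + _; have Q0 : 0 <= Q.
  by apply: addr_ge0 => //; apply: mulr_ge0 => //; exact: addr_ge0.
have incr (f : R -> V -> R) c (a a' : R) : regular T C f -> near_pair c e a a' ->
    `|(f s (x + v) - f s x) * a - (f s (x' + v') - f s x') * a'| <= C * c * Q.
  move=> fr aa; have c0 := near_pair_ge0 aa; case: aa => h1 h2 h3.
  have -> : (f s (x + v) - f s x) * a - (f s (x' + v') - f s x') * a'
    = (f s (x + v) - f s x - (f s (x' + v') - f s x')) * a
      + (f s (x' + v') - f s x') * (a - a') by ring.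
  have k1 := ler_norm_mul (regular_incr fr x x' v v' s0) h1.
  have k2 := regular_lip fr (x' + v') x' s0; rewrite [x' + v']addrC addrK in k2.
  have k3 := ler_norm_mul k2 h3.
  rewrite [v' + x']addrC in k3.
  apply: (le_trans (ler_normD _ _)); apply: (le_trans (lerD k1 k3)).
  by rewrite le_eqVlt /Q; apply/orP; left; apply/eqP; ring.
apply: ler_mx_norm => [|i j]; first by apply: mulr_ge0 => //; exact: mulr_ge0 step_const_ge0 eta_ge0.
pose S y (w : 'cV[R]_d) k := sigma s y i k * w k 0.
pose D y (W : 'M[R]_d) k l := dsigma_sigma s y i k l * W l k.
have -> : (rough_step s (x + v) z Z - rough_step s x z Z
    - (rough_step s (x' + v') z' Z' - rough_step s x' z' Z')) i j
  = \sum_k (S (x + v) z k - S x z k - (S (x' + v') z' k - S x' z' k))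
    + \sum_k \sum_l (D (x + v) Z k l - D x Z k l - (D (x' + v') Z' k l - D x' Z' k l)).
  rewrite !mxE; under [X in _ = _ + X]eq_bigr do rewrite !sumrB.
  by rewrite !sumrB /S /D; ring.
have -> : step_const * eta * Q = d%:R * (2 * C * M * eta * Q) + area_const * H * eta * Q.
  by rewrite /step_const; ring.
have CMe : 0 <= C * M * eta * Q by rewrite !mulr_ge0.
apply: (le_trans (ler_normD _ _)); apply: lerD.
  apply: ler_norm_sum_ord => k.
  have := incr _ _ _ _ (bounds_sigma sigma_bounds i k) (near_pair_entry k 0 zz).
  rewrite /S !mulrBl; have : C * (M * eta) * Q = C * M * eta * Q by ring.
  lra.
have -> : area_const * H * eta * Q = d%:R * (d%:R * (2 * C * M * H * eta * Q)).
  by rewrite /area_const; ring.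
apply: ler_norm_sum_ord => k; apply: ler_norm_sum_ord => l.
have := incr _ _ _ _ (bounds_dsigma_sigma sigma_bounds i k l) (near_pair_entry l k ZZ).
rewrite /D !mulrBl => /le_trans; apply.
have : C * (M * eta ^+ 2) * Q <= C * M * H * eta * Q.
  rewrite ler_wpM2r // expr2 -!mulrA ler_wpM2l // ler_wpM2l // ler_wpM2r //.
have : 0 <= C * M * H * eta * Q by rewrite !mulr_ge0.
lra.
Qed.

(** Chen's relation cancels all terms of order less than three.  What remains is,
    against the path increment b, the variation of sigma in time, its Taylor
    remainder, and the derivative of sigma along the area part of the first step;
    against the area B, the variation of D sigma sigma in space and in time. *)
Lemma rough_step_defect s u x (a b : 'cV[R]_d) (A B : 'M[R]_d) i :
  let v := rough_step s x a A in
  (v + rough_step u (x + v) b B - rough_step s x (a + b) (A + B + a *m b^T)) i 0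
  = \sum_k ((sigma u (x + v) i k - sigma s (x + v) i k)
             + taylor_rem (sigma s) (fun j => partial_x sigma [:: j] s) x v i k
             + \sum_j partial_x sigma [:: j] s x i k
                * \sum_k' \sum_l dsigma_sigma s x j k' l * A l k') * b k 0
    + \sum_k \sum_l ((dsigma_sigma u (x + v) i k l - dsigma_sigma u x i k l)
                     + (dsigma_sigma u x i k l - dsigma_sigma s x i k l)) * B l k.
Proof.
move=> v.
have brace k : (sigma u (x + v) i k - sigma s (x + v) i k)
      + taylor_rem (sigma s) (fun j => partial_x sigma [:: j] s) x v i k
      + \sum_j partial_x sigma [:: j] s x i k
          * (\sum_k' \sum_l dsigma_sigma s x j k' l * A l k')
    = sigma u (x + v) i k - sigma s x i k - \sum_l dsigma_sigma s x i k l * a l 0.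
  have -> : taylor_rem (sigma s) (fun j => partial_x sigma [:: j] s) x v i k
    = sigma s (x + v) i k - sigma s x i k - \sum_j v j 0 * partial_x sigma [:: j] s x i k.
    move: v => w; rewrite /taylor_rem /lin_part !mxE summxE; congr (_ - _).
    by apply: eq_bigr => j _; rewrite mxE.
  have -> : \sum_l dsigma_sigma s x i k l * a l 0
     = \sum_j partial_x sigma [:: j] s x i k * \sum_l sigma s x j l * a l 0.
    rewrite /dsigma_sigma; under eq_bigr do rewrite mulr_suml.
    rewrite exchange_big /=; apply: eq_bigr => j _; rewrite mulr_sumr.
    by apply: eq_bigr => l _; rewrite mulrA.
  have -> : \sum_j v j 0 * partial_x sigma [:: j] s x i k
     = \sum_j partial_x sigma [:: j] s x i k * (\sum_l sigma s x j l * a l 0)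
       + \sum_j partial_x sigma [:: j] s x i k
          * (\sum_k' \sum_l dsigma_sigma s x j k' l * A l k').
    by rewrite -big_split /=; apply: eq_bigr => j _; rewrite -mulrDr /v !mxE mulrC.
  ring.
under [X in _ = X + _]eq_bigr do rewrite brace !mulrBl.
have bracket k l : dsigma_sigma u (x + v) i k l - dsigma_sigma u x i k l
    + (dsigma_sigma u x i k l - dsigma_sigma s x i k l)
  = dsigma_sigma u (x + v) i k l - dsigma_sigma s x i k l by ring.
under [X in _ = _ + X]eq_bigr do
  (under eq_bigr do rewrite bracket mulrBl; rewrite sumrB).
rewrite !sumrB.
have -> : (v + rough_step u (x + v) b B - rough_step s x (a + b) (A + B + a *m b^T)) i 0
  = v i 0 + rough_step u (x + v) b B i 0 - rough_step s x (a + b) (A + B + a *m b^T) i 0.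
  by rewrite !mxE.
have -> : v i 0 = \sum_k sigma s x i k * a k 0
    + \sum_k \sum_l dsigma_sigma s x i k l * A l k by rewrite !mxE.
have -> : rough_step u (x + v) b B i 0 = \sum_k sigma u (x + v) i k * b k 0
    + \sum_k \sum_l dsigma_sigma u (x + v) i k l * B l k by rewrite !mxE.
have -> : rough_step s x (a + b) (A + B + a *m b^T) i 0
  = \sum_k sigma s x i k * a k 0 + \sum_k sigma s x i k * b k 0
    + (\sum_k \sum_l dsigma_sigma s x i k l * A l k
       + \sum_k \sum_l dsigma_sigma s x i k l * B l k
       + \sum_k (\sum_l dsigma_sigma s x i k l * a l 0) * b k 0).
  rewrite mxE; congr (_ + _).
    by rewrite -big_split; apply: eq_bigr => k _; rewrite mxE mulrDr.
  rewrite -!big_split /=; apply: eq_bigr => k _.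
  rewrite mulr_suml -!big_split /=; apply: eq_bigr => l _.
  by rewrite !mxE big_ord1 !mxE !mulrDr mulrA.
ring.
Qed.

Lemma regular_near_time (f : R -> V -> R) (c dl s u : R) x x' :
  0 <= s <= T -> 0 <= u <= T -> regular T c f -> `|x - x'| <= dl ->
  near_pair (c * `|u - s|) dl (f u x - f s x) (f u x' - f s x').
Proof.
move=> s0 u0 fr xx; have c0 : 0 <= c by exact: le_trans (normr_ge0 _) (regular_bound fr x s0).
split; [exact: (regular_time fr)|exact: (regular_time fr)|].
by apply: (le_trans (regular_mixed fr x x' s0 u0)); rewrite ler_wpM2l ?mulr_ge0.
Qed.

Lemma regular_near_incr (f : R -> V -> R) (c w dl s : R) x x' v v' :
  0 <= dl -> 0 <= s <= T -> regular T c f -> `|x - x'| <= dl -> near_pair w dl v v' ->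
  near_pair (2 * c * w) dl (f s (x + v) - f s x) (f s (x' + v') - f s x').
Proof.
move=> dl0 s0 fr xx vv; have c0 : 0 <= c by exact: le_trans (normr_ge0 _) (regular_bound fr x s0).
have w0 := near_pair_ge0 vv; case: vv => h1 h2 h3; have cw : 0 <= c * w by rewrite mulr_ge0.
have inc y (y' : V) : `|y'| <= w -> `|f s (y + y') - f s y| <= 2 * c * w.
  move=> y'w; have := regular_lip fr (y + y') y s0; rewrite [y + y']addrC addrK.
  have : c * `|y'| <= c * w by rewrite ler_wpM2l.
  lra.
split; [exact: inc|exact: inc|].
apply: (le_trans (regular_incr fr _ _ _ _ s0)).
have -> : 2 * c * w * dl = c * (w * dl + dl * w) by ring.
by rewrite ler_wpM2l // lerD // ler_pM.
Qed.

Lemma near_taylor (w dl s : R) x x' v v' i k : 0 <= dl -> 0 <= s <= T ->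
  `|x - x'| <= dl -> near_pair w dl v v' ->
  let rem := taylor_rem (sigma s) (fun j => partial_x sigma [:: j] s) in
  near_pair (3 * C * w ^+ 2) dl (rem x v i k) (rem x' v' i k).
Proof.
move=> dl0 s0 xx vv rem; have w0 := near_pair_ge0 vv; case: vv => h1 h2 h3.
have [t1 t2] := bounds_taylor sigma_bounds s0; rewrite -/rem in t1 t2.
have Cw : 0 <= C * w ^+ 2 by rewrite mulr_ge0 // exprn_ge0.
have sq (y : V) : `|y| <= w -> `|y| ^+ 2 <= w ^+ 2.
  by move=> yw; rewrite lerXn2r ?nnegrE.
apply: near_pair_entry; split.
- by apply: (le_trans (t1 _ _)); have := ler_wpM2l C_ge0 (sq _ h1); lra.
- by apply: (le_trans (t1 _ _)); have := ler_wpM2l C_ge0 (sq _ h2); lra.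
apply: (le_trans (t2 _ _ _ _)).
have -> : 3 * C * w ^+ 2 * dl = C * (dl * w ^+ 2 + w * dl * (w + w)) by ring.
rewrite ler_wpM2l // lerD // ?ler_pM ?exprn_ge0 ?sq // ?addr_ge0 // lerD //.
Qed.

Variable Tp : R.
Hypothesis Tp_ge0 : 0 <= Tp.

(** Constant of the factor of the path increment in [rough_step_defect], which is
    of order eta^2: its three terms are those of that factor.  Tp bounds
    |u - s| / eta^2. *)
Definition brace_const := C * (1 + step_const * H) * Tp + 3 * C * step_const ^+ 2
  + m%:R * (2 * C * area_const).

Definition defect_const := d%:R * (2 * brace_const * M)
  + d%:R * (d%:R * (2 * (2 * C * step_const + C * Tp * H) * M)).

(** Every summand of [rough_step_defect] is a product of factors for which pairs of
    estimates are known, of total order eta^3. *)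
Lemma near_defect (dl s u : R) (x x' : V) (a a' b b' : 'cV[R]_d) (A A' B B' : 'M[R]_d) :
  0 <= dl -> 0 <= s <= T -> 0 <= u <= T -> `|u - s| <= Tp * eta ^+ 2 ->
  `|x - x'| <= dl -> near_pair (M * eta) dl a a' -> near_pair (M * eta) dl b b' ->
  near_pair (M * eta ^+ 2) dl A A' -> near_pair (M * eta ^+ 2) dl B B' ->
  let v := rough_step s x a A in let v' := rough_step s x' a' A' in
  near_pair (defect_const * eta ^+ 3) dl
    (v + rough_step u (x + v) b B - rough_step s x (a + b) (A + B + a *m b^T))
    (v' + rough_step u (x' + v') b' B' - rough_step s x' (a' + b') (A' + B' + a' *m b'^T)).
Proof.
move=> dl0 s0 u0 us xx aa bb AA BB v v'.
have vv : near_pair (step_const * eta) dl v v' by exact: near_step.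
have c10 := step_const_ge0; have ac0 := area_const_ge0; have eta20 := exprn_ge0 2 eta_ge0.
have [C0 M0 H0 e0] := And4 C_ge0 M_ge0 H_ge0 eta_ge0.
have brace0 : 0 <= brace_const.
  rewrite /brace_const; apply: addr_ge0; first apply: addr_ge0.
  - apply: mulr_ge0 => //; apply: mulr_ge0 => //; apply: addr_ge0 => //; exact: mulr_ge0.
  - by apply: mulr_ge0; [exact: mulr_ge0|exact: exprn_ge0].
  - by apply: mulr_ge0 => //; apply: mulr_ge0 => //; exact: mulr_ge0.
have xv : `|x + v - (x' + v')| <= (1 + step_const * H) * dl.
  have -> : x + v - (x' + v') = (x - x') + (v - v') by mx_ring.
  apply: (le_trans (ler_normD _ _)); rewrite mulrDl mul1r lerD //.
  case: vv => _ _ /le_trans; apply; rewrite ler_wpM2r // ler_wpM2l //.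
have h1 : 0 <= 1 + step_const * H by apply: addr_ge0 => //; exact: mulr_ge0.
have rescale (W : normedZmodType R) (y y' : W) c : 0 <= c ->
    near_pair c ((1 + step_const * H) * dl) y y' -> near_pair (c * (1 + step_const * H)) dl y y'.
  have g1 : 1 <= 1 + step_const * H by rewrite lerDl; exact: mulr_ge0.
  move=> c0 [k1 k2 k3]; split.
  - by apply: (le_trans k1); exact: ler_peMr.
  - by apply: (le_trans k2); exact: ler_peMr.
  - by rewrite -mulrA.
have E3 : defect_const * eta ^+ 3 = d%:R * (2 * (brace_const * eta ^+ 2) * (M * eta))
   + d%:R * (d%:R * (2 * ((2 * C * step_const + C * Tp * H) * eta) * (M * eta ^+ 2))).
  by rewrite /defect_const; ring.
have P0 : 0 <= C * Tp by exact: mulr_ge0.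
apply: near_pair_mx => //.
  apply: mulr_ge0; last exact: exprn_ge0.
  rewrite /defect_const; apply: addr_ge0.
    by apply: mulr_ge0 => //; apply: mulr_ge0 => //; exact: mulr_ge0.
  do 2!apply: mulr_ge0 => //; apply: mulr_ge0 => //; apply: mulr_ge0 => //.
  by apply: addr_ge0; apply: mulr_ge0 => //; exact: mulr_ge0.
move=> i j; rewrite (ord1 j) !rough_step_defect -/v -/v' E3; apply: near_pairD => //.
  apply: near_pair_sum => // k; apply: near_pairM => //; last exact: near_pair_entry.
  have -> : brace_const * eta ^+ 2 = C * (1 + step_const * H) * Tp * eta ^+ 2
     + 3 * C * step_const ^+ 2 * eta ^+ 2 + m%:R * (2 * C * area_const) * eta ^+ 2.
    by rewrite /brace_const; ring.
  apply: near_pairD => //; first apply: near_pairD => //.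
  - apply: (@near_pair_le _ dl dl0 _ (C * `|u - s| * (1 + step_const * H))).
      have -> : C * `|u - s| * (1 + step_const * H) = C * (1 + step_const * H) * `|u - s|.
        by ring.
      by rewrite -[leRHS]mulrA; apply: ler_wpM2l us; exact: mulr_ge0.
    apply: rescale; first exact: mulr_ge0.
    exact: (regular_near_time s0 u0 (bounds_sigma sigma_bounds i k)).
  - have -> : 3 * C * step_const ^+ 2 * eta ^+ 2 = 3 * C * (step_const * eta) ^+ 2 by ring.
    exact: near_taylor.
  - have -> : m%:R * (2 * C * area_const) * eta ^+ 2
      = m%:R * (2 * C * (area_const * eta ^+ 2)) by ring.
    apply: near_pair_sum => // j'; apply: near_pairM => //.
      exact: (regular_near s0 (bounds_dsigma sigma_bounds j' i k)).
    exact: near_area.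
apply: near_pair_sum => // k; apply: near_pair_sum => // l.
apply: near_pairM => //; last exact: near_pair_entry.
rewrite mulrDl; apply: near_pairD => //.
  rewrite -mulrA.
  exact: (regular_near_incr dl0 u0 (bounds_dsigma_sigma sigma_bounds i k l)).
apply: near_pair_le (regular_near_time s0 u0 (bounds_dsigma_sigma sigma_bounds i k l) xx) => //.
rewrite -!mulrA ler_wpM2l //; apply: (le_trans us); rewrite ler_wpM2l //.
by rewrite expr2 ler_wpM2r.
Qed.

End estimates.
End rough_step.

(** * The almost flow of a driver *)

Section driver.
Context {R : realType} {m d : nat}.
Notation V := 'cV[R]_m.
Variables (T k : R) (sigma : R -> V -> 'M[R]_(m, d)).

Record driver (M : R) (z : R -> 'cV[R]_d) (z2 : R -> R -> 'M[R]_d) : Prop := {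
  driver_path : forall s t, 0 <= s -> s <= t -> t <= T ->
    `|z t - z s| <= M * (t - s) `^ k ;
  driver_area : forall s t, 0 <= s -> s <= t -> t <= T ->
    `|z2 s t| <= M * (t - s) `^ (2 * k) ;
  driver_chen : forall s u t, 0 <= s -> s <= u -> u <= t -> t <= T ->
    z2 s t = z2 s u + z2 u t + (z u - z s) *m (z t - z u)^T }.

Record close_drivers (M e : R) (z z' : R -> 'cV[R]_d) (z2 z2' : R -> R -> 'M[R]_d) : Prop := {
  close_path : forall s t, 0 <= s -> s <= t -> t <= T ->
    `|z t - z s - (z' t - z' s)| <= M * e * (t - s) `^ k ;
  close_area : forall s t, 0 <= s -> s <= t -> t <= T ->
    `|z2 s t - z2' s t| <= M * e * (t - s) `^ (2 * k) }.

Definition driver_flow (z : R -> 'cV[R]_d) (z2 : R -> R -> 'M[R]_d) (s t : R) (x : V) : V :=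
  rough_step sigma s x (z t - z s) (z2 s t).

Lemma close_driversxx M z z2 : close_drivers M 0 z z z2 z2.
Proof. by split=> *; rewrite subrr normr0 mulr0 mul0r. Qed.

Lemma powR_mul_nat (x : R) (n : nat) : 0 <= x -> x `^ (n%:R * k) = (x `^ k) ^+ n.
Proof. by move=> x0; rewrite mulrC powRrM powR_mulrn // powR_ge0. Qed.

Lemma near_pair_dl (W : normedZmodType R) (c dl dl' : R) (v v' : W) :
  dl <= dl' -> near_pair c dl v v' -> near_pair c dl' v v'.
Proof.
move=> dd nv; have c0 := near_pair_ge0 nv; case: nv => h1 h2 h3; split => //.
by apply: (le_trans h3); rewrite ler_wpM2l.
Qed.

(** The estimates for one step hold with eta = |t - s|^k.  The variation of sigma in
    time is of order |t - s|, hence O(eta^2) because 2k <= 1. *)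
Lemma driver_flow_close (C M : R) : 0 < T -> 3^-1 < k -> k <= 2 / 5 ->
  0 <= C -> 0 <= M -> coefficient_bounds T sigma C ->
  exists2 Cf, 0 <= Cf & forall e z z' z2 z2', 0 <= e ->
    driver M z z2 -> driver M z' z2' -> close_drivers M e z z' z2 z2' ->
    close_flows k Cf e 0 T (driver_flow z z2) (driver_flow z' z2')
    /\ almost_flow k Cf 0 T (driver_flow z z2).
Proof.
move=> T0 k13 k25 C0 M0 sB; have k0 : 0 <= k by lra.
have k1 : 0 < 2 * k <= 1 by lra.
pose H := T `^ k; have H0 : 0 <= H by exact: powR_ge0.
pose Tp := T `^ (1 - 2 * k); have Tp0 : 0 <= Tp by exact: powR_ge0.
pose Cs := @step_const R d C M H; pose Cd := @defect_const R m d C M H Tp.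
have Cs0 : 0 <= Cs by exact: step_const_ge0.
exists (Cs + `|Cd|); first by rewrite addr_ge0.
have Cd_le : Cd <= Cs + `|Cd|.
  by have := ler_norm Cd; lra.
have Cs_le : Cs <= Cs + `|Cd| by have := normr_ge0 Cd; lra.
have sT s t : 0 <= s -> s <= t -> t <= T -> 0 <= s <= T by move=> *; lra.
have etaH h : 0 <= h -> h <= T -> h `^ k <= H by move=> ? ?; rewrite ge0_ler_powR ?nnegrE //; lra.
have main e z z' z2 z2' : 0 <= e ->
    driver M z z2 -> driver M z' z2' -> close_drivers M e z z' z2 z2' ->
  [/\ forall s t p p', 0 <= s -> s <= t -> t <= T ->
        near_pair (Cs * (t - s) `^ k) (`|p - p'| + e)
          (driver_flow z z2 s t p) (driver_flow z' z2' s t p'),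
      forall s t p p' q q', 0 <= s -> s <= t -> t <= T ->
        `|driver_flow z z2 s t (p + q) - driver_flow z z2 s t p
          - (driver_flow z' z2' s t (p' + q') - driver_flow z' z2' s t p')|
        <= Cs * (t - s) `^ k * (`|q - q'| + (`|p - p'| + e) * `|q'|) &
      forall s u t p p', 0 <= s -> s <= u -> u <= t -> t <= T ->
        near_pair (Cd * (t - s) `^ (3 * k)) (`|p - p'| + e)
          (flow_defect (driver_flow z z2) s u t p)
          (flow_defect (driver_flow z' z2') s u t p')].
  move=> e0 [zp za zc] [zp' za' zc'] [cp ca].
  have near_path h s t : 0 <= s -> s <= t -> t <= T -> t - s <= h ->
      near_pair (M * h `^ k) e (z t - z s) (z' t - z' s).
    move=> s0 st tT tsh.
    have kk : (t - s) `^ k <= h `^ k by apply: ler_powR_base => //; rewrite subr_ge0.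
    split.
    - by apply: (le_trans (zp _ _ s0 st tT)); rewrite ler_wpM2l.
    - by apply: (le_trans (zp' _ _ s0 st tT)); rewrite ler_wpM2l.
    - by apply: (le_trans (cp _ _ s0 st tT)); rewrite mulrAC ler_wpM2r // ler_wpM2l.
  have near_area2 h s t : 0 <= s -> s <= t -> t <= T -> t - s <= h ->
      near_pair (M * (h `^ k) ^+ 2) e (z2 s t) (z2' s t).
    move=> s0 st tT tsh; rewrite -powR_mul_nat; last by apply: le_trans tsh; rewrite subr_ge0.
    have kk : (t - s) `^ (2 * k) <= h `^ (2 * k).
      by apply: ler_powR_base; rewrite ?mulr_ge0 ?subr_ge0.
    split.
    - by apply: (le_trans (za _ _ s0 st tT)); rewrite ler_wpM2l.
    - by apply: (le_trans (za' _ _ s0 st tT)); rewrite ler_wpM2l.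
    - by apply: (le_trans (ca _ _ s0 st tT)); rewrite mulrAC ler_wpM2r // ler_wpM2l.
  split.
  - move=> s t p p' s0 st tT; set dl := `|p - p'| + e.
    have dl0 : 0 <= dl by exact: addr_ge0.
    have edl : e <= dl by rewrite lerDr.
    have ppdl : `|p - p'| <= dl by rewrite lerDl.
    have ts0 : 0 <= t - s by rewrite subr_ge0.
    have tsT : t - s <= T by apply: le_trans tT; rewrite gerBl.
    have h := near_step C0 M0 H0 (powR_ge0 _ _) (etaH _ ts0 tsT) sB dl0 (sT _ _ s0 st tT)
      ppdl (near_pair_dl edl (near_path _ _ _ s0 st tT (lexx _)))
      (near_pair_dl edl (near_area2 _ _ _ s0 st tT (lexx _))).
    exact: h.
  - move=> s t p p' q q' s0 st tT.
    have ts0 : 0 <= t - s by rewrite subr_ge0.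
    have tsT : t - s <= T by apply: le_trans tT; rewrite gerBl.
    have h := step_increment C0 M0 H0 (powR_ge0 _ _) (etaH _ ts0 tsT) sB p p' q q' e0
      (sT _ _ s0 st tT) (near_path _ _ _ s0 st tT (lexx _)) (near_area2 _ _ _ s0 st tT (lexx _)).
    exact: h.
  - move=> s u t p p' s0 su ut tT; set dl := `|p - p'| + e.
    have dl0 : 0 <= dl by exact: addr_ge0.
    have edl : e <= dl by rewrite lerDr.
    have ppdl : `|p - p'| <= dl by rewrite lerDl.
    have st : s <= t by exact: le_trans ut.
    have ts0 : 0 <= t - s by rewrite subr_ge0.
    have tsT : t - s <= T by apply: le_trans tT; rewrite gerBl.
    have u0 : 0 <= u by exact: le_trans su.
    have uT : u <= T by exact: le_trans tT.
    have us_le : `|u - s| <= Tp * ((t - s) `^ k) ^+ 2.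
      rewrite -powR_mul_nat // ger0_norm ?subr_ge0 //.
      have := @ler_powR_horizon R T (t - s) 1 (2 * k); rewrite ts0 tsT powRr1 // => /(_ isT k1).
      by apply: le_trans; apply: lerB.
    have uts : u - s <= t - s by apply: lerB.
    have tut : t - u <= t - s by apply: lerB.
    have := near_defect C0 M0 H0 (powR_ge0 _ _) (etaH _ ts0 tsT) sB Tp0 dl0
      (sT _ _ s0 st tT) (sT _ _ u0 ut tT) us_le ppdl
      (near_pair_dl edl (near_path _ _ _ s0 su uT uts))
      (near_pair_dl edl (near_path _ _ _ u0 ut tT tut))
      (near_pair_dl edl (near_area2 _ _ _ s0 su uT uts))
      (near_pair_dl edl (near_area2 _ _ _ u0 ut tT tut)).
    have zE (w : R -> 'cV[R]_d) : w u - w s + (w t - w u) = w t - w s by rewrite addrC addrA subrK.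
    by rewrite !zE -zc // -zc' // (powR_mul_nat 3).
move=> e z z' z2 z2' e0 dz dz' dzz; split.
  have [n1 n2 n3] := main _ _ _ _ _ e0 dz dz' dzz; split.
  - move=> s t p p' s0 st tT; have [_ _ /le_trans] := n1 s t p p' s0 st tT.
    by apply; rewrite !ler_wpM2r ?powR_ge0 ?addr_ge0.
  - move=> s t p p' q q' s0 st tT; apply: (le_trans (n2 _ _ _ _ _ _ s0 st tT)).
    apply: ler_wpM2r; last by rewrite ler_wpM2r ?powR_ge0.
    by apply: addr_ge0 => //; apply: mulr_ge0 => //; exact: addr_ge0.
  - move=> s u t p p' s0 su ut tT; have [_ _ /le_trans] := n3 s u t p p' s0 su ut tT.
    by apply; rewrite !ler_wpM2r ?powR_ge0 ?addr_ge0.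
have [n1 _ n3] := main _ _ _ _ _ (lexx 0) dz dz (close_driversxx _ _ _); split.
- move=> s t p s0 st tT; have [/le_trans h _ _] := n1 s t p p s0 st tT.
  by apply: h; rewrite ler_wpM2r ?powR_ge0.
- move=> s t p q s0 st tT; have [_ _] := n1 s t p q s0 st tT.
  by rewrite addr0 => /le_trans; apply; rewrite !ler_wpM2r ?powR_ge0.
- move=> s u t p s0 su ut tT; have [/le_trans h _ _] := n3 s u t p p s0 su ut tT.
  by apply: h; rewrite ler_wpM2r ?powR_ge0.
Qed.

End driver.

(** * Rough integrals as limits of dyadic sums *)

Section dyadic_points.
Context {R : realType}.
Implicit Types (s u v : R).

Fixpoint dyadic_points (j : nat) u v : seq R :=
  if j is j'.+1 then dyadic_points j' u ((u + v) / 2) ++ dyadic_points j' ((u + v) / 2) v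
  else [:: v].

Lemma last_dyadic_points j u v w : last w (dyadic_points j u v) = v.
Proof. by elim: j u v w => [|j IH] u v w //=; rewrite last_cat !IH. Qed.

Lemma dyadic_points_path j u v : u < v -> path <%R u (dyadic_points j u v).
Proof.
elim: j u v => [|j IH] u v uv /=; first by rewrite uv.
by rewrite cat_path last_dyadic_points !IH //; lra.
Qed.

Lemma dyadic_points_mesh j u v (h : R) : v - u < h * 2 ^+ j ->
  path (fun a b => b - a < h) u (dyadic_points j u v).
Proof.
elim: j u v => [|j IH] u v uv /=; first by rewrite mulr1 in uv; rewrite uv.
by rewrite cat_path last_dyadic_points !IH //; rewrite exprS in uv; lra.
Qed.

(** A partition of [s, u] has no points besides s when s = u. *)
Definition initial_points (j : nat) s u : seq R := if s < u then dyadic_points j s u else [::].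

Lemma initial_points_props j s u (h : R) : s <= u -> u - s < h * 2 ^+ j ->
  [/\ path <%R s (initial_points j s u), last s (initial_points j s u) = u &
     path (fun a b => b - a < h) s (initial_points j s u)].
Proof.
rewrite /initial_points; case: (ltP s u) => [su _ uh|us su _].
  by split; [exact: dyadic_points_path|exact: last_dyadic_points|exact: dyadic_points_mesh].
by split => //=; apply/eqP; rewrite eq_le su us.
Qed.

End dyadic_points.

Section partition_sum.
Context {R : realType} {V : zmodType}.
Implicit Types (g : R -> R -> V) (s u v : R) (l : seq R).

Definition partition_sum g s l : V :=
  \sum_(0 <= q < size l) g (nth s (s :: l) q) (nth s (s :: l) q.+1).

Lemma partition_sum_cons g s u l :
  partition_sum g s (u :: l) = g s u + partition_sum g u l.
Proof.
rewrite /partition_sum big_nat_recl //=; congr (_ + _).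
rewrite !big_mkord; apply: eq_bigr => q _.
by congr (g _ _); rewrite -?[nth s l q]/(nth s (u :: l) q.+1); apply: set_nth_default => //=;
   rewrite ltnS // ltnW.
Qed.

Lemma partition_sum_cat g s l1 l2 :
  partition_sum g s (l1 ++ l2) = partition_sum g s l1 + partition_sum g (last s l1) l2.
Proof.
elim: l1 s => [|u l1 IH] s /=; first by rewrite /partition_sum big_nil add0r.
by rewrite !partition_sum_cons IH addrA.
Qed.

Lemma partition_sum_dyadic g j u v :
  partition_sum g u (dyadic_points j u v) = dyadic_sum g j u v.
Proof.
elim: j u v => [|j IH] u v /=; first by rewrite /partition_sum big_nat1.
by rewrite partition_sum_cat last_dyadic_points !IH.
Qed.

End partition_sum.

(** A fine partition of [s, u], followed by the dyadic partition of [u, v], is a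
    fine partition of [s, v]; the contribution of [s, u] is close to Iu. *)
Lemma rough_integral_dyadic (R : realType) (m d : nat)
    (zeta : R -> 'cV[R]_d) (zeta2 : R -> R -> 'M[R]_d)
    (Y : R -> 'M[R]_(m, d)) (Y' : R -> 'I_m -> 'M[R]_d) (s u v : R) (Iu Iv : 'cV[R]_m) (e : R) :
  s <= u -> u < v -> 0 < e ->
  is_rough_integral zeta zeta2 Y Y' s u Iu -> is_rough_integral zeta zeta2 Y Y' s v Iv ->
  exists j, `|dyadic_sum (rough_term zeta zeta2 Y Y') j u v - (Iv - Iu)| < e.
Proof.
move=> su uv e0 HIu HIv; have e20 : 0 < e / 2 by lra.
have [h1 h10 H1] := HIu _ e20; have [h2 h20 H2] := HIv _ e20.
have [j1 J1] := eventually_lt_exp2 (u - s) h10.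
have [j2 J2] := eventually_lt_exp2 (u - s) h20; have [j3 J3] := eventually_lt_exp2 (v - u) h20.
pose j := (j1 + j2 + j3)%N; exists j.
have jj1 : (j1 <= j)%N by rewrite /j -addnA leq_addr.
have jj2 : (j2 <= j)%N by rewrite /j addnAC leq_addl.
have jj3 : (j3 <= j)%N by rewrite /j leq_addl.
have [p1 l1 m1] := initial_points_props su (J1 _ jj1).
have [_ _ m2] := initial_points_props su (J2 _ jj2).
have m3 := dyadic_points_mesh (J3 _ jj3); have p3 := dyadic_points_path j uv.
set g := rough_term zeta zeta2 Y Y'; set P := initial_points j s u in p1 l1 m1 m2.
have hu : `|partition_sum g s P - Iu| < e / 2.
  apply: H1; first by split => //; rewrite l1.
  by move=> q qP; move/pathP: m1 => /(_ s q qP).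
have hv : `|partition_sum g s (P ++ dyadic_points j u v) - Iv| < e / 2.
  apply: H2.
    by split; rewrite ?cat_path ?l1 ?p1 //= last_cat last_dyadic_points.
  have mm : path (fun a b => b - a < h2) s (P ++ dyadic_points j u v).
    by rewrite cat_path m2 l1.
  by move=> q qP; move/pathP: mm => /(_ s q qP).
rewrite partition_sum_cat l1 partition_sum_dyadic in hv.
have -> : dyadic_sum g j u v - (Iv - Iu)
  = (partition_sum g s P + dyadic_sum g j u v - Iv) - (partition_sum g s P - Iu).
  by move: (partition_sum _ _ _) (dyadic_sum _ _ _ _) => a1 a2; mx_ring.
by apply: (le_lt_trans (ler_normB _ _)); rewrite [e]splitr ltrD.
Qed.

Section rough_side.
Context {R : realType} {m d : nat}.
Notation V := 'cV[R]_m.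

(** The error of x is controlled of order 2k, so that its additivity fails at
    order 3k > 1 and the error is within O(|v - u|^(3k)) of its dyadic sums.
    These tend to the increment of x minus the integral, which is the drift. *)
Lemma step_error_negligible (k T Cf Cx s : R) (psi : R -> R -> V -> V)
    (x : R -> V) (dr I : R -> V) y :
  3^-1 < k -> 0 <= Cf -> 0 <= Cx -> s <= T -> almost_flow k Cf s T psi ->
  (forall u v, s <= u -> u <= v -> v <= T -> `|step_error psi x u v| <= Cx * (v - u) `^ (2 * k)) ->
  (forall t, s <= t <= T -> x t = y + dr t + I t) ->
  (forall u v e, s <= u -> u < v -> v <= T -> 0 < e -> exists j : nat,
      `|dyadic_sum (fun u v => psi u v (x u)) j u v - (I v - I u)| < e) ->
  sum_negligible s T (fun u v => `|step_error psi x u v - (dr v - dr u)|).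
Proof.
move=> k13 Cf0 Cx0 sT F xe xI DI.
have k0 : 0 <= k by lra.
have k30 : 1 < 3 * k by lra.
have C20 : 0 <= Cf * Cx + Cf by rewrite addr_ge0 // mulr_ge0.
apply: ler_negligible (powR_negligible k30 sT (descent_const_ge0 k30 C20)) => u v su uv vT.
have sew j := sewing_bound j k30 C20 _ su uv vT.
have {}sew j : `|step_error psi x u v - dyadic_sum (step_error psi x) j u v|
    <= descent_const (3 * k) (Cf * Cx + Cf) * (v - u) `^ (3 * k).
  apply: sew => a b sa ab bT; have [ac cb] := midpoint_bounds ab.
  set c := (a + b) / 2 in ac cb *.
  rewrite step_error_cocycle; apply: (le_trans (ler_normD _ _)); rewrite mulrDl.
  have sc : s <= c by lra.
  have cT : c <= T by lra.
  apply: lerD; last exact: (almost_flow_defect F).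
  apply: (le_trans (almost_flow_lipschitz F _ _ sc cb bT)).
  rewrite addrAC subrr add0r.
  have -> : 3 * k = k + 2 * k by ring.
  rewrite powRD; last by apply/implyP => /eqP ?; exfalso; lra.
  have e1 := xe a c sa ac cT.
  have e2 : (c - a) `^ (2 * k) <= (b - a) `^ (2 * k).
    by apply: ler_powR_base; [exact: mulr_ge0|rewrite subr_ge0|exact: lerB].
  have e3 : (b - c) `^ k <= (b - a) `^ k.
    by apply: ler_powR_base; [|rewrite subr_ge0|exact: lerB].
  have -> : Cf * Cx * ((b - a) `^ k * (b - a) `^ (2 * k))
     = (Cf * (b - a) `^ k) * (Cx * (b - a) `^ (2 * k)) by ring.
  apply: ler_pM => //; first by rewrite mulr_ge0 // powR_ge0.
    by rewrite ler_wpM2l.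
  by apply: (le_trans e1); rewrite ler_wpM2l.
have [uv'|vu] := ltP u v; last first.
  have -> : v = u by apply/eqP; rewrite eq_le uv vu.
  have psi0 : `|psi u u (x u)| <= 0.
    have := almost_flow_bound F (x u) su (lexx u) (le_trans uv vT).
    by rewrite subrr powR0 ?mulr0 //; apply/eqP; lra.
  have {}psi0 : psi u u (x u) = 0 by apply/eqP; rewrite -normr_le0.
  rewrite /step_error !subrr psi0 subr0 subrr normr0 mulr_ge0 ?powR_ge0 //.
  exact: descent_const_ge0.
apply/ler_addgt0Pr => e e0; have [j Hj] := DI u v e su uv' vT e0.
have SE : dyadic_sum (step_error psi x) j u v
    = (x v - x u) - dyadic_sum (fun u v => psi u v (x u)) j u v.
  clear; elim: j u v => [|j IH] u v //=; rewrite !IH.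
  by move: (dyadic_sum _ _ _ _) (dyadic_sum _ _ _ _) => a1 a2; mx_ring.
have xvu : x v - x u = (dr v - dr u) + (I v - I u).
  by rewrite !xI; [mx_ring|lra|lra].
have := sew j; rewrite SE xvu; set A := dyadic_sum _ _ _ _ in Hj *.
have -> : step_error psi x u v - (dr v - dr u)
  = (step_error psi x u v - (dr v - dr u + (I v - I u) - A)) - (A - (I v - I u)).
  by move: (step_error _ _ _ _) => a1; mx_ring.
move=> H1; apply: (le_trans (ler_normB _ _)); apply: lerD => //; exact: ltW.
Qed.

End rough_side.

(** * The integral of an everywhere defined derivative *)

Section segment_integral.
Context {R : realType}.
Notation mu := (@lebesgue_measure R).
Implicit Types (f g : R -> R) (a b s u t : R).

Lemma integrable_subsegment f a b s t : a <= s -> t <= b ->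
  mu.-integrable `[a, b] (EFin \o f) -> mu.-integrable `[s, t] (EFin \o f).
Proof.
move=> as_ tb; apply: integrableS => //.
by apply: subset_itv; rewrite bnd_simp.
Qed.

Lemma integral_segment_split f a b s u t : a <= s -> s <= u -> u <= t -> t <= b ->
  mu.-integrable `[a, b] (EFin \o f) ->
  \int[mu]_(r in `[s, t]) f r = \int[mu]_(r in `[s, u]) f r + \int[mu]_(r in `[u, t]) f r.
Proof.
move=> as_ su ut tb fi.
have fst := integrable_subsegment as_ tb fi.
have := @Rintegral_itvB R f (BLeft s) (BRight t) u fst; rewrite !bnd_simp => /(_ su ut) E.
rewrite -[\int[mu]_(r in `[u, t]) f r]Rintegral_itv_obnd_cbnd; last first.
  apply: integrableS fst => //; apply: subset_itvr; by rewrite bnd_simp.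
by rewrite -E addrC subrK.
Qed.

Lemma Rintegral_segment_cst s t (K : R) : s <= t -> \int[mu]_(r in `[s, t]) K = K * (t - s).
Proof.
move=> st; rewrite Rintegral_cst //= lebesgue_measure_itv /= lte_fin.
by case: ltP => // ts; rewrite /= (_ : t = s) ?subrr //; apply/eqP; rewrite eq_le ts st.
Qed.

Lemma integrable_segment_cst s t (K : R) : mu.-integrable `[s, t] (EFin \o (fun=> K)).
Proof.
apply: continuous_compact_integrable; first exact: segment_compact.
by apply: continuous_subspaceT => x; exact: cvg_cst.
Qed.

Lemma integral_segment_bound f s t (K : R) : s <= t ->
  mu.-integrable `[s, t] (EFin \o f) -> (forall r, s <= r <= t -> `|f r| <= K) ->
  `|\int[mu]_(r in `[s, t]) f r| <= K * (t - s).
Proof.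
move=> st fi fK; rewrite -Rintegral_segment_cst //.
apply: (le_trans (le_normr_Rintegral _ fi)) => //.
apply: le_Rintegral => //.
  by have := integrable_abse fi.
exact: integrable_segment_cst.
Qed.

End segment_integral.

Section creeping.
Context {R : realType}.

(** The supremum of the points where the inequality holds satisfies it, by
    continuity of f and monotonicity of Psi.  It cannot be less than b, since one
    could creep further from there. *)
Lemma creeping_bound (f Psi : R -> R) (a b : R) : a <= b ->
  {within `[a, b], continuous f} ->
  (forall s t, a <= s -> s <= t -> t <= b -> Psi s <= Psi t) ->
  (forall t, a <= t < b -> exists2 h : R, 0 < h &
     forall u, t < u < t + h -> u <= b -> f u - f t <= Psi u - Psi t) ->
  f b - f a <= Psi b - Psi a.
Proof.
move=> ab /within_continuous_dist fc Pmono step.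
pose S := [set t : R | a <= t <= b /\ f t - f a <= Psi t - Psi a].
have Sa : S a by rewrite /S /= !subrr lexx ab.
have hS : has_sup S by split; [exists a|exists b => t [/andP[]]].
set c := sup S; have Sc t : S t -> t <= c by move=> St; apply: ub_le_sup => //; exact: hS.2.
have ac : a <= c by exact: Sc.
have cb : c <= b by apply: ge_sup; [exists a|move=> t [/andP[]]].
have Pc : f c - f a <= Psi c - Psi a.
  apply/ler_addgt0Pr => e e0.
  have [|h h0 hf] := fc c _ e e0; first by rewrite /= in_itv /= ac.
  have [t [/andP[at_ tb] Pt] ct] := sup_adherent h0 hS; rewrite -/c in ct.
  have tc : t <= c by apply: Sc; split => //; rewrite at_.
  have := hf t; rewrite /= in_itv /= at_ tb => /(_ isT).
  rewrite distrC ger0_norm ?subr_ge0 // => /(_ ltac:(lra)).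
  rewrite ltr_norml => /andP[h1 h2]; have := Pmono t c at_ tc cb; lra.
have [cb'|bc] := ltP c b; last by have -> : b = c by apply/eqP; rewrite eq_le bc cb.
have [|h h0 hs] := step c; first by rewrite ac.
pose u := Num.min (c + h / 2) b.
have cu : c < u by rewrite lt_min cb' andbT; lra.
have ub : u <= b by rewrite ge_min lexx orbT.
have uh : u < c + h by rewrite gt_min; apply/orP; left; lra.
have := hs u ltac:(lra) ub => hu.
have : S u by split; [lra|lra].
by move=> /Sc; rewrite leNgt cu.
Qed.

End creeping.

Section null_sets.
Context {R : realType}.
Notation mu := (@lebesgue_measure R).

(** A null set is covered by open sets of measure e / 2^(k+1).  The sum of the
    lengths of their traces on [a, t] is small, and its right derivative is
    infinite at every point of the null set, because such a point is interior to
    all the covering sets. *)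
Lemma null_set_weight (N : set R) (a b e : R) : 0 < e -> mu.-negligible N ->
  exists h : R -> R, [/\ h a = 0, h b <= e,
    forall s t, a <= s -> s <= t -> t <= b -> h s <= h t &
    forall t n, a <= t -> N t -> exists2 del : R, 0 < del &
      forall u, t < u < t + del -> u <= b -> n%:R * (u - t) <= h u - h t].
Proof.
move=> e0 [A [mA A0 NA]].
have A0' : lebesgue_measure A = 0%E by [].
have covers (k : nat) : exists U : set R, [/\ open U, A `<=` U &
    (mu U <= (e / (2 ^ k.+1)%:R)%:E)%E].
  have ek : 0 < e / (2 ^ k.+1)%:R by rewrite divr_gt0 // ltr0n expn_gt0.
  have Afin : (lebesgue_measure A < +oo)%E by rewrite A0'.
  have [U [oU AU muU]] := lebesgue_regularity_outer mA Afin ek.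
  exists U; split => //; apply: ltW.
  have mU : measurable U by exact: measurable_realfun.open_measurable.
  have -> : mu U = (mu (U `\` A) + 0)%E.
    transitivity (mu (U `\` A) + mu (U `&` A))%E; first exact: measureDI.
    by congr (_ + _)%E; rewrite (setIidr AU); exact: A0'.
  by rewrite adde0.
have [V HV] := choice covers.
pose W k (s t : R) : set R := V k `&` `]s, t].
have mW k s t : measurable (W k s t).
  by apply: measurableI => //; apply: measurable_realfun.open_measurable; have [] := HV k.
pose c s t : \bar R := (\sum_(k <oo) mu (W k s t))%E.
have c0 s t : (0 <= c s t)%E by apply: nneseries_ge0.
have c_le s t : (c s t <= e%:E)%E.
  apply: le_trans (epsilon_trick0 xpredT (ltW e0)).
  apply: lee_nneseries => // k _; have [oV _ muV] := HV k.
  apply: le_trans muV; apply: le_measure; [exact: mem_set (mW _ _ _)| |exact: subIsetl].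
  by apply: mem_set; exact: measurable_realfun.open_measurable.
have c_fin s t : c s t \is a fin_num.
  by rewrite ge0_fin_numE // (le_lt_trans (c_le _ _)) // ltry.
have cD s u t : s <= u -> u <= t -> c s t = (c s u + c u t)%E.
  move=> su ut; rewrite /c -nneseriesD //; apply: eq_eseriesr => k _.
  have -> : W k s t = W k s u `|` W k u t.
    rewrite /W -setIUr; congr (_ `&` _).
    by rewrite (@itv_bndbnd_setU _ _ _ (BRight u)) // bnd_simp.
  apply: measureU; [exact: mW|exact: mW|].
  rewrite /W; apply/seteqP; split => // x [[_ /=]].
  by rewrite in_itv /= => /andP[_ xu] [_]; rewrite /= in_itv /= ltNge xu.
exists (fun t => fine (c a t)); split.
- rewrite /c (eq_eseriesr (g := fun=> 0%E)) ?eseries0 // => k _.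
  by rewrite /W set_itvoc0 setI0 measure0.
- by rewrite -lee_fin fineK.
- move=> s t as_ st tb; apply: fine_le => //.
  by rewrite (cD a s t) // leeDl.
- move=> t n at_ Nt.
  have [del del0 Hdel] : exists2 del : R, 0 < del & forall k, (k < n)%N ->
      forall r, t <= r < t + del -> V k r.
    elim: n => [|n [del del0 IH]]; first by exists 1.
    have [oV AV _] := HV n.
    have : nbhs t (V n) by apply: open_nbhs_nbhs; split => //; exact/AV/NA.
    move=> /nbhs_ballP[del' /= del'0 Hdel'].
    exists (Num.min del del'); first by rewrite lt_min del0.
    move=> k; rewrite ltnS leq_eqVlt => /predU1P[->|kn] r /andP[tr rt].
      apply: Hdel'; rewrite /ball /= distrC ger0_norm ?subr_ge0 // ltrBlDl.
      by apply: lt_le_trans rt _; rewrite lerD2l ge_min lexx orbT.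
    apply: (IH k kn); rewrite tr /=; apply: lt_le_trans rt _.
    by rewrite lerD2l ge_min lexx.
  exists del => // u /andP[tu utd] ub.
  have -> : fine (c a u) - fine (c a t) = fine (c t u).
    by rewrite (cD a t u) ?fineD // ?ltW // addrC addKr.
  rewrite -lee_fin fineK //.
  apply: le_trans (nneseries_lim_ge n _) => //.
  rewrite big_mkord (eq_bigr (fun=> (u - t)%:E)); last first.
    move=> k _; rewrite /W setIidr; last first.
      move=> r; rewrite /= in_itv /= => /andP[tr ru]; apply: (Hdel k (ltn_ord k)).
      by rewrite ltW //= (le_lt_trans ru).
    by rewrite lebesgue_measure_itv /= lte_fin tu.
  by rewrite sumEFin lee_fin sumr_const card_ord mulr_natl.
Qed.

End null_sets.

Section everywhere_derivative.
Context {R : realType}.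
Notation mu := (@lebesgue_measure R).
Implicit Types (f G g : R -> R) (a b : R).

Lemma derivable_lower_bound (F : R -> R) (t e : R) : derivable F t 1 -> 0 < e ->
  exists2 h : R, 0 < h & forall u, t < u < t + h ->
    (u - t) * (F^`()%classic t - e) <= F u - F t.
Proof.
move=> Fd e0; have /cvgrPdist_le /(_ e e0) := Fd.
rewrite -/(derive F t 1) -derive1E near_withinE => /nbhs_ballP[h /= h0 hF].
exists h => // u /andP[tu uth].
have ut : 0 < u - t by rewrite subr_gt0.
have := hF (u - t); rewrite /ball /= sub0r normrN gtr0_norm // => /(_ ltac:(lra)).
rewrite gt_eqF // => /(_ isT); rewrite [_ *: 1]mulr1 subrK.
rewrite -[_ *: _]/((u - t)^-1 * (F u - F t)) ler_norml => /andP[_].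
rewrite lerBlDr -lerBlDl ler_pdivlMl //.
Qed.

Definition right_derivative_le f a b G : Prop :=
  forall t e, a <= t < b -> 0 < e -> exists2 h : R, 0 < h &
    forall u, t < u < t + h -> u <= b -> f u - f t <= (u - t) * (G t + e).

(** At almost every point the integral of G has derivative G, and f can be
    compared with it directly.  On the remaining null set nothing is known about
    the integral, but the growth of f is dominated by the weight of the null set. *)
Lemma le_integral_of_right_derivative_ge0 f G a b : a <= b ->
  {within `[a, b], continuous f} -> mu.-integrable `[a, b] (EFin \o G) ->
  (forall r, a <= r <= b -> 0 <= G r) -> right_derivative_le f a b G ->
  f b - f a <= \int[mu]_(r in `[a, b]) G r.
Proof.
move=> ab fc Gi G0 fG.
pose H : R -> R := G \_ `[a, b].
have HE r : a <= r <= b -> H r = G r.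
  by move=> arb; rewrite /H patchE mem_set //= in_itv.
have H0 r : 0 <= H r.
  rewrite /H patchE; case: ifPn => // /set_mem /=; rewrite in_itv; exact: G0.
have Hi : mu.-integrable [set: R] (EFin \o H).
  by rewrite /H -restrict_EFin -integrable_mkcond.
have HiS (D : set R) : measurable D -> mu.-integrable D (EFin \o H).
  by move=> mD; apply: integrableS Hi.
pose F (x : R) := \int[mu]_(r in `[a, x]) H r.
have Fsplit s t : a <= s -> s <= t -> F t - F s = \int[mu]_(r in `[s, t]) H r.
  move=> as_ st; rewrite /F (@integral_segment_split _ H a t a s t) //; first by rewrite addrC addKr.
  exact: HiS.
have Fmono s t : a <= s -> s <= t -> F s <= F t.
  by move=> as_ st; rewrite -subr_ge0 Fsplit // Rintegral_ge0.
have Fae := @FTC1 R H (BLeft a) (fun y => HiS _ (measurable_itv _))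
  (integrable_locally_restrict (measurable_itv _) Gi).
rewrite /= -/F in Fae.
(* The point a is added because nothing is known about F to the left of a. *)
pose bad : set R := [set t | ~ (a < t -> derivable F t 1 /\ F^`()%classic t = H t)].
have bad0 : mu.-negligible (bad `|` [set a]).
  apply: negligibleU.
    by apply: negligibleS Fae => t /= tbad; apply: contra_not tbad => + at_; exact.
  by exists [set a]; split => //; exact: lebesgue_measure_set1.
apply/ler_addgt0Pr => e e0.
have e1 : 0 < e / 2 by lra.
have [h [ha hb hmono hbad]] := null_set_weight a b e1 bad0.
have ba : 0 <= b - a by rewrite subr_ge0.
have e2 : 0 < e / 2 / (b - a + 1) by apply: divr_gt0 => //; lra.
have -> : \int[mu]_(r in `[a, b]) G r = F b.
  by apply: eq_Rintegral => r /set_mem /=; rewrite in_itv /= => /HE.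
set e' := e / 2 / (b - a + 1) in e2.
have e'b : e' * (b - a) <= e / 2.
  rewrite /e' mulrAC ler_pdivrMr; last lra.
  by rewrite ler_wpM2l //; lra.
have Fa : 0 <= F a by apply: Rintegral_ge0.
(* F dominates f outside the bad set and h on it; the linear term absorbs the
   errors in the two derivatives. *)
pose Psi t := F t + h t + e' * (t - a).
suff : f b - f a <= Psi b - Psi a.
  rewrite /Psi ha subrr mulr0; lra.
apply: creeping_bound => //.
  move=> s t as_ st tb; have := Fmono s t as_ st; have := hmono s t as_ st tb.
  have : e' * (s - a) <= e' * (t - a) by apply: ler_wpM2l; [exact: ltW|lra].
  rewrite /Psi; lra.
move=> t /andP[at_ tb].
have [tbad|tgood] := pselect ((bad `|` [set a]) t).
- have [d1 d10 Hd1] := fG t 1 ltac:(lra) ltr01.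
  have [d2 d20 Hd2] := hbad t (Num.truncn (G t + 1)).+1 at_ tbad.
  exists (Num.min d1 d2); first by rewrite lt_min d10.
  move=> u /andP[tu utd] ub.
  have [ud1 ud2] : u < t + d1 /\ u < t + d2.
    by move: utd; rewrite -ltrBlDl lt_min => /andP[]; rewrite !ltrBlDl.
  have h1 := Hd1 u (introT andP (conj tu ud1)) ub; have h2 := Hd2 u (introT andP (conj tu ud2)) ub.
  have h3 := Fmono t u at_ (ltW tu).
  have h4 : e' * (t - a) <= e' * (u - a) by apply: ler_wpM2l; [exact: ltW|lra].
  have h5 : (u - t) * (G t + 1) <= (Num.truncn (G t + 1)).+1%:R * (u - t).
    by rewrite mulrC ler_wpM2r ?subr_ge0 ?ltW // truncnS_gt.
  by rewrite /Psi; clear Hd1 Hd2; lra.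
- have at' : a < t.
    by rewrite lt_neqAle at_ andbT; apply/eqP => E; apply: tgood; right.
  have [Fd FE] : derivable F t 1 /\ F^`()%classic t = H t.
    by apply: contrapT => nF; apply: tgood; left => /=; apply: contra_not nF; exact.
  have e'2 : 0 < e' / 2 by lra.
  have [d1 d10 Hd1] := fG t (e' / 2) ltac:(lra) e'2.
  have [d2 d20 Hd2] := derivable_lower_bound Fd e'2.
  exists (Num.min d1 d2); first by rewrite lt_min d10.
  move=> u /andP[tu utd] ub.
  have [ud1 ud2] : u < t + d1 /\ u < t + d2.
    by move: utd; rewrite -ltrBlDl lt_min => /andP[]; rewrite !ltrBlDl.
  have h1 := Hd1 u (introT andP (conj tu ud1)) ub; have h2 := Hd2 u (introT andP (conj tu ud2)).
  rewrite FE HE ?at_ ?(ltW tb) // in h2.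
  have h3 := hmono t u at_ (ltW tu) ub.
  by rewrite /Psi; clear Hd1 Hd2; lra.
Qed.

(** Bounding the derivative below by -n makes it nonnegative after adding n t;
    the truncations are removed by dominated convergence. *)
Lemma le_integral_of_right_derivative f g a b : a <= b ->
  {within `[a, b], continuous f} -> mu.-integrable `[a, b] (EFin \o g) ->
  right_derivative_le f a b g -> f b - f a <= \int[mu]_(r in `[a, b]) g r.
Proof.
move=> ab fc gi fg.
pose gn (n : nat) r := Num.max (g r) (- n%:R).
have gm : measurable_fun `[a, b] g by apply/measurable_EFinP; exact: measurable_int gi.
have gnm n : measurable_fun `[a, b] (gn n).
  by apply: measurable_maxr => //; exact: measurable_cst.
have gn_le n r : `|gn n r| <= `|g r|.
  rewrite /gn; have n0 : 0 <= n%:R :> R by [].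
  case: (leP (g r) (- n%:R)) => // h.
  by rewrite !ler0_norm; lra.
have gni n : mu.-integrable `[a, b] (EFin \o gn n).
  apply: le_integrable gi => //; first by apply/measurable_EFinP; exact: gnm.
  by move=> r _ /=; rewrite lee_fin.
have fgn n : f b - f a <= \int[mu]_(r in `[a, b]) gn n r.
  have fi := integrable_segment_cst a b n%:R.
  have := @le_integral_of_right_derivative_ge0 (fun t => f t + n%:R * t) (fun r => gn n r + n%:R) a b ab.
  rewrite RintegralD // Rintegral_segment_cst // => H.
  have {H} : f b + n%:R * b - (f a + n%:R * a) <=
      \int[mu]_(r in `[a, b]) gn n r + n%:R * (b - a).
    apply: H.
    - apply/within_continuous_dist => x xab e e0; have e2 : 0 < e / 2 by lra.
      have [h h0 hf] := (within_continuous_dist _ _).1 fc x xab _ e2.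
      exists (Num.min h (e / 2 / (n%:R + 1))).
        by rewrite lt_min h0 divr_gt0 // ltr_wpDl.
      move=> y yab; rewrite lt_min => /andP[yh ye].
      have -> : f y + n%:R * y - (f x + n%:R * x) = (f y - f x) + n%:R * (y - x) by ring.
      apply: (le_lt_trans (ler_normD _ _)); rewrite [e]splitr ltr_leD ?hf //.
      rewrite normrM ger0_norm //; rewrite ltr_pdivlMr ?ltr_wpDl // in ye.
      have := normr_ge0 (y - x); have : 0 <= n%:R :> R by []; lra.
    - rewrite (_ : EFin \o _ = ((EFin \o gn n) \+ (EFin \o fun=> n%:R))%E) //.
      exact: integrableD.
    - by move=> r _; rewrite /gn -lerBlDr sub0r le_max lexx orbT.
    - move=> t e tab e0; have [h h0 hf] := fg t e tab e0; exists h => // u tu ub.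
      have := hf u tu ub; have gg : g t <= gn n t by rewrite /gn le_max lexx.
      have : (u - t) * (g t + e) <= (u - t) * (gn n t + e).
        by rewrite ler_wpM2l ?lerD2r //; lra.
      lra.
  lra.
have gfin n : (\int[mu]_(r in `[a, b]) (gn n r)%:E)%E \is a fin_num by apply: integrable_fin_num (gni n).
have [|||||_ _ cv] := @dominated_convergence _ _ _ mu `[a, b] (measurable_itv _)
   (fun n => EFin \o gn n) (EFin \o g) (EFin \o (fun r => `|g r|)).
- by move=> n; apply/measurable_EFinP; exact: gnm.
- exact/measurable_EFinP.
- apply: aeW => r _; apply: cvg_near_cst.
  exists (Num.truncn `|g r|).+1 => // n /= rn; rewrite /gn; congr (_%:E).
  apply/max_idPl; rewrite lerNl; apply: le_trans (ler_norm _) _.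
  by rewrite normrN (le_trans (ltW (truncnS_gt _))) // ler_nat.
- by have := integrable_abse gi.
- by apply: aeW => r n _; rewrite /= lee_fin.
rewrite -lee_fin /Rintegral fineK; last by apply: integrable_fin_num gi.
rewrite -(cvg_lim _ cv) //; apply: lime_ge; first by apply/cvg_ex; eexists; exact: cv.
by apply: nearW => n; have := fgn n; rewrite -lee_fin /Rintegral fineK.
Qed.

Lemma right_derivative_leN f g a b :
  (forall t e, a <= t < b -> 0 < e -> exists2 h : R, 0 < h &
     forall u, t < u < t + h -> u <= b -> `|f u - f t - (u - t) * g t| <= e * (u - t)) ->
  right_derivative_le f a b g /\ right_derivative_le (- f) a b (- g).
Proof.
move=> H; split=> t e tab e0; have [h h0 hf] := H t e tab e0; exists h => // u tu ub.
  by have := hf u tu ub; rewrite ler_norml => /andP[_ ?]; lra.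
by have := hf u tu ub; rewrite ler_norml !fctE => /andP[? _]; lra.
Qed.

(** The derivative g is assumed integrable only, so that f is not known to be
    absolutely continuous; that g is its derivative at every point is essential. *)
Theorem integral_of_derivative f g a b : a <= b ->
  {within `[a, b], continuous f} -> mu.-integrable `[a, b] (EFin \o g) ->
  (forall t e, a <= t < b -> 0 < e -> exists2 h : R, 0 < h &
     forall u, t < u < t + h -> u <= b -> `|f u - f t - (u - t) * g t| <= e * (u - t)) ->
  \int[mu]_(r in `[a, b]) g r = f b - f a.
Proof.
move=> ab fc gi /right_derivative_leN[h1 h2]; apply/eqP; rewrite eq_le; apply/andP; split.
  have := @le_integral_of_right_derivative (- f) (- g) a b ab _ _ h2.
  rewrite !fctE (_ : (fun r => - g r) = (fun r => -1 * g r)); last first.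
    by apply/funext => r; rewrite mulN1r.
  rewrite RintegralZl // mulN1r => H.
  have {H} : - f b - - f a <= - \int[mu]_(r in `[a, b]) g r.
    apply: H; last by have := integrableN gi.
    apply/within_continuous_dist => x xab e e0.
    have [h h0 hf] := (within_continuous_dist _ _).1 fc x xab _ e0.
    by exists h => // y yab yx; rewrite -opprD normrN; exact: hf.
  lra.
exact: le_integral_of_right_derivative.
Qed.

End everywhere_derivative.

(** * Integrals against laws at a small Wasserstein distance *)

Section bounded_integrals.
Context {R : realType} {dd : measure_display} {X : measurableType dd}.

Lemma open_preimage_measurable (f : X -> R) :
  (forall B : set R, open B -> measurable (f @^-1` B)) -> measurable_fun setT f.
Proof.
move=> fo; apply: (measurability _ (RGenOpens.measurableE R)).
by move=> _ [_ [a [b ->] <-]]; rewrite setTI; apply: fo; exact: interval_open.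
Qed.

Variable P : probability X R.

Lemma bounded_integrable (f : X -> R) (C : R) : measurable_fun setT f ->
  (forall a, `|f a| <= C) -> P.-integrable setT (EFin \o f).
Proof.
move=> fm fC; apply: measurable_bounded_integrable => //.
- exact: le_lt_trans (probability_le1 P measurableT) (ltry _).
- exists C; split; first exact: num_real.
  by move=> M CM a _ /=; apply: le_trans (fC a) (ltW CM).
Qed.

Lemma bounded_Rintegral (f : X -> R) (C : R) : measurable_fun setT f ->
  (forall a, `|f a| <= C) -> `|\int[P]_(a in setT) f a| <= C.
Proof.
move=> fm fC; have fi := bounded_integrable fm fC.
apply: (le_trans (le_normr_Rintegral _ fi)) => //.
have ci : P.-integrable setT (EFin \o (fun=> C)).
  by apply: (@bounded_integrable _ `|C|) => //; exact: measurable_cst.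
apply: (@le_trans _ _ (\int[P]_(a in setT) C)).
  by apply: le_Rintegral => //; have := integrable_abse fi.
suff -> : \int[P]_(a in setT) C = C by [].
transitivity (C * fine (P setT)); first exact: Rintegral_cst.
by rewrite probability_setT mulr1.
Qed.

End bounded_integrals.

Section coupling_bound.
Context {R : realType} {U : pmetricType R}.

Lemma lipschitz_mdist_continuous (V : normedModType R) (f : U -> V) (L : R) :
  (forall a a', `|f a - f a'| <= L * mdist a a') -> continuous f.
Proof.
move=> fL a; apply/cvgrPdist_lt => e e0; apply/(@nbhs_ballP R U).
exists (e / (`|L| + 1)) => /=; first by rewrite divr_gt0 // ltr_wpDl.
move=> a'; rewrite ballEmdist /= ltr_pdivlMr ?ltr_wpDl // => aa'.
apply: (le_lt_trans (fL a a')); apply: le_lt_trans aa'.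
have := mdist_ge0 a a'; have := ler_norm L; nra.
Qed.

Lemma mdist_continuous : continuous (fun z : U * U => mdist z.1 z.2).
Proof.
move=> [a b]; apply/cvgrPdist_lt => e e0; apply/(@nbhs_ballP R (U * U)%type).
exists (e / 2) => /=; first lra.
move=> [a' b'] [] /=; rewrite !ballEmdist /= => aa bb.
have h1 := metric_triangle a a' b; have h2 := metric_triangle a' b' b.
have h3 := metric_triangle a' a b'; have h4 := metric_triangle a b b'.
have s1 := metric_sym a a'; have s2 := metric_sym b b'.
rewrite ltr_norml; apply/andP; split; lra.
Qed.

Lemma continuous_fst_comp (f : U -> R) : continuous f -> continuous (fun z : U * U => f z.1).
Proof. by move=> fc z; apply: continuous_comp; [exact: cvg_fst|exact: fc]. Qed.

Lemma continuous_snd_comp (f : U -> R) : continuous f -> continuous (fun z : U * U => f z.2).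
Proof. by move=> fc z; apply: continuous_comp; [exact: cvg_snd|exact: fc]. Qed.

Lemma continuous_borel (f : U -> R) : continuous f ->
  measurable_fun [set: borel U] (f : borel U -> R).
Proof.
move=> /continuousP fc; apply: open_preimage_measurable => B oB.
by apply: sub_sigma_algebra; exact: fc.
Qed.

Lemma continuous_borel2 (f : U * U -> R) : continuous f ->
  measurable_fun [set: borel (U * U)%type] (f : borel (U * U)%type -> R).
Proof.
move=> /continuousP fc; apply: open_preimage_measurable => B oB.
by apply: sub_sigma_algebra; exact: fc.
Qed.

(** The marginals of a coupling are its images under the projections, on the
    Borel sets. *)
Lemma marginal_integral (P : probability (borel (U * U)%type) R)
    (Q : probability (borel U) R) (pi : U * U -> U) (f : U -> R) (C : R) :
  continuous pi ->
  (forall A : set U, measurable (A : set (borel U)) -> P (pi @^-1` A) = Q A) ->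
  continuous f -> (forall a, `|f a| <= C) ->
  \int[P]_(z in [set: borel (U * U)%type]) f (pi z) = \int[Q]_(a in [set: borel U]) f a.
Proof.
move=> pc PQ fc fC.
have pm : measurable_fun [set: borel (U * U)%type] (pi : borel (U * U)%type -> borel U).
  apply: (@measurability _ _ _ (borel U) _ _ (@open U) erefl) => _ [A oA <-].
  by rewrite setTI; apply: sub_sigma_algebra; move/continuousP: pc; exact.
congr fine.
have fm := continuous_borel fc; have fi := bounded_integrable Q fm fC.
have pfi : P.-integrable (pi @^-1` [set: borel U]) (EFin \o f \o pi).
  rewrite preimage_setT.
  have fpm : measurable_fun [set: borel (U * U)%type] (fun z : borel (U * U)%type => f (pi z)).
    by apply: continuous_borel2 => z; apply: continuous_comp; [exact: pc|exact: fc].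
  exact: (bounded_integrable P fpm (fun z => fC (pi z))).
have fm' : measurable_fun [set: borel U] (EFin \o f) by apply/measurable_EFinP.
have := @integral_pushforward _ _ (borel (U * U)%type) (borel U) R pi pm P setT
  (EFin \o f) fm' pfi measurableT.
rewrite preimage_setT => <-.
by apply: eq_measure_integral => A mA _; exact: PQ.
Qed.

(** Integrates L dist <= L w / 2 + L dist^2 / (2 w) against a coupling whose
    quadratic cost is less than w^2. *)
Lemma coupling_integral_bound (P1 P2 : probability (borel U) R) (f : U -> R) (C L w : R) :
  0 <= L -> (forall a, `|f a| <= C) -> (forall a a', `|f a - f a'| <= L * mdist a a') ->
  0 < w -> (W2 P1 P2 < w%:E)%E ->
  `|\int[P1]_(a in [set: borel U]) f a - \int[P2]_(a in [set: borel U]) f a| <= L * w.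
Proof.
move=> L0 fC fL w0 /ereal_inf_lt[_ [P PP <-] Pw].
have fc : continuous f by exact: lipschitz_mdist_continuous fL.
have [PP1 PP2] : (forall A : set U, measurable (A : set (borel U)) -> P (fst @^-1` A) = P1 A)
  /\ (forall A : set U, measurable (A : set (borel U)) -> P (snd @^-1` A) = P2 A).
  by split=> A mA; have [] := PP A mA.
have f1c := continuous_fst_comp fc; have f2c := continuous_snd_comp fc.
rewrite -(@marginal_integral P P1 fst f C) //; last by move=> z; exact: cvg_fst.
rewrite -(@marginal_integral P P2 snd f C) //; last by move=> z; exact: cvg_snd.
have f1i := bounded_integrable P (continuous_borel2 f1c) (fun z => fC z.1).
have f2i := bounded_integrable P (continuous_borel2 f2c) (fun z => fC z.2).
rewrite -RintegralB //.
have fbi : P.-integrable [set: borel (U * U)%type] (EFin \o (fun z => f z.1 - f z.2)).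
  rewrite (_ : EFin \o _ = ((EFin \o (fun z => f z.1)) \- (EFin \o (fun z => f z.2)))%E) //.
  exact: integrableB.
rewrite -lee_fin EFin_normr_Rintegral //.
apply: (le_trans (le_abse_integral _ _ _)) => //.
  by case/integrableP: fbi.
have d2m : measurable_fun [set: borel (U * U)%type]
    (fun z : borel (U * U)%type => (mdist z.1 z.2 ^+ 2)%:E).
  apply/measurable_EFinP; apply: continuous_borel2 => z.
  apply: (@continuous_comp _ _ _ (fun z : U * U => mdist z.1 z.2) (fun x : R => x ^+ 2)).
    exact: mdist_continuous.
  exact: exprn_continuous.
have int_d2 : (\int[P]_z (mdist z.1 z.2 ^+ 2)%:E <= (w ^+ 2)%:E)%E.
  have i0 : (0 <= \int[P]_z (mdist z.1 z.2 ^+ 2)%:E)%E.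
    by apply: integral_ge0 => z _; rewrite lee_fin exprn_ge0 // mdist_ge0.
  move: i0 Pw; case: (\int[P]_z _)%E => [r| |] //.
  - rewrite poweR_EFin lte_fin !lee_fin => r0 rw.
    rewrite -[r](powRr1 r0) -(mulVf (_ : 2 != 0 :> R)) // powRrM powR_mulrn ?powR_ge0 //.
    by rewrite lerXn2r ?nnegrE ?powR_ge0 ?ltW.
  - by rewrite poweRyr ?invr_neq0.
apply: (@le_trans _ _ (\int[P]_z ((L * (w / 2))%:E + (L / (2 * w))%:E * (mdist z.1 z.2 ^+ 2)%:E))%E).
  apply: ge0_le_integral => //.
  - by apply: measurableT_comp => //; case/integrableP: fbi.
  - apply: emeasurable_funD => //; exact: measurable_funeM.
  - move=> z _; rewrite -EFinM -EFinD /= lee_fin.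
    apply: (le_trans (fL _ _)); set D := mdist z.1 z.2.
    have -> : L * (w / 2) + L / (2 * w) * D ^+ 2 = L * (w / 2 + D ^+ 2 / (2 * w)).
      by rewrite mulrDr; congr (_ + _); rewrite -mulrA [(2 * w)^-1 * _]mulrC.
    rewrite ler_wpM2l // -subr_ge0.
    have -> : w / 2 + D ^+ 2 / (2 * w) - D = (D - w) ^+ 2 / (2 * w).
      by field; rewrite gt_eqF.
    by rewrite divr_ge0 ?sqr_ge0 // mulr_ge0 // ltW.
rewrite ge0_integralD //; first last.
- exact: measurable_funeM.
- move=> z _; rewrite -EFinM lee_fin mulr_ge0 ?exprn_ge0 ?mdist_ge0 // divr_ge0 // mulr_ge0 // ltW //.
- by move=> z _; rewrite lee_fin mulr_ge0 // divr_ge0 // ltW.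
have -> : (\int[P]_(z in [set: borel (U * U)%type]) (L * (w / 2))%:E = (L * (w / 2))%:E)%E.
  transitivity ((L * (w / 2))%:E * P setT)%E; first exact: integral_cst.
  by rewrite probability_setT mule1.
rewrite ge0_integralZl //; first last.
- by rewrite lee_fin divr_ge0 // mulr_ge0 // ltW.
- by move=> z _; rewrite lee_fin exprn_ge0 // mdist_ge0.
apply: (@le_trans _ _ ((L * (w / 2))%:E + (L / (2 * w))%:E * (w ^+ 2)%:E)%E).
  apply: leeD2l; apply: lee_wpmul2l => //.
  by rewrite lee_fin divr_ge0 // mulr_ge0 // ltW.
rewrite -EFinM -EFinD lee_fin le_eqVlt; apply/orP; left; apply/eqP; field.
by rewrite gt_eqF.
Qed.

End coupling_bound.

(** * The averaged drift *)

Section matrix_segment_integral.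
Context {R : realType} {p q : nat}.
Notation mu := (@lebesgue_measure R).
Implicit Types (f g : R -> 'M[R]_(p, q)).

Definition mx_integrable (a b : R) f : Prop :=
  forall i j, mu.-integrable `[a, b] (EFin \o (fun r => f r i j)).

Lemma mx_integrable_sub (a b s t : R) f : a <= s -> t <= b ->
  mx_integrable a b f -> mx_integrable s t f.
Proof. by move=> as_ tb fi i j; exact: integrable_subsegment (fi i j). Qed.

Lemma continuous_mx_integrable (a b : R) f :
  {within `[a, b], continuous f} -> mx_integrable a b f.
Proof.
move=> fc i j; apply: continuous_compact_integrable; first exact: segment_compact.
exact: within_continuous_entry.
Qed.

Lemma mx_integral_split f (a b s u t : R) : a <= s -> s <= u -> u <= t -> t <= b ->
  mx_integrable a b f ->
  mx_integral mu `[s, t] f = mx_integral mu `[s, u] f + mx_integral mu `[u, t] f.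
Proof.
move=> as_ su ut tb fi; apply/matrixP => i j; rewrite !mxE.
exact: (integral_segment_split as_ su ut tb (fi i j)).
Qed.

Lemma mx_integral_bound f (s t K : R) : s <= t -> mx_integrable s t f ->
  (forall r, s <= r <= t -> `|f r| <= K) -> `|mx_integral mu `[s, t] f| <= K * (t - s).
Proof.
move=> st fi fK; have K0 : 0 <= K.
  by apply: le_trans (fK s _); rewrite ?normr_ge0 // lexx.
apply: ler_mx_norm => [|i j]; first by rewrite mulr_ge0 // subr_ge0.
rewrite mxE; apply: integral_segment_bound => // r rst.
exact: le_trans (ler_mx_entry _ _ _) (fK r rst).
Qed.

Lemma mx_integralB f g (s t : R) : mx_integrable s t f -> mx_integrable s t g ->
  mx_integral mu `[s, t] f - mx_integral mu `[s, t] g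
  = mx_integral mu `[s, t] (fun r => f r - g r).
Proof.
move=> fi gi; apply/matrixP => i j; rewrite !mxE -RintegralB //.
by apply: eq_Rintegral => r _; rewrite !mxE.
Qed.

Lemma mx_integrableB f g (s t : R) : mx_integrable s t f -> mx_integrable s t g ->
  mx_integrable s t (fun r => f r - g r).
Proof.
move=> fi gi i j.
rewrite (_ : EFin \o _ = ((EFin \o (fun r => f r i j)) \- (EFin \o (fun r => g r i j)))%E).
  exact: integrableB.
by apply/funext => r /=; rewrite !mxE EFinB.
Qed.

End matrix_segment_integral.

Lemma three_quarters_lt (R : realFieldType) (e : R) : 0 < e -> e / 4 + e / 4 + e / 4 < e.
Proof. lra. Qed.

Section drift.
Context {R : realType} {m k : nat} {U : pmetricType R}.
Notation V := 'cV[R]_m.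
Notation mu := (@lebesgue_measure R).
Variables (emb : U -> 'cV[R]_k) (T : R) (b : R -> V -> U -> V).
Hypothesis b_Cb : Cb011 emb T b.
Hypothesis b_unif : forall x (e : R), 0 < e -> exists2 h : R, 0 < h &
    forall u1 u2, 0 <= u1 <= T -> 0 <= u2 <= T -> `|u2 - u1| < h ->
      forall a, `|b u2 x a - b u1 x a| <= e.

Definition mean_drift (P : probability (borel U) R) (t : R) (x : V) : V :=
  mx_integral P [set: borel U] (b t x).

Lemma Cb011_lipschitz_x : exists2 C, 0 <= C & forall t x y a, 0 <= t <= T ->
  `|b t x a - b t y a| <= C * `|x - y|.
Proof.
have [C C0 HC] : exists2 C, 0 <= C & forall (j : 'I_m) t x a, 0 <= t <= T ->
    `|'D_(delta_mx j 0) ((b t)^~ a) x| <= C.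
  apply: (@finite_uniform_bound R 'I_m (fun j C => forall t x a, 0 <= t <= T ->
    `|'D_(delta_mx j 0) ((b t)^~ a) x| <= C)).
    by move=> j C C' CC' H t x a t0; exact: le_trans (H t x a t0) CC'.
  exact: (Cb011_partial_x_bounded b_Cb).
exists (m%:R * C); first by rewrite mulr_ge0.
move=> t x y a t0; apply: (@lipschitz_of_partials _ _ _ _ ((b t)^~ a)
  (fun j z => 'D_(delta_mx j 0) ((b t)^~ a) z)) => // j z.
  by apply: DeriveDef => //; exact: (Cb011_derivable_x b_Cb).
exact: HC.
Qed.

Lemma b_entry_continuous t x i j : 0 <= t <= T -> continuous (fun a => b t x a i j).
Proof.
move=> t0; have [C HC] := Cb011_lipschitz_a b_Cb.
apply: (@lipschitz_mdist_continuous _ _ _ _ C) => a a'.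
apply: le_trans (HC t x a a' t0).
by have := ler_mx_entry (b t x a - b t x a') i j; rewrite !mxE.
Qed.

Lemma b_entry_integrable (P : probability (borel U) R) t x i j : 0 <= t <= T ->
  P.-integrable [set: borel U] (EFin \o (fun a => b t x a i j)).
Proof.
move=> t0; have [C HC] := Cb011_bounded b_Cb.
have bm := continuous_borel (@b_entry_continuous t x i j t0).
apply: (bounded_integrable P bm (C := C)) => a.
exact: le_trans (ler_mx_entry _ _ _) (HC t x a t0).
Qed.

Lemma mean_drift_bounded : exists2 C, 0 <= C & forall P t x, 0 <= t <= T ->
  `|mean_drift P t x| <= C.
Proof.
have [C HC] := Cb011_bounded b_Cb; exists `|C| => // P t x t0.
apply: ler_mx_norm => // i j; rewrite mxE.
have bm := continuous_borel (@b_entry_continuous t x i j t0).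
apply: (bounded_Rintegral P bm) => a.
by apply: le_trans (ler_mx_entry _ _ _) (le_trans (HC t x a t0) (ler_norm _)).
Qed.

Lemma mean_drift_diff P t t' x x' (K : R) : 0 <= K -> 0 <= t <= T -> 0 <= t' <= T ->
  (forall a, `|b t x a - b t' x' a| <= K) ->
  `|mean_drift P t x - mean_drift P t' x'| <= K.
Proof.
move=> K0 t0 t'0 bK; apply: ler_mx_norm => // i j; rewrite !mxE.
rewrite -RintegralB //; [|exact: b_entry_integrable|exact: b_entry_integrable].
have bm := continuous_borel (@b_entry_continuous t x i j t0).
have bm' := continuous_borel (@b_entry_continuous t' x' i j t'0).
apply: (bounded_Rintegral P (measurable_funB bm bm')) => a.
by apply: le_trans (bK a); have := ler_mx_entry (b t x a - b t' x' a) i j; rewrite !mxE.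
Qed.

Lemma mean_drift_lipschitz : exists2 C, 0 <= C & forall P t x y, 0 <= t <= T ->
  `|mean_drift P t x - mean_drift P t y| <= C * `|x - y|.
Proof.
have [C C0 HC] := Cb011_lipschitz_x; exists C => // P t x y t0.
by apply: mean_drift_diff => // [|a]; [rewrite mulr_ge0|exact: HC].
Qed.

Lemma mean_drift_W2 : exists2 C, 0 <= C & forall P P' t x w, 0 <= t <= T ->
  0 < w -> (W2 P P' < w%:E)%E -> `|mean_drift P t x - mean_drift P' t x| <= C * w.
Proof.
have [C0 HC0] := Cb011_bounded b_Cb; have [C HC] := Cb011_lipschitz_a b_Cb.
exists `|C| => // P P' t x w t0 w0 Ww.
apply: ler_mx_norm => [|i j]; first by rewrite mulr_ge0 // ltW.
rewrite !mxE; apply: (@coupling_integral_bound _ _ _ _ _ C0) => // [a|a a'].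
  exact: le_trans (ler_mx_entry _ _ _) (HC0 t x a t0).
apply: (@le_trans _ _ `|b t x a - b t x a'|).
  by have := ler_mx_entry (b t x a - b t x a') i j; rewrite !mxE.
by apply: (le_trans (HC t x a a' t0)); rewrite ler_wpM2r ?mdist_ge0 ?ler_norm.
Qed.

(** The state, the law and the time are moved in this order: the uniform
    continuity of b in time is given for each state separately, so that the time
    has to be moved at the fixed state x r0. *)
Lemma mean_drift_continuous (K : set (P2 U)) (eps L s : R) (gamma : R -> P2 U) (x : R -> V) :
  0 < eps -> 0 < L -> 0 <= s -> admissible K eps L s T gamma ->
  {within `[s, T], continuous x} ->
  {within `[s, T], continuous (fun r => mean_drift (gamma r) r (x r))}.
Proof.
move=> eps0 L0 s0 [_ gW] /within_continuous_dist xc.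
have [C1 C10 H1] := mean_drift_lipschitz; have [C2 C20 H2] := mean_drift_W2.
apply/within_continuous_dist => r0; rewrite /= in_itv /= => r0T e e0.
have r00 : 0 <= r0 <= T by lra.
have e1 : 0 < e / (4 * (C1 + 1)) by apply: divr_gt0 => //; lra.
have e2 : 0 < e / (4 * (C2 + 1)) by apply: divr_gt0 => //; lra.
have e3 : 0 < e / 4 by lra.
have [|h1 h10 Hx] := xc r0 _ _ e1; first by rewrite /= in_itv.
have [h2 h20 HW] := small_powR eps0 (ltW L0) e2.
have [h3 h30 Hb] := b_unif (x r0) e3.
exists (Num.min h1 (Num.min h2 h3)); first by rewrite !lt_min h10 h20.
move=> r; rewrite /= in_itv /= => rT; rewrite !lt_min => /and3P[rh1 rh2 rh3].
have r0' : 0 <= r <= T by lra.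
have k1 : `|mean_drift (gamma r) r (x r) - mean_drift (gamma r) r (x r0)| <= e / 4.
  apply: (le_trans (H1 _ _ _ _ r0')).
  have := Hx r; rewrite /= in_itv /= => /(_ rT rh1).
  rewrite ltr_pdivlMr; last lra.
  have := normr_ge0 (x r - x r0); lra.
have k2 : `|mean_drift (gamma r) r (x r0) - mean_drift (gamma r0) r (x r0)| <= e / 4.
  apply: (le_trans (H2 _ _ _ _ _ r0' e2 _)).
    apply: le_lt_trans (gW r r0 rT r0T) _; rewrite lte_fin.
    by apply: HW => //; rewrite distrC.
  rewrite mulrA ler_pdivrMr; last lra.
  lra.
have k3 : `|mean_drift (gamma r0) r (x r0) - mean_drift (gamma r0) r0 (x r0)| <= e / 4.
  by apply: mean_drift_diff => //; [lra|exact: Hb].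
have -> : mean_drift (gamma r) r (x r) - mean_drift (gamma r0) r0 (x r0)
  = (mean_drift (gamma r) r (x r) - mean_drift (gamma r) r (x r0))
   + (mean_drift (gamma r) r (x r0) - mean_drift (gamma r0) r (x r0))
   + (mean_drift (gamma r0) r (x r0) - mean_drift (gamma r0) r0 (x r0)).
  move: k1 k2 k3; move: (mean_drift _ _ _) (mean_drift _ _ _) (mean_drift _ _ _) (mean_drift _ _ _).
  by move=> ? ? ? ? _ _ _; mx_ring.
apply: (le_lt_trans (ler_normD _ _)).
apply: (@le_lt_trans _ _ (e / 4 + e / 4 + e / 4)).
  apply: lerD k3; apply: (le_trans (ler_normD _ _)); exact: lerD k1 k2.
exact: three_quarters_lt.
Qed.

End drift.

(** * Equations driven by differentiable paths *)

Lemma compact_uniform_continuity (R : realType) (V W : normedModType R) (A : set V)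
    (f : V -> W) (e : R) :
  compact A -> {within A, continuous f} -> 0 < e -> exists2 h : R, 0 < h &
    forall x y, A x -> A y -> `|y - x| < h -> `|f y - f x| < e.
Proof.
move=> /compact_near_coveringP /near_covering_withinP Ac /within_continuous_dist fc e0.
have : \forall h \near (0 : R)^'+, A `<=` (fun x => forall y, A y -> `|y - x| < h -> `|f y - f x| < e).
  apply: Ac => x Ax; have e2 : 0 < e / 2 by lra.
  have [h h0 Hh] := fc x Ax _ e2; have h2 : 0 < h / 2 by lra.
  exists (ball x (h / 2), [set h' | h' < h / 2]) => /=.
    split; first by apply/nbhs_ballP; exists (h / 2).
    exact: nbhs_right_lt.
  move=> [x' h'] /= [xx' h'h] Ax' y Ay yx'.
  have x'x : `|x' - x| < h / 2 by move: xx'; rewrite -ball_normE /= distrC.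
  have H1 : `|f y - f x| < e / 2.
    apply: Hh => //; have -> : y - x = (y - x') + (x' - x) by rewrite addrA subrK.
    by apply: le_lt_trans (ler_normD _ _) _; lra.
  have H2 : `|f x' - f x| < e / 2 by apply: Hh => //; lra.
  have -> : f y - f x' = (f y - f x) - (f x' - f x) by rewrite opprB addrA subrK.
  by apply: le_lt_trans (ler_normB _ _) _; lra.
move=> H; near (0 : R)^'+ => h; exists h; first by near: h; exact: nbhs_right_gt.
by move=> x y Ax Ay; apply: (near H h).
Unshelve. all: by end_near. Qed.

Lemma mx_integral_mull (R : realType) p q n (A : 'M[R]_(p, q)) (f : R -> 'M[R]_(q, n)) (s t : R) :
  mx_integrable s t f ->
  A *m mx_integral lebesgue_measure `[s, t] f
  = mx_integral lebesgue_measure `[s, t] (fun r => A *m f r).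
Proof.
move=> fi; apply/matrixP => i j; rewrite !mxE.
pose g l (r : R) := A i l * f r l j.
have gi l : (@lebesgue_measure R).-integrable `[s, t] (EFin \o g l).
  rewrite (_ : EFin \o _ = (fun r => (A i l)%:E * (EFin \o (fun r => f r l j)) r)%E) //.
  exact: (integrableZl _ _ (fi l j)).
rewrite /Rintegral.
under [X in fine X]eq_integral => r _ do rewrite mxE -sumEFin.
rewrite (_ : (\int[_]_(r in _) _)%E
    = (\sum_(l < q) \int[@lebesgue_measure R]_(r in `[s, t]) (EFin \o g l) r)%E); last first.
  by apply: integral_sum => // l; exact: gi.
rewrite -sum_fine => [|l _]; last by apply: integrable_fin_num => //; exact: gi.
apply: eq_bigr => l _; rewrite mxE -RintegralZl //; exact: fi.
Qed.

Section smooth_driver.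
Context {R : realType} {d : nat}.
Notation mu := (@lebesgue_measure R).
Variables (T : R) (z : R -> 'cV[R]_d).
Hypothesis T_gt0 : 0 < T.
Hypothesis z_diff : differentiable_path T z.

Notation z' := (derive_in `[0, T] z).
Implicit Types (s t u v r : R).

Lemma smooth_path_continuous : {within `[0, T], continuous z}.
Proof.
apply: derivable_in_continuous => t; rewrite /= in_itv /= => t0.
exact: (differentiable_path_derivable z_diff).
Qed.

Lemma velocity_integrable : mx_integrable 0 T z'.
Proof.
move=> i j; have := differentiable_path_integrable z_diff i.
by rewrite (ord1 j).
Qed.

Lemma smooth_path_integral s t : 0 <= s -> s <= t -> t <= T ->
  mx_integral mu `[s, t] z' = z t - z s.
Proof.
move=> s0 st tT; apply/matrixP => i j; rewrite !mxE.
apply: (@integral_of_derivative _ (fun r => z r i j)) => //.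
- apply: (continuous_subspaceW (B := `[0, T]%classic)).
    by move=> r; rewrite /= !in_itv /=; lra.
  exact/within_continuous_entry/smooth_path_continuous.
- exact: (mx_integrable_sub s0 tT velocity_integrable).
- move=> u e ust e0; have u0T : 0 <= u <= T by lra.
  have [h h0 hf] := derive_in_approx (differentiable_path_derivable z_diff u0T) e0.
  exists h => // v uv vt; have v0T : `[0, T]%classic v by rewrite /= in_itv /=; lra.
  have vu : `|v - u| = v - u by rewrite ger0_norm //; lra.
  have := hf v v0T; rewrite vu => /(_ ltac:(lra)) H.
  apply: le_trans H.
  by have := ler_mx_entry (z v - z u - (v - u) *: z' u) i j; rewrite !mxE.
Qed.

(** The summand 1 makes [clock] grow at least as fast as time, so that increments
    in time are controlled by increments of the clock. *)
Definition speed (r : R) : R := 1 + \sum_j `|z' r j 0|.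

Definition clock (t : R) : R := \int[mu]_(r in `[0, t]) speed r.

Lemma speed_ge1 r : 1 <= speed r.
Proof. by rewrite lerDl sumr_ge0. Qed.

Lemma velocity_speed r : `|z' r| <= speed r.
Proof.
apply: ler_mx_norm => [|i j]; first by have := speed_ge1 r; lra.
rewrite (ord1 j) /speed (bigD1 i) //=.
have : 0 <= \sum_(l < d | l != i) `|z' r l 0| by rewrite sumr_ge0.
lra.
Qed.

Lemma speed_integrable : mu.-integrable `[0, T] (EFin \o speed).
Proof.
pose g j := EFin \o (fun r : R => `|z' r j 0|).
rewrite (_ : EFin \o speed = ((EFin \o (fun=> 1%R)) \+ (fun r => \sum_(j < d) g j r))%E); last first.
  by apply/funext => r /=; rewrite /speed EFinD sumEFin.
apply: integrableD => //; first exact: integrable_segment_cst.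
apply: integrable_sum => // j _.
exact: (integrable_abse (differentiable_path_integrable z_diff j)).
Qed.

Lemma clock_split s t : 0 <= s -> s <= t -> t <= T ->
  \int[mu]_(r in `[s, t]) speed r = clock t - clock s.
Proof.
move=> s0 st tT; have := integral_segment_split (lexx 0) s0 st tT speed_integrable.
rewrite /clock => ->; lra.
Qed.

Lemma weighted_integral_bound p q (f : R -> 'M[R]_(p, q)) (K s t : R) :
  0 <= K -> 0 <= s -> s <= t -> t <= T -> mx_integrable s t f ->
  (forall r, s <= r <= t -> `|f r| <= K * speed r) ->
  `|mx_integral mu `[s, t] f| <= K * (clock t - clock s).
Proof.
move=> K0 s0 st tT fi fK; rewrite -clock_split //.
have si := integrable_subsegment s0 tT speed_integrable.
have Ksi : mu.-integrable `[s, t] (EFin \o (fun r => K * speed r)).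
  rewrite (_ : EFin \o _ = (fun r => K%:E * (EFin \o speed) r)%E) //.
  exact: integrableZl.
rewrite -RintegralZl //.
apply: ler_mx_norm => [|i j].
  apply: Rintegral_ge0 => r _; rewrite mulr_ge0 //; have := speed_ge1 r; lra.
rewrite mxE; apply: le_trans (le_normr_Rintegral _ (fi i j)) _ => //.
apply: le_Rintegral => //.
  exact: (integrable_abse (fi i j)).
move=> r; rewrite /= in_itv /= => rst.
exact: le_trans (ler_mx_entry _ _ _) (fK r rst).
Qed.

Lemma clock_ge s t : 0 <= s -> s <= t -> t <= T -> t - s <= clock t - clock s.
Proof.
move=> s0 st tT; rewrite -clock_split // -[t - s]mul1r -(Rintegral_segment_cst 1 st).
have si := integrable_subsegment s0 tT speed_integrable.
apply: le_Rintegral => //; first exact: integrable_segment_cst.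
by move=> r _; exact: speed_ge1.
Qed.

Lemma clock_uniform_continuity (e : R) : 0 < e -> exists2 h : R, 0 < h &
  forall s t, 0 <= s -> s <= t -> t <= T -> t - s < h -> clock t - clock s < e.
Proof.
move=> e0.
have cc : {within `[0, T], continuous clock}.
  exact: (parameterized_integral_continuous (ltW T_gt0) speed_integrable).
have [h h0 H] := compact_uniform_continuity (@segment_compact _ 0 T) cc e0.
exists h => // s t s0 st tT sth; apply: le_lt_trans (ler_norm _) _.
apply: H; rewrite /= ?in_itv /=; [lra|lra|].
by rewrite ger0_norm // subr_ge0.
Qed.

Lemma smooth_path_clock s t : 0 <= s -> s <= t -> t <= T ->
  `|z t - z s| <= clock t - clock s.
Proof.
move=> s0 st tT; rewrite -smooth_path_integral // -[clock _ - _]mul1r.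
apply: weighted_integral_bound => //; first exact: (mx_integrable_sub s0 tT velocity_integrable).
by move=> r _; rewrite mul1r velocity_speed.
Qed.

Lemma continuous_mul_integrable (f g : R -> R) s t :
  {within `[s, t], continuous f} -> mu.-integrable `[s, t] (EFin \o g) ->
  mu.-integrable `[s, t] (EFin \o (fun r => f r * g r)).
Proof.
move=> fc gi.
rewrite (_ : EFin \o _ = ((EFin \o f) \* (EFin \o g))%E); last first.
  by apply/funext => r /=; rewrite EFinM.
apply: integrableMr => //; first exact: subspace_continuous_measurable_fun.
have := continuous_compact fc (@segment_compact _ s t) => /compact_bounded.
by move=> [M [Mr HM]]; exists M; split => // N MN x xst; apply: (HM N MN); exists x.
Qed.

Lemma continuous_mulmx_integrable p (f : R -> 'M[R]_(p, d)) s t :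
  0 <= s -> t <= T -> {within `[s, t], continuous f} ->
  mx_integrable s t (fun r => f r *m z' r).
Proof.
move=> s0 tT fc i j.
pose g l := EFin \o (fun r : R => f r i l * z' r l j).
rewrite (_ : EFin \o _ = (fun r => \sum_(l < d) g l r)%E); last first.
  by apply/funext => r /=; rewrite mxE sumEFin.
apply: integrable_sum => // l _; apply: continuous_mul_integrable.
  exact: within_continuous_entry.
exact: (mx_integrable_sub s0 tT velocity_integrable).
Qed.

Lemma area_integrable s u t : 0 <= u -> t <= T ->
  mx_integrable u t (fun r => (z r - z s) *m (z' r)^T).
Proof.
move=> u0 tT i j.
rewrite (_ : EFin \o _ = (EFin \o (fun r => (z r i 0 - z s i 0) * z' r j 0))); last first.
  by apply/funext => r /=; rewrite mxE big_ord1 !mxE.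
apply: continuous_mul_integrable; last first.
  exact: (mx_integrable_sub u0 tT velocity_integrable).
apply/within_continuous_dist => x; rewrite /= in_itv /= => xut e e0.
have x0T : `[0, T]%classic x by rewrite /= in_itv /=; lra.
have [h h0 hf] := (within_continuous_dist _ _).1 smooth_path_continuous x x0T e e0.
exists h => // y; rewrite /= in_itv /= => yut yx.
have y0T : `[0, T]%classic y by rewrite /= in_itv /=; lra.
apply: le_lt_trans (hf y y0T yx).
have := ler_mx_entry (z y - z x) i 0; rewrite !mxE.
by rewrite (_ : z y i 0 - z s i 0 - _ = z y i 0 - z x i 0) //; ring.
Qed.

Lemma iterated_integral_chen s u t : 0 <= s -> s <= u -> u <= t -> t <= T ->
  iterated_integral T z s t
  = iterated_integral T z s u + iterated_integral T z u t + (z u - z s) *m (z t - z u)^T.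
Proof.
move=> s0 su ut tT; have u0 := le_trans s0 su.
rewrite /iterated_integral (mx_integral_split (lexx s) su ut (lexx t) (area_integrable s s0 tT)).
rewrite -addrA; congr (_ + _); rewrite -(smooth_path_integral u0 ut tT).
apply/eqP; rewrite addrC -subr_eq; apply/eqP.
rewrite (mx_integralB (area_integrable s u0 tT) (area_integrable u u0 tT)).
apply/matrixP => i j; rewrite [RHS]mxE big_ord1 !mxE.
have vi : mu.-integrable `[u, t] (EFin \o (fun r => z' r j 0)).
  exact: (mx_integrable_sub u0 tT velocity_integrable).
rewrite -RintegralZl //; apply: eq_Rintegral => r _.
by rewrite !mxE !big_ord1 !mxE; ring.
Qed.

Lemma iterated_integral_clock s t : 0 <= s -> s <= t -> t <= T ->
  `|iterated_integral T z s t| <= (clock t - clock s) ^+ 2.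
Proof.
move=> s0 st tT; have c0 := clock_ge s0 st tT.
rewrite expr2; apply: weighted_integral_bound => //; [lra|exact: area_integrable|].
move=> r rst; have ? : 0 <= clock t - clock s by lra.
apply: ler_mx_norm => [|i j]; first by rewrite mulr_ge0 //; have := speed_ge1 r; lra.
rewrite mxE big_ord1 [X in _ * X]mxE; apply: ler_norm_mul; last first.
  exact: le_trans (ler_mx_entry _ _ _) (velocity_speed r).
apply: le_trans (ler_mx_entry _ _ _) _.
have r0 : s <= r by lra.
have rT : r <= T by lra.
apply: le_trans (smooth_path_clock s0 r0 rT) _.
have r00 : 0 <= r by lra.
have rt : r <= t by lra.
have := clock_ge r00 rt tT; lra.
Qed.

Lemma smooth_driver (k M : R) :
  (forall s t, 0 <= s -> s <= t -> t <= T -> `|z t - z s| <= M * (t - s) `^ k) ->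
  (forall s t, 0 <= s -> s <= t -> t <= T ->
    `|iterated_integral T z s t| <= M * (t - s) `^ (2 * k)) ->
  driver T k M z (iterated_integral T z).
Proof. by move=> H1 H2; split => // s u t; exact: iterated_integral_chen. Qed.

End smooth_driver.

Section smooth_solution.
Context {R : realType} {m d kk : nat} {U : pmetricType R}.
Notation V := 'cV[R]_m.
Notation mu := (@lebesgue_measure R).
Implicit Types (u v t r : R).
Variables (emb : U -> 'cV[R]_kk) (T : R) (b : R -> V -> U -> V).
Variables (sigma : R -> V -> 'M[R]_(m, d)) (K : set (P2 U)) (eps L C : R).
Hypothesis b_Cb : Cb011 emb T b.
Hypothesis b_unif : forall x (e : R), 0 < e -> exists2 h : R, 0 < h &
    forall u1 u2, 0 <= u1 <= T -> 0 <= u2 <= T -> `|u2 - u1| < h ->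
      forall a, `|b u2 x a - b u1 x a| <= e.
Hypotheses (T_gt0 : 0 < T) (eps_gt0 : 0 < eps) (L_gt0 : 0 < L) (C_ge0 : 0 <= C).
Hypothesis sigma_bounds : coefficient_bounds T sigma C.
Variables (s : R) (gamma : R -> P2 U).
Hypotheses (s_ge0 : 0 <= s) (gamma_adm : admissible K eps L s T gamma).

Lemma drift_integrand_integrable (x : R -> V) u v : s <= u -> v <= T ->
  {within `[s, T], continuous x} ->
  mx_integrable u v (fun r => mean_drift b (gamma r) r (x r)).
Proof.
move=> su vT xc; apply: (mx_integrable_sub su vT).
apply: continuous_mx_integrable.
exact: (mean_drift_continuous b_Cb b_unif eps_gt0 L_gt0 s_ge0 gamma_adm xc).
Qed.

Lemma driftE (x : R -> V) u v :
  drift b gamma x u v = mx_integral mu `[u, v] (fun r => mean_drift b (gamma r) r (x r)).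
Proof. by []. Qed.

Lemma drift_split (x : R -> V) u v : {within `[s, T], continuous x} ->
  s <= u -> u <= v -> v <= T -> drift b gamma x s v = drift b gamma x s u + drift b gamma x u v.
Proof.
move=> xc su uv vT; rewrite !driftE.
exact: (mx_integral_split (lexx s) su uv (lexx v) (drift_integrand_integrable (lexx s) vT xc)).
Qed.

Lemma sigma_lipschitz t r x y : 0 <= t <= T -> 0 <= r <= T ->
  `|sigma t x - sigma r y| <= C * (`|t - r| + `|x - y|).
Proof.
move=> t0 r0; apply: ler_mx_norm => [|i j]; first by rewrite mulr_ge0 // addr_ge0.
rewrite !mxE; have sb := bounds_sigma sigma_bounds i j.
have -> : sigma t x i j - sigma r y i j
  = (sigma t x i j - sigma r x i j) + (sigma r x i j - sigma r y i j) by ring.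
apply: le_trans (ler_normD _ _) _; rewrite mulrDr; apply: lerD.
  exact: (regular_time sb).
exact: (regular_lip sb).
Qed.

Lemma sigma_bound t x : 0 <= t <= T -> `|sigma t x| <= C.
Proof.
move=> t0; apply: ler_mx_norm => // i j.
exact: (regular_bound (bounds_sigma sigma_bounds i j)).
Qed.

Lemma ler_norm_mulmx p q n (A : 'M[R]_(p, q)) (B : 'M[R]_(q, n)) (x y : R) :
  0 <= x -> 0 <= y -> `|A| <= x -> `|B| <= y -> `|A *m B| <= q%:R * (x * y).
Proof.
move=> x0 y0 Ax By; apply: ler_mx_norm => [|i j].
  by rewrite mulr_ge0 ?mulr_ge0.
rewrite mxE; apply: ler_norm_sum_ord => l; apply: ler_norm_mul.
  exact: le_trans (ler_mx_entry _ _ _) Ax.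
exact: le_trans (ler_mx_entry _ _ _) By.
Qed.

Variables (z : R -> 'cV[R]_d) (y : V) (x : R -> V).
Hypothesis z_diff : differentiable_path T z.
Hypothesis x_sol : smooth_solution T b sigma z s y gamma x.

Notation z' := (derive_in `[0, T] z).
Notation w := (clock T z).

Lemma sigma_path_continuous : {within `[s, T], continuous (fun r => sigma r (x r))}.
Proof.
have [/within_continuous_dist xc _] := x_sol.
apply/within_continuous_dist => r rsT e e0.
have e1 : 0 < e / (2 * (C + 1)) by rewrite divr_gt0 //; move: C_ge0 => ?; lra.
have [h h0 H] := xc r rsT _ e1.
exists (Num.min h (e / (2 * (C + 1)))); first by rewrite lt_min h0.
move=> q qsT; rewrite lt_min => /andP[qh qe].
move: rsT qsT (H q qsT qh); rewrite /= !in_itv /= => rsT qsT xx.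
have C1 : 0 < C + 1 by move: C_ge0 => ?; lra.
have := @sigma_lipschitz q r (x q) (x r) ltac:(move: s_ge0 => ?; lra) ltac:(move: s_ge0 => ?; lra).
move=> /le_lt_trans; apply.
have -> : e = (C + 1) * (e / (2 * (C + 1)) + e / (2 * (C + 1))).
  by field; rewrite gt_eqF.
apply: (@le_lt_trans _ _ ((C + 1) * (`|q - r| + `|x q - x r|))).
  by apply: ler_wpM2r; rewrite ?addr_ge0 //; lra.
by rewrite ltr_pM2l // ltrD.
Qed.

Lemma smooth_increment u v : s <= u -> u <= v -> v <= T ->
  x v - x u = drift b gamma x u v + mx_integral mu `[u, v] (fun r => sigma r (x r) *m z' r).
Proof.
move=> su uv vT; have [xc xE] := x_sol.
have hu : s <= u <= T by rewrite su (le_trans uv vT).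
have hv : s <= v <= T by rewrite (le_trans su uv) vT.
rewrite (xE v hv) (xE u hu) (drift_split xc su uv vT).
have sT : s <= T by lra.
rewrite (mx_integral_split (lexx s) su uv vT
  (continuous_mulmx_integrable z_diff s_ge0 (lexx T) sigma_path_continuous)).
move: (drift _ _ _ _ _) (drift _ _ _ _ _) (mx_integral _ _ _) (mx_integral _ _ _) => a1 a2 a3 a4.
mx_ring.
Qed.

Lemma smooth_increment_clock (B : R) u v : 0 <= B ->
  (forall P r q, 0 <= r <= T -> `|mean_drift b P r q| <= B) ->
  s <= u -> u <= v -> v <= T -> `|x v - x u| <= (B + d%:R * C) * (w v - w u).
Proof.
move=> B0 HB su uv vT; have [xc _] := x_sol. rewrite smooth_increment // mulrDl.
have u0 := le_trans s_ge0 su.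
apply: le_trans (ler_normD _ _) _; apply: lerD.
  rewrite driftE; apply: (weighted_integral_bound z_diff) => //.
    exact: drift_integrand_integrable.
  move=> r ruv; apply: le_trans (HB _ _ _ _) _; first by lra.
  by rewrite ler_peMr // speed_ge1.
apply: (weighted_integral_bound z_diff) => //; first by rewrite mulr_ge0.
  apply: (mx_integrable_sub su vT).
  exact: (continuous_mulmx_integrable z_diff s_ge0 (lexx T) sigma_path_continuous).
move=> r ruv; rewrite -mulrA; apply: ler_norm_mulmx => //.
- by have := speed_ge1 T z r; lra.
- by apply: sigma_bound; lra.
- exact: velocity_speed.
Qed.

(** The integral of sigma against the path is compared with sigma at the left
    endpoint; sigma (x r) varies by O(w v - w u), which leaves a second-order
    term in the clock w.  The area term of the step is of second order as well. *)
Lemma smooth_error_clock : exists2 C', 0 <= C' & forall u v, s <= u -> u <= v -> v <= T ->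
  `|step_error (driver_flow sigma z (iterated_integral T z)) x u v - drift b gamma x u v|
    <= C' * (w v - w u) ^+ 2.
Proof.
have [B1 B10 HB1] := mean_drift_bounded b_Cb.
have [B B0 HB] : exists2 B, 0 <= B & forall u v, s <= u -> u <= v -> v <= T ->
    `|x v - x u| <= B * (w v - w u).
  exists (B1 + d%:R * C); first by rewrite addr_ge0 ?mulr_ge0.
  by move=> u v; exact: smooth_increment_clock.
exists (d%:R * (C * (1 + B)) + d%:R * (d%:R * C)).
  by rewrite addr_ge0 ?mulr_ge0 ?addr_ge0.
move=> u v su uv vT; have u0 := le_trans s_ge0 su.
have cuv := clock_ge z_diff u0 uv vT.
have w0 : 0 <= w v - w u by lra.
have si : mx_integrable u v (fun r => sigma r (x r) *m z' r).
  apply: (mx_integrable_sub su vT).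
  exact: (continuous_mulmx_integrable z_diff s_ge0 (lexx T) sigma_path_continuous).
have ci : mx_integrable u v (fun r => sigma u (x u) *m z' r).
  apply: (continuous_mulmx_integrable z_diff u0 vT).
  by apply/within_continuous_dist => r _ e e0; exists 1 => // q _ _; rewrite subrr normr0.
have E : sigma u (x u) *m (z v - z u) = mx_integral mu `[u, v] (fun r => sigma u (x u) *m z' r).
  rewrite -(smooth_path_integral z_diff u0 uv vT).
  exact/mx_integral_mull/(mx_integrable_sub u0 vT (velocity_integrable z_diff)).
pose A : V := \col_i \sum_(k < d) \sum_(l < d) dsigma_sigma sigma u (x u) i k l * iterated_integral T z u v l k.
have -> : step_error (driver_flow sigma z (iterated_integral T z)) x u v - drift b gamma x u v
  = mx_integral mu `[u, v] (fun r => sigma r (x r) *m z' r - sigma u (x u) *m z' r) - A.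
  rewrite -(mx_integralB si ci) -E /step_error smooth_increment //.
  rewrite (_ : driver_flow _ _ _ _ _ _ = sigma u (x u) *m (z v - z u) + A).
    by move: (drift _ _ _ _ _) (mx_integral _ _ _) (_ *m _) A => a1 a2 a3 a4; mx_ring.
  by apply/matrixP => i j; rewrite (ord1 j) !mxE.
apply: le_trans (ler_normB _ _) _; rewrite mulrDl; apply: lerD.
  rewrite expr2 [X in _ <= X]mulrA; apply: (weighted_integral_bound z_diff) => //.
  - by apply: mulr_ge0 => //; rewrite !mulr_ge0 ?addr_ge0.
  - exact: mx_integrableB.
  move=> r ruv; rewrite -mulmxBl -!mulrA.
  have r0 : 0 <= r <= T by lra.
  have ur : u <= r by lra.
  have rT : r <= T by lra.
  have rv : r <= v by lra.
  have wr : w r <= w v.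
    rewrite -subr_ge0; apply: le_trans (clock_ge z_diff (le_trans u0 ur) rv vT).
    by rewrite subr_ge0.
  have wru : w r - w u <= w v - w u by apply: lerB.
  have cur := le_trans (clock_ge z_diff u0 ur rT) wru.
  have -> : C * ((1 + B) * ((w v - w u) * speed T z r)) = C * ((1 + B) * (w v - w u)) * speed T z r.
    by ring.
  apply: ler_norm_mulmx => //.
  - by apply: mulr_ge0 => //; apply: mulr_ge0 => //; apply: addr_ge0.
  - by have := speed_ge1 T z r; lra.
  - apply: le_trans (sigma_lipschitz _ _ _ _) _ => //; first by lra.
    apply: ler_wpM2l => //; rewrite mulrDl mul1r; apply: lerD.
      by rewrite ger0_norm // subr_ge0.
    by apply: le_trans (HB u r su ur rT) _; exact: ler_wpM2l.
  - exact: velocity_speed.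
apply: ler_mx_norm => [|i j]; first by rewrite !mulr_ge0 // sqr_ge0.
rewrite mxE -!mulrA; apply: ler_norm_sum_ord => k; apply: ler_norm_sum_ord => l.
apply: ler_norm_mul.
  by apply: (regular_bound (bounds_dsigma_sigma sigma_bounds i k l)); lra.
apply: le_trans (ler_mx_entry _ _ _) _.
exact: iterated_integral_clock.
Qed.

(** The square of an increment of the clock is the increment times a small factor,
    because the clock is uniformly continuous. *)
Lemma smooth_error_negligible :
  sum_negligible s T (fun u v =>
    `|step_error (driver_flow sigma z (iterated_integral T z)) x u v - drift b gamma x u v|).
Proof.
have [B B0 HB] := smooth_error_clock.
exists w => [u v su uv vT|eta eta0].
  by have := clock_ge z_diff (le_trans s_ge0 su) uv vT; lra.
have B1 : 0 < B + 1 by lra.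
have [h h0 H] := clock_uniform_continuity T_gt0 z_diff (divr_gt0 eta0 B1).
have h2 : 0 < h / 2 by lra.
exists (h / 2) => // u v su uv vT uvh.
have u0 := le_trans s_ge0 su.
have cuv := clock_ge z_diff u0 uv vT.
apply: le_trans (HB u v su uv vT) _; rewrite expr2 mulrA; apply: ler_wpM2r; first lra.
have := H u v u0 uv vT ltac:(lra); rewrite ltr_pdivlMr // => H'.
have : 0 <= w v - w u by lra.
move: (w v - w u) H' => c H' c0.
have -> : B * c = c * (B + 1) - c by ring.
lra.
Qed.

End smooth_solution.

(** * Hölder norms and convergence of drivers *)

Section holder_norms.
Context {R : realType} {V : normedModType R}.
Implicit Types (mu a b c s t : R).

Lemma holder2_bound mu a b c (h : R -> R -> V) s t : a <= s -> s < t -> t <= b ->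
  (holder2_norm mu a b h <= c%:E)%E -> `|h s t| <= c * (t - s) `^ mu.
Proof.
move=> as_ st tb hc; have p0 : 0 < (t - s) `^ mu by rewrite powR_gt0 // subr_gt0.
rewrite -ler_pdivrMr // -lee_fin; apply: le_trans hc.
apply: ereal_sup_ubound; exists (s, t) => //=; split => //.
by rewrite as_ ltW.
Qed.

Lemma holder2_norm_ge0 mu a b (h : R -> R -> V) : a <= b -> (0 <= holder2_norm mu a b h)%E.
Proof.
move=> ab; apply: (@le_trans _ _ (`|h a a| / (a - a) `^ mu)%:E).
  by rewrite lee_fin divr_ge0 // powR_ge0.
by apply: ereal_sup_ubound; exists (a, a) => //=; rewrite !lexx.
Qed.

Lemma holder2_finite mu a b (h : R -> R -> V) : a <= b -> (holder2_norm mu a b h < +oo)%E ->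
  exists2 c, 0 <= c & forall s t, a <= s -> s < t -> t <= b -> `|h s t| <= c * (t - s) `^ mu.
Proof.
move=> ab hoo; have h0 := holder2_norm_ge0 mu h ab.
have hf : holder2_norm mu a b h \is a fin_num by rewrite ge0_fin_numE.
exists (fine (holder2_norm mu a b h)); first exact: fine_ge0.
by move=> s t as_ st tb; apply: holder2_bound as_ st tb _; rewrite fineK.
Qed.

Lemma holder_lower_exponent (T c p q : R) (x : V) h : 0 <= h <= T -> 0 < q <= p -> 0 <= c ->
  `|x| <= c * h `^ p -> `|x| <= c * T `^ (p - q) * h `^ q.
Proof.
move=> hT qp c0 /le_trans; apply; rewrite -mulrA; apply: ler_wpM2l => //.
exact: ler_powR_horizon.
Qed.

End holder_norms.

Lemma cvg_to0_lt (R : realType) (u : nat -> \bar R) (e : R) : u @ \oo --> 0%E -> 0 < e ->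
  \forall n \near \oo, (u n < e%:E)%E.
Proof.
move=> u0 e0.
have := u0 [set x | (x < e%:E)%E]; apply; apply: open_ereal_lt'.
by rewrite lte_fin.
Qed.

Section drivers.
Context {R : realType} {d : nat}.
Implicit Types (s t u c M : R).
Variables (T alpha k0 : R).
Hypotheses (T_gt0 : 0 < T) (k0_gt0 : 0 < k0) (k0_le : k0 <= alpha).

Lemma rough_path_bounds (zeta : R -> 'cV[R]_d) (zeta2 : R -> R -> 'M[R]_d) :
  rough_path alpha T zeta zeta2 -> exists2 c, 0 <= c &
  (forall s t, 0 <= s -> s <= t -> t <= T -> `|zeta t - zeta s| <= c * (t - s) `^ alpha) /\
  (forall s t, 0 <= s -> s <= t -> t <= T -> `|zeta2 s t| <= c * (t - s) `^ (2 * alpha)).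
Proof.
move=> [_ z1 [_ z20 z2oo] _ _].
have [c1 c10 H1] := holder2_finite (ltW T_gt0) z1.
have [c2 c20 H2] := holder2_finite (ltW T_gt0) z2oo.
exists (c1 + c2); first exact: addr_ge0.
split=> s t s0 st tT.
  have := st; rewrite le_eqVlt => /predU1P[<-|st'].
    by rewrite subrr normr0 mulr_ge0 ?addr_ge0 ?powR_ge0.
  apply: le_trans (H1 s t s0 st' tT) _; apply: ler_wpM2r; rewrite ?powR_ge0 //; lra.
have := st; rewrite le_eqVlt => /predU1P[<-|st'].
  by rewrite z20 ?s0 ?(le_trans st tT) // normr0 mulr_ge0 ?addr_ge0 ?powR_ge0.
apply: le_trans (H2 s t s0 st' tT) _; apply: ler_wpM2r; rewrite ?powR_ge0 //; lra.
Qed.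

Lemma rough_path_area_chen (zeta : R -> 'cV[R]_d) (zeta2 : R -> R -> 'M[R]_d) s u t :
  rough_path alpha T zeta zeta2 -> 0 <= s -> s <= u -> u <= t -> t <= T ->
  zeta2 s t = zeta2 s u + zeta2 u t + (zeta u - zeta s) *m (zeta t - zeta u)^T.
Proof.
move=> rp s0 su ut tT; apply/matrixP => i j.
have := rough_path_chen rp i j s0 su ut tT.
rewrite !mxE big_ord1 !mxE => <-; ring.
Qed.

Definition horizon_factor := T `^ (alpha - k0) + T `^ (2 * alpha - 2 * k0).

Lemma drop_exponent (W : normedModType R) (c : R) (x : W) h : 0 <= h <= T -> 0 <= c ->
  (`|x| <= c * h `^ alpha -> `|x| <= c * horizon_factor * h `^ k0) /\
  (`|x| <= c * h `^ (2 * alpha) -> `|x| <= c * horizon_factor * h `^ (2 * k0)).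
Proof.
move=> hT c0; rewrite /horizon_factor.
have f1 : 0 <= T `^ (alpha - k0) by exact: powR_ge0.
have f2 : 0 <= T `^ (2 * alpha - 2 * k0) by exact: powR_ge0.
split=> H.
  have k1 : 0 < k0 <= alpha by move: k0_gt0 k0_le => ? ?; lra.
  apply: le_trans (holder_lower_exponent hT k1 c0 H) _.
  by apply: ler_wpM2r; rewrite ?powR_ge0 // ler_wpM2l // lerDl.
have k1 : 0 < 2 * k0 <= 2 * alpha by move: k0_gt0 k0_le => ? ?; lra.
apply: le_trans (holder_lower_exponent hT k1 c0 H) _.
by apply: ler_wpM2r; rewrite ?powR_ge0 // ler_wpM2l // lerDr.
Qed.

(** The smooth drivers at distance at most 1 of the rough one share a bound with it.
    The distances are transferred from the exponent alpha to the exponent k0 at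
    the cost of powers of T. *)
Lemma smooth_rough_drivers (zeta : R -> 'cV[R]_d) (zeta2 : R -> R -> 'M[R]_d) :
  rough_path alpha T zeta zeta2 -> exists2 M, 0 <= M &
  driver T k0 M zeta zeta2 /\
  forall (e : R) z, 0 <= e <= 1 -> differentiable_path T z ->
    (holder1_norm alpha 0 T (fun t => z t - zeta t)%R
     + holder2_norm (2 * alpha)%R 0 T
         (fun s t => iterated_integral T z s t - zeta2 s t)%R < e%:E)%E ->
    driver T k0 M z (iterated_integral T z) /\
    close_drivers T k0 M e z zeta (iterated_integral T z) zeta2.
Proof.
move=> rp; have [c c0 [H1 H2]] := rough_path_bounds rp.
have F0 : 0 <= horizon_factor by rewrite addr_ge0 ?powR_ge0.
exists ((c + 1) * horizon_factor); first by rewrite mulr_ge0 // addr_ge0.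
have hT (s t : R) : 0 <= s -> s <= t -> t <= T -> 0 <= t - s <= T by lra.
have c1 : 0 <= c + 1 by lra.
have cle (p h : R) (c' : R) : c' <= c + 1 -> c' * h `^ p <= (c + 1) * h `^ p.
  by move=> H; rewrite ler_wpM2r ?powR_ge0.
split.
  split=> [s t s0 st tT|s t s0 st tT|s u t]; last exact: rough_path_area_chen.
    apply: (drop_exponent _ (hT s t s0 st tT) c1).1.
    by apply: le_trans (H1 s t s0 st tT) _; apply: cle; lra.
  apply: (drop_exponent _ (hT s t s0 st tT) c1).2.
  by apply: le_trans (H2 s t s0 st tT) _; apply: cle; lra.
move=> e z /andP[e0 e1] zd near_z.
have T0 := ltW T_gt0.
have n1 := holder2_norm_ge0 alpha (fun s t => (z t - zeta t) - (z s - zeta s)) T0.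
have n2 := holder2_norm_ge0 (2 * alpha) (fun s t => iterated_integral T z s t - zeta2 s t) T0.
have b1 : (holder2_norm alpha 0 T (fun s t => (z t - zeta t) - (z s - zeta s))%R <= e%:E)%E.
  by apply: le_trans (ltW near_z); exact: leeDl.
have b2 : (holder2_norm (2 * alpha)%R 0 T
    (fun s t => iterated_integral T z s t - zeta2 s t)%R <= e%:E)%E.
  by apply: le_trans (ltW near_z); exact: leeDr.
have D1 s t : 0 <= s -> s <= t -> t <= T ->
    `|z t - z s - (zeta t - zeta s)| <= e * (t - s) `^ alpha.
  move=> s0; rewrite le_eqVlt => /predU1P[<- _|st tT].
    by rewrite !subrr normr0 mulr_ge0 ?powR_ge0.
  have := holder2_bound s0 st tT b1; congr (`|_| <= _).
  by rewrite !opprD !opprK !addrA; congr (_ + _); rewrite addrAC.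
have J0 s : 0 <= s -> s <= T -> iterated_integral T z s s = 0.
  move=> s0 sT; have := iterated_integral_chen zd s0 (lexx s) (lexx s) sT.
  by rewrite subrr mul0mx addr0 => /eqP; rewrite -subr_eq subrr eq_sym => /eqP.
have D2 s t : 0 <= s -> s <= t -> t <= T ->
    `|iterated_integral T z s t - zeta2 s t| <= e * (t - s) `^ (2 * alpha).
  move=> s0; rewrite le_eqVlt => /predU1P[<- sT|st tT].
    rewrite J0 // (C2_diagonal (rough_path_C2 rp)) ?s0 // subrr normr0.
    by rewrite mulr_ge0 ?powR_ge0.
  exact: holder2_bound s0 st tT b2.
have ec : e <= c + 1 by lra.
split; last first.
  have E (h p : R) : e * horizon_factor * h `^ p <= (c + 1) * horizon_factor * e * h `^ p.
    rewrite ler_wpM2r ?powR_ge0 //.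
    have -> : (c + 1) * horizon_factor * e = (c + 1) * (e * horizon_factor) by ring.
    by apply: ler_peMl; [rewrite mulr_ge0|lra].
  split=> s t s0 st tT.
    apply: le_trans ((drop_exponent _ (hT s t s0 st tT) e0).1 (D1 s t s0 st tT)) _.
    exact: E.
  apply: le_trans ((drop_exponent _ (hT s t s0 st tT) e0).2 (D2 s t s0 st tT)) _.
  exact: E.
apply: (smooth_driver zd) => s t s0 st tT.
  apply: (drop_exponent _ (hT s t s0 st tT) c1).1.
  have -> : z t - z s = (zeta t - zeta s) + (z t - z s - (zeta t - zeta s)).
    by rewrite [RHS]addrC subrK.
  apply: le_trans (ler_normD _ _) _; rewrite mulrDl; apply: lerD; first exact: H1.
  apply: le_trans (D1 s t s0 st tT) _; by apply: ler_wpM2r; rewrite ?powR_ge0.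
apply: (drop_exponent _ (hT s t s0 st tT) c1).2.
have -> : iterated_integral T z s t = zeta2 s t + (iterated_integral T z s t - zeta2 s t).
  by rewrite [RHS]addrC subrK.
apply: le_trans (ler_normD _ _) _; rewrite mulrDl; apply: lerD; first exact: H2.
apply: le_trans (D2 s t s0 st tT) _; by apply: ler_wpM2r; rewrite ?powR_ge0.
Qed.

End drivers.

(** * Solutions as paths that follow an almost flow *)

Section state_stability.
Context {R : realType} {m d kk : nat} {U : pmetricType R}.
Notation V := 'cV[R]_m.
Notation mu := (@lebesgue_measure R).
Implicit Types (s t u v r e : R).
Variables (emb : U -> 'cV[R]_kk) (T : R) (b : R -> V -> U -> V).
Variables (sigma : R -> V -> 'M[R]_(m, d)) (K : set (P2 U)) (eps L C B Lb : R).
Hypothesis b_Cb : Cb011 emb T b.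
Hypothesis b_unif : forall x (e : R), 0 < e -> exists2 h : R, 0 < h &
    forall u1 u2, 0 <= u1 <= T -> 0 <= u2 <= T -> `|u2 - u1| < h ->
      forall a, `|b u2 x a - b u1 x a| <= e.
Hypotheses (T_gt0 : 0 < T) (eps_gt0 : 0 < eps) (L_gt0 : 0 < L) (C_ge0 : 0 <= C).
Hypothesis sigma_bounds : coefficient_bounds T sigma C.
Hypothesis B_ge0 : 0 <= B.
Hypothesis drift_bound : forall P t x, 0 <= t <= T -> `|mean_drift b P t x| <= B.
Hypothesis Lb_ge0 : 0 <= Lb.
Hypothesis drift_lip : forall P t x y, 0 <= t <= T ->
  `|mean_drift b P t x - mean_drift b P t y| <= Lb * `|x - y|.

Lemma holder_path_continuous kappa s (x : R -> V) : 0 < kappa -> s <= T ->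
  C1 kappa s T x -> {within `[s, T], continuous x}.
Proof.
move=> kp sT xC; have [c c0 H] := holder2_finite sT xC.
apply/within_continuous_dist => t; rewrite /= in_itv /= => tsT e e0.
have [h h0 Hh] := small_powR kp c0 e0.
exists h => // u; rewrite /= in_itv /= => usT ut.
have [tu|ut'|<-] := ltgtP t u.
- apply: le_lt_trans (H t u _ tu _) _; [lra|lra|].
  by move: ut; rewrite ger0_norm => [uth|]; [apply: Hh; lra|lra].
- rewrite distrC; apply: le_lt_trans (H u t _ ut' _) _; [lra|lra|].
  by move: ut; rewrite distrC ger0_norm => [uth|]; [apply: Hh; lra|lra].
- by rewrite subrr normr0.
Qed.

Lemma drift_bounded s (gamma : R -> P2 U) (x : R -> V) u v :
  0 <= s -> admissible K eps L s T gamma -> {within `[s, T], continuous x} ->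
  s <= u -> u <= v -> v <= T -> `|drift b gamma x u v| <= B * (v - u).
Proof.
move=> s0 ga xc su uv vT; rewrite driftE; apply: mx_integral_bound => //.
  exact: (drift_integrand_integrable b_Cb b_unif eps_gt0 L_gt0 s0 ga su vT xc).
by move=> r ruv; apply: drift_bound; lra.
Qed.

Lemma drift_close s (gamma : R -> P2 U) (x x' : R -> V) u v (N : R) :
  0 <= s -> admissible K eps L s T gamma ->
  {within `[s, T], continuous x} -> {within `[s, T], continuous x'} ->
  s <= u -> u <= v -> v <= T -> (forall r, u <= r <= v -> `|x r - x' r| <= N) ->
  `|drift b gamma x u v - drift b gamma x' u v| <= Lb * N * (v - u).
Proof.
move=> s0 ga xc xc' su uv vT xN; rewrite !driftE.
have i1 := drift_integrand_integrable b_Cb b_unif eps_gt0 L_gt0 s0 ga su vT xc.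
have i2 := drift_integrand_integrable b_Cb b_unif eps_gt0 L_gt0 s0 ga su vT xc'.
rewrite (mx_integralB i1 i2); apply: mx_integral_bound => //.
  exact: mx_integrableB.
move=> r ruv; apply: le_trans (drift_lip _ _ _ _) _; first by lra.
by apply: ler_wpM2l => //; exact: xN.
Qed.

Lemma rough_term_flow (zeta : R -> 'cV[R]_d) (zeta2 : R -> R -> 'M[R]_d) (x : R -> V) :
  rough_term zeta zeta2 (fun r => sigma r (x r))
      (fun r i => \matrix_(k, l)
         \sum_(j < m) 'D_(delta_mx j 0) (sigma r) (x r) i k * sigma r (x r) j l)
  = (fun u v => driver_flow sigma zeta zeta2 u v (x u)).
Proof.
apply/funext => u; apply/funext => v; apply/matrixP => i j.
rewrite /rough_term /driver_flow /rough_step !mxE; congr (_ + _).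
by apply: eq_bigr => p _; apply: eq_bigr => l _; rewrite mxE.
Qed.

Section rough.
Variables (kappa k0 M Cf s : R) (zeta : R -> 'cV[R]_d) (zeta2 : R -> R -> 'M[R]_d).
Variables (y : V) (gamma : R -> P2 U) (x : R -> V).
Hypotheses (k0_gt : 3^-1 < k0) (k0_le : k0 <= kappa) (M_ge0 : 0 <= M) (Cf_ge0 : 0 <= Cf).
Hypothesis zeta_driver : driver T k0 M zeta zeta2.
Hypothesis zeta_flow : almost_flow k0 Cf 0 T (driver_flow sigma zeta zeta2).
Hypotheses (s_in : 0 <= s <= T) (gamma_adm : admissible K eps L s T gamma).
Hypothesis x_sol : rough_solution kappa T b sigma zeta zeta2 s y gamma x.

Lemma rough_solution_continuous : {within `[s, T], continuous x}.
Proof.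
have [cx _] := x_sol.
apply: (holder_path_continuous _ _ (controlled_path cx)); first by move: k0_gt k0_le => ? ?; lra.
by move: s_in => /andP[].
Qed.

(** The remainder of the controlled path x is of order 2 kappa, and so is the area
    part of the step. *)
Lemma rough_solution_step_error : exists2 Cx, 0 <= Cx & forall u v, s <= u -> u <= v -> v <= T ->
  `|step_error (driver_flow sigma zeta zeta2) x u v| <= Cx * (v - u) `^ (2 * k0).
Proof.
have [s0 sT] := andP s_in.
have [cx _] := x_sol; have [_ r0 roo] := controlled_remainder cx.
have [c c0 H] := holder2_finite sT roo.
pose c' := c * T `^ (2 * kappa - 2 * k0).
have c'0 : 0 <= c' by rewrite mulr_ge0 ?powR_ge0.
exists (c' + d%:R * (d%:R * (C * M))).
  by apply: addr_ge0 => //; rewrite !mulr_ge0.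
move=> u v su uv vT.
have u0T : 0 <= u <= T by lra.
pose A : V := \col_i \sum_(k < d) \sum_(l < d) dsigma_sigma sigma u (x u) i k l * zeta2 u v l k.
have -> : step_error (driver_flow sigma zeta zeta2) x u v
    = (x v - x u - sigma u (x u) *m (zeta v - zeta u)) - A.
  rewrite /step_error (_ : driver_flow _ _ _ _ _ _ = sigma u (x u) *m (zeta v - zeta u) + A).
    by rewrite opprD addrA.
  by apply/matrixP => i j; rewrite (ord1 j) !mxE.
apply: le_trans (ler_normB _ _) _; rewrite mulrDl; apply: lerD.
  move: uv; rewrite le_eqVlt => /predU1P[<-|uv].
    have suT : s <= u <= T by lra.
    have -> : x u - x u - sigma u (x u) *m (zeta u - zeta u) = 0 by exact: r0.
    by rewrite normr0 mulr_ge0 ?powR_ge0.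
  apply: (holder_lower_exponent _ _ c0 (H u v su uv vT)); first lra.
  by move: k0_gt k0_le => ? ?; lra.
apply: ler_mx_norm => [|i j]; first by rewrite !mulr_ge0 ?powR_ge0.
rewrite mxE -!mulrA; apply: ler_norm_sum_ord => k; apply: ler_norm_sum_ord => l.
apply: ler_norm_mul; first exact: (regular_bound (bounds_dsigma_sigma sigma_bounds i k l)).
apply: le_trans (ler_mx_entry _ _ _) _; apply: (driver_area zeta_driver) => //; lra.
Qed.

(** The rough integrals over [s, t] for all t form a path, whose increments are the
    limits of the dyadic sums of the steps. *)
Lemma rough_flow_solution :
  flow_solution B s T (driver_flow sigma zeta zeta2) x (drift b gamma x).
Proof.
have [s0 sT] := andP s_in; have xc := rough_solution_continuous.
split; first by move=> u v; exact: drift_bounded.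
have [cx eqx] := x_sol; have [Cx Cx0 Hx] := rough_solution_step_error.
have /choice[I HI] : forall t, exists I : V, s <= t <= T ->
    is_rough_integral zeta zeta2 (fun r => sigma r (x r))
      (fun r i => \matrix_(k, l)
         \sum_(j < m) 'D_(delta_mx j 0) (sigma r) (x r) i k * sigma r (x r) j l) s t I
    /\ x t = y + drift b gamma x s t + I.
  move=> t; have [tT|] := boolP (s <= t <= T); last by exists 0.
  by have [I I1 I2] := eqx t tT; exists I.
have N := @step_error_negligible _ _ k0 T Cf Cx s (driver_flow sigma zeta zeta2) x
  (fun t => drift b gamma x s t) I y k0_gt Cf_ge0 Cx0 sT
  (almost_flow_sub s0 (lexx T) zeta_flow) Hx.
have [|w w1 w2] := N ltac:(by move=> t tT; have [] := HI t tT).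
  move=> u v e su uv vT e0.
  have [Iu _] := HI u ltac:(lra); have [Iv _] := HI v ltac:(lra).
  have [j] := rough_integral_dyadic su uv e0 Iu Iv; exists j.
  by rewrite -rough_term_flow.
exists w => // eta eta0; have [h h0 Hh] := w2 eta eta0.
exists h => // u v su uv vT uvh.
have := Hh u v su uv vT uvh.
by rewrite (drift_split b_Cb b_unif eps_gt0 L_gt0 s0 gamma_adm xc su uv vT) [drift _ _ _ s u + _]addrC addrK.
Qed.

End rough.

Lemma coupled_flow_solutions (k0 M Cf e s kappa : R) (zeta z : R -> 'cV[R]_d)
    (zeta2 : R -> R -> 'M[R]_d) (y : V) (gamma : R -> P2 U) (x x' : R -> V) :
  3^-1 < k0 -> k0 <= kappa -> 0 <= M -> 0 <= Cf ->
  driver T k0 M zeta zeta2 -> differentiable_path T z ->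
  almost_flow k0 Cf 0 T (driver_flow sigma zeta zeta2) ->
  almost_flow k0 Cf 0 T (driver_flow sigma z (iterated_integral T z)) ->
  close_flows k0 Cf e 0 T (driver_flow sigma z (iterated_integral T z))
    (driver_flow sigma zeta zeta2) ->
  0 <= s <= T -> admissible K eps L s T gamma ->
  smooth_solution T b sigma z s y gamma x ->
  rough_solution kappa T b sigma zeta zeta2 s y gamma x' ->
  coupled_solutions k0 Cf (B + Lb) e s T (driver_flow sigma z (iterated_integral T z))
    (driver_flow sigma zeta zeta2) x x' (drift b gamma x) (drift b gamma x').
Proof.
move=> k0_gt k0_le M0 Cf0 zd zdiff zf zf' zz sT ga xs xs'.
have [s0 sT'] := andP sT.
have [xc _] := xs; have xc' := rough_solution_continuous k0_gt k0_le sT xs'.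
have BL u v : u <= v -> B * (v - u) <= (B + Lb) * (v - u).
  by move=> uv; rewrite ler_wpM2r ?subr_ge0 // lerDl.
split; [exact: almost_flow_sub zf'|exact: almost_flow_sub zf|exact: close_flows_sub zz| | |].
- split=> [u v su uv vT|].
    exact: le_trans (drift_bounded s0 ga xc su uv vT) (BL _ _ uv).
  exact: (smooth_error_negligible b_Cb b_unif T_gt0 eps_gt0 L_gt0 C_ge0 sigma_bounds s0 ga zdiff xs).
- have [H1 H2] := rough_flow_solution k0_gt k0_le M0 Cf0 zd zf sT ga xs'.
  by split=> // u v su uv vT; apply: le_trans (H1 u v su uv vT) (BL _ _ uv).
move=> u v N su uv vT xN; apply: le_trans (drift_close s0 ga xc xc' su uv vT xN) _.
have N0 : 0 <= N by apply: le_trans (normr_ge0 _) (xN u _); rewrite lexx uv.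
by rewrite ler_wpM2r ?subr_ge0 // ler_wpM2r // lerDr.
Qed.

Lemma initial_value s (z : R -> 'cV[R]_d) (y : V) (gamma : R -> P2 U) (x : R -> V) :
  s <= T -> smooth_solution T b sigma z s y gamma x -> x s = y.
Proof.
move=> sT [_ /(_ s)]; rewrite lexx sT => /(_ isT) ->.
have E p q (f : R -> 'M[R]_(p, q)) : mx_integral mu `[s, s] f = 0.
  by apply/matrixP => i j; rewrite !mxE set_itv1 Rintegral_set1.
by rewrite driftE !E !addr0.
Qed.

End state_stability.

(** * Suprema and payoffs *)

Lemma sup_close (R : realType) (S : Type) (A : set S) (f g : S -> R) (B e : R) : 0 <= e ->
  (forall a, A a -> `|f a| <= B) -> (forall a, A a -> `|g a| <= B) ->
  (forall a, A a -> `|f a - g a| <= e) ->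
  `|sup [set f a | a in A] - sup [set g a | a in A]| <= e.
Proof.
move=> e0 fB gB fg.
have [[a0 Aa0]|A0] := pselect (A !=set0); last first.
  have E (h : S -> R) : [set h a | a in A] = set0.
    by apply/seteqP; split => // r [a Aa _]; case: A0; exists a.
  by rewrite !E subrr normr0.
have one_side (h k : S -> R) : (forall a, A a -> `|k a| <= B) ->
    (forall a, A a -> `|h a - k a| <= e) ->
    sup [set h a | a in A] <= sup [set k a | a in A] + e.
  move=> kB hk; apply: ge_sup; first by exists (h a0), a0.
  move=> _ [a Aa <-]; have := hk a Aa => /ler_normlP[_ H].
  have : k a <= sup [set k a | a in A].
    apply: ub_le_sup; last by exists a.
    by exists B => _ [a' Aa' <-]; exact: le_trans (ler_norm _) (kB a' Aa').
  lra.
have H1 := one_side f g gB fg.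
have H2 := one_side g f fB ltac:(by move=> a Aa; rewrite distrC; exact: fg).
by apply/ler_normlP; split; lra.
Qed.

Section running_payoff.
Context {R : realType} {m : nat} {U : pmetricType R}.
Notation V := 'cV[R]_m.
Notation mu := (@lebesgue_measure R).
Implicit Types (s t u v r e : R).
Variables (T eps L CF : R) (K : set (P2 U)) (F : R -> V -> P2 U -> R).
Hypotheses (eps_gt0 : 0 < eps) (L_gt0 : 0 < L).
Hypothesis F_bounded : forall t x nu, 0 <= t <= T -> K nu -> `|F t x nu| <= CF.
Hypothesis F_measurable : forall x nu, K nu -> measurable_fun `[0, T] (fun t => F t x nu).
Hypothesis F_lipschitz_x : forall t x x' nu, 0 <= t <= T -> K nu ->
  `|F t x nu - F t x' nu| <= CF * `|x - x'|.
Hypothesis F_lipschitz_mu : forall x, exists2 C : R, 0 <= C & forall t mu nu,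
    0 <= t <= T -> K mu -> K nu ->
    (`|F t x mu - F t x nu|%:E <= C%:E * W2 mu nu)%E.
Hypothesis CF_ge0 : 0 <= CF.
Variables (s : R) (gamma : R -> P2 U).
Hypotheses (s_in : 0 <= s <= T) (gamma_adm : admissible K eps L s T gamma).

Lemma F_lipschitz_control x : exists2 C, 0 <= C & forall t r r',
  0 <= t <= T -> s <= r <= T -> s <= r' <= T ->
  `|F t x (gamma r) - F t x (gamma r')| <= C * `|r' - r| `^ eps.
Proof.
have [C C0 H] := F_lipschitz_mu x; have [gK gW] := gamma_adm.
exists (C * L); first by rewrite mulr_ge0 // ltW.
move=> t r r' t0 rT r'T; rewrite -lee_fin.
apply: le_trans (H t _ _ t0 (gK r rT) (gK r' r'T)) _.
rewrite -mulrA EFinM; apply: lee_wpmul2l; first by rewrite lee_fin.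
exact: gW.
Qed.

Definition grid_index (n : nat) (r : R) : nat := Num.truncn ((r - s) * n.+1%:R).
Definition grid_point (n i : nat) : R := s + i%:R / n.+1%:R.

Lemma grid_index_eq n r i : s <= r ->
  (grid_index n r == i) = (grid_point n i <= r < grid_point n i.+1).
Proof.
move=> sr; have n0 : 0 < n.+1%:R :> R by [].
have H i' : (grid_point n i' <= r) = (i'%:R <= (r - s) * n.+1%:R).
  by rewrite /grid_point addrC -lerBrDr ler_pdivrMr.
rewrite ltNge !H -ltNge.
apply/eqP/idP => [<-|]; last by move=> /truncn_def.
by apply: truncn_itv; rewrite mulr_ge0 // subr_ge0.
Qed.

Lemma grid_point_near n r : s <= r ->
  s <= grid_point n (grid_index n r) <= r /\
  r - grid_point n (grid_index n r) < n.+1%:R^-1.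
Proof.
move=> sr; have := grid_index_eq n (grid_index n r) sr; rewrite eqxx => /esym /andP[H1 H2].
split; first by rewrite H1 /grid_point lerDl divr_ge0.
by rewrite ltrBlDl; move: H2; rewrite /grid_point -(natr1 (grid_index n r)) mulrDl mul1r addrA.
Qed.

Section path.
Variable x : R -> V.
Hypothesis x_cont : {within `[s, T], continuous x}.

(** The state and the control are frozen at the left end of a cell of the grid.
    The time is not, because F is only measurable in time. *)
Definition grid_payoff (n : nat) (r : R) : R :=
  let q := grid_point n (grid_index n r) in F r (x q) (gamma q).

(** On each cell of the grid the state and the law are constant, and the
    measurability in time for a fixed state and law applies. *)
Lemma grid_payoff_measurable n : measurable_fun `[s, T] (grid_payoff n).
Proof.
have [gK _] := gamma_adm; have [s0 sT] := andP s_in.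
pose D i := `[s, T]%classic `&` `[grid_point n i, grid_point n i.+1[%classic.
have mD i : measurable (D i) by exact: measurableI.
have -> : `[s, T]%classic = \bigcup_i D i.
  apply/seteqP; split => [r rsT|r [i _ []]//].
  exists (grid_index n r) => //; split => //; move: rsT; rewrite /= !in_itv /= => /andP[sr _].
  by rewrite -grid_index_eq.
apply/measurable_fun_bigcup => // i.
have [iT|iT] := leP (grid_point n i) T.
  have iK : K (gamma (grid_point n i)).
    by apply: gK; rewrite iT andbT /grid_point lerDl divr_ge0.
  apply: (@eq_measurable_fun _ _ _ _ _ (fun r => F r (x (grid_point n i)) (gamma (grid_point n i)))).
    move=> r; rewrite inE => -[]; rewrite /= !in_itv /= => /andP[sr _].
    by rewrite -grid_index_eq // /grid_payoff => /eqP ->.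
  apply: (measurable_funS _ _ (F_measurable (x (grid_point n i)) iK)) => //.
  by move=> r []; rewrite /= !in_itv /= => /andP[sr rT] _; rewrite rT (le_trans s0 sr).
rewrite (_ : D i = set0); first exact: measurable_fun_set0.
by rewrite -subset0 => r []; rewrite /= !in_itv /= => H1 H2; exfalso; lra.
Qed.

(** The law is moved first, at the state x r: the Lipschitz constant in the law
    depends on the state, but r is fixed in a pointwise limit. *)
Lemma running_payoff_measurable : measurable_fun `[s, T] (fun r => F r (x r) (gamma r)).
Proof.
have [gK _] := gamma_adm; have [s0 sT] := andP s_in.
apply: (measurable_fun_cvg (h := grid_payoff)); first exact: grid_payoff_measurable.
move=> r; rewrite /= in_itv /= => rsT.
have rs : s <= r by lra.
have r0 : 0 <= r <= T by lra.
have [C C0 HC] := F_lipschitz_control (x r).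
apply/cvgrPdist_lt => e e0.
have e2 : 0 < e / 2 by lra.
have e3 : 0 < e / (2 * (CF + 1)) by apply: divr_gt0 => //; move: CF_ge0 => ?; lra.
have rsT' : `[s, T]%classic r by rewrite /= in_itv.
have [h1 h10 H1] := (within_continuous_dist _ _).1 x_cont r rsT' _ e3.
have [h2 h20 H2] := small_powR eps_gt0 C0 e2.
have h0 : 0 < Num.min h1 h2 by rewrite lt_min h10.
have /= N := near_infty_natSinv_lt (PosNum h0).
near=> n; have := near N n => /(_ ltac:(by [])) nh.
have [q1 q2] := grid_point_near n rs; move: q1 q2; rewrite /grid_payoff.
move: (grid_point n (grid_index n r)) => q q1 q2.
have qsT : s <= q <= T by lra.
move: nh; rewrite lt_min => /andP[nh1 nh2].
have -> : F r (x r) (gamma r) - F r (x q) (gamma q)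
  = (F r (x r) (gamma r) - F r (x r) (gamma q)) + (F r (x r) (gamma q) - F r (x q) (gamma q)).
  by rewrite addrA subrK.
apply: le_lt_trans (ler_normD _ _) _.
have A1 : `|F r (x r) (gamma r) - F r (x r) (gamma q)| < e / 2.
  apply: le_lt_trans (HC r r q r0 rsT qsT) _; apply: H2 => //.
  by rewrite distrC ger0_norm; [exact: lt_trans q2 nh2|lra].
have A2 : `|F r (x r) (gamma q) - F r (x q) (gamma q)| <= e / 2.
  apply: le_trans (F_lipschitz_x _ _ r0 (gK q qsT)) _.
  have qsT' : `[s, T]%classic q by rewrite /= in_itv.
  have := H1 q qsT'; rewrite distrC ger0_norm; last lra.
  move=> /(_ (lt_trans q2 nh1)); rewrite distrC => A.
  have -> : e / 2 = (CF + 1) * (e / (2 * (CF + 1))).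
    by field; rewrite gt_eqF //; move: CF_ge0 => ?; lra.
  by apply: ler_pM => //; [lra|exact: ltW].
lra.
Unshelve. all: by end_near. Qed.

Lemma running_payoff_integrable :
  mu.-integrable `[s, T] (EFin \o (fun r => F r (x r) (gamma r))).
Proof.
have [gK _] := gamma_adm; have [s0 sT] := andP s_in.
apply: measurable_bounded_integrable => //.
- exact/compact_finite_measure/segment_compact.
- exact: running_payoff_measurable.
exists CF; split; first by rewrite num_real.
move=> M MCF r; rewrite /= in_itv /= => rsT.
apply: le_trans (ltW MCF); apply: F_bounded; [lra|exact: gK].
Qed.

Lemma running_payoff_bounded :
  `|\int[mu]_(r in `[s, T]) F r (x r) (gamma r)| <= CF * T.
Proof.
have [gK _] := gamma_adm; have [s0 sT] := andP s_in.
apply: le_trans (integral_segment_bound sT running_payoff_integrable (K := CF) _) _.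
  by move=> r rsT; apply: F_bounded; [lra|exact: gK].
by apply: ler_wpM2l => //; lra.
Qed.

End path.

Lemma running_payoff_close e x x' :
  {within `[s, T], continuous x} -> {within `[s, T], continuous x'} ->
  (forall r, s <= r <= T -> `|x r - x' r| <= e) ->
  `|\int[mu]_(r in `[s, T]) F r (x r) (gamma r) - \int[mu]_(r in `[s, T]) F r (x' r) (gamma r)|
    <= CF * e * T.
Proof.
move=> xc xc' xx; have [gK _] := gamma_adm; have [s0 sT] := andP s_in.
have i1 := running_payoff_integrable xc; have i2 := running_payoff_integrable xc'.
rewrite -RintegralB //.
have e0 : 0 <= e by apply: le_trans (normr_ge0 _) (xx s _); rewrite lexx.
have i3 : lebesgue_measure.-integrable `[s, T]
    (EFin \o (fun r => F r (x r) (gamma r) - F r (x' r) (gamma r))).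
  rewrite (_ : EFin \o _ = ((EFin \o (fun r => F r (x r) (gamma r)))
      \- (EFin \o (fun r => F r (x' r) (gamma r))))%E) //.
  exact: integrableB.
apply: le_trans (integral_segment_bound sT i3 (K := CF * e) _) _.
  move=> r rsT; apply: le_trans (F_lipschitz_x _ _ _ (gK r rsT)) _; first lra.
  by apply: ler_wpM2l => //; exact: xx.
by apply: ler_wpM2l; [rewrite mulr_ge0|lra].
Qed.

End running_payoff.

(** Transposition, an isometry, reduces column vectors to row vectors, whose
    closed balls are compact. *)
Lemma continuous_uniform_on_balls (R : realType) (m : nat) (G : 'cV[R]_m -> R) (M e : R) :
  continuous G -> 0 < e -> exists2 h : R, 0 < h &
    forall x y, `|x| <= M -> `|y| <= M -> `|x - y| < h -> `|G x - G y| < e.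
Proof.
move=> Gc e0; pose A := [set v : 'rV[R]_m | `|v| <= M].
have normT p q (v : 'M[R]_(p, q)) : `|v^T| = `|v|.
  have le p' q' (w : 'M[R]_(p', q')) : `|w^T| <= `|w|.
    by apply: ler_mx_norm => // i j; rewrite mxE; exact: ler_mx_entry.
  by apply/eqP; rewrite eq_le le -{1}[v]trmxK le.
have Ac : compact A.
  apply: bounded_closed_compact.
    by exists M; split; [rewrite num_real|move=> N MN v Av; exact: le_trans Av (ltW MN)].
  rewrite (_ : A = Num.norm @^-1` [set r : R | r <= M]) //.
  by apply: closed_comp => [v _|]; [exact: norm_continuous|exact: closed_le].
have gc : {within A, continuous (fun v : 'rV[R]_m => G v^T)}.
  apply/within_continuous_dist => v _ e1 e10.
  have /cvgrPdist_lt/(_ e1 e10) /nbhs_ballP[h /= h0 H] := Gc v^T.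
  exists h => // w _ wv; rewrite distrC; apply: H.
  by rewrite -ball_normE /= distrC -linearB normT.
have [h h0 H] := compact_uniform_continuity Ac gc e0.
exists h => // x y xM yM xy; rewrite -[x]trmxK -[y]trmxK; apply: H; rewrite /A /= ?normT //.
by rewrite -linearB normT.
Qed.

(** * Stability of the states and of the values *)

Lemma two_thirds_lt (R : realFieldType) (e : R) : 0 < e -> e / 3 + e / 3 < e.
Proof. lra. Qed.

(** The empty list is a partition of [s, s]. *)
Lemma is_rough_integral_start (R : realType) (m d : nat)
    (zeta : R -> 'cV[R]_d) (zeta2 : R -> R -> 'M[R]_d)
    (Y : R -> 'M[R]_(m, d)) (Y' : R -> 'I_m -> 'M[R]_d) (s : R) (I : 'cV[R]_m) :
  is_rough_integral zeta zeta2 Y Y' s s I -> I = 0.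
Proof.
move=> sI; apply/eqP; rewrite -normr_eq0 eq_le normr_ge0 andbT.
apply/ler_addgt0Pr => e e0; rewrite add0r.
have [h h0 /(_ [::])] := sI e e0; rewrite big_geq // sub0r normrN => H.
by apply/ltW/H => //; rewrite /itv_partition /= eqxx.
Qed.

(** The exponent k0 is at most kappa, so that the rough solution is controlled at
    order 2 k0, and at most 2/5, so that k0 + 1 >= 3 k0 and 2 k0 <= 1. *)
Theorem states_close (R : realType) (m d k : nat) (U : pmetricType R)
    (emb : U -> 'cV[R]_k) (T alpha kappa eps L : R)
    (zeta : R -> 'cV[R]_d) (zeta2 : R -> R -> 'M[R]_d) (K : set (P2 U))
    (sigma : R -> 'cV[R]_m -> 'M[R]_(m, d)) (b : R -> 'cV[R]_m -> U -> 'cV[R]_m) :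
  0 < T -> 3^-1 < kappa < alpha -> 0 < eps -> 0 < L -> rough_path alpha T zeta zeta2 ->
  Cb T 1 3 sigma -> Cb011 emb T b ->
  (forall x (e : R), 0 < e -> exists2 h : R, 0 < h &
    forall u1 u2, 0 <= u1 <= T -> 0 <= u2 <= T -> `|u2 - u1| < h ->
      forall a, `|b u2 x a - b u1 x a| <= e) ->
  exists2 C : R, 0 <= C & forall (e : R) z s y gamma x x',
    0 <= e <= 1 -> differentiable_path T z ->
    (holder1_norm alpha 0 T (fun t => z t - zeta t)%R
     + holder2_norm (2 * alpha)%R 0 T
         (fun s t => iterated_integral T z s t - zeta2 s t)%R < e%:E)%E ->
    0 <= s <= T -> admissible K eps L s T gamma ->
    smooth_solution T b sigma z s y gamma x ->
    rough_solution kappa T b sigma zeta zeta2 s y gamma x' ->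
    forall t : R, s <= t <= T -> `|x t - x' t| <= C * e.
Proof.
move=> T0 /andP[kappa_gt kappa_lt] eps0 L0 zr sigma_Cb b_Cb b_unif.
have [C C0 sb] := Cb_coefficient_bounds T0 sigma_Cb.
have [B B0 HB] := mean_drift_bounded b_Cb; have [Lb Lb0 HLb] := mean_drift_lipschitz b_Cb.
pose k0 := Num.min kappa (2 / 5).
have k0_gt : 3^-1 < k0 by rewrite /k0 lt_min kappa_gt /=; lra.
have k0_kappa : k0 <= kappa by rewrite /k0 ge_min lexx.
have k0_le : k0 <= 2 / 5 by rewrite /k0 ge_min lexx orbT.
have k0_gt0 : 0 < k0 by lra.
have k0_alpha : k0 <= alpha by lra.
have [M M0 [zd near_zd]] := smooth_rough_drivers T0 k0_gt0 k0_alpha zr.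
have [Cf Cf0 Hflow] := @driver_flow_close _ _ _ T k0 sigma C M T0 k0_gt k0_le C0 M0 sb.
have [_ zf] := Hflow 0 _ _ _ _ (lexx 0) zd zd (close_driversxx _ _ _ _ _).
have BL0 : 0 <= B + Lb by rewrite addr_ge0.
have [A A0 HA] := coupled_solutions_close (m := m) k0_gt k0_le T0 Cf0 BL0.
exists A => // e z s y gamma x x' e01 zdiff near_z sT ga xs xs' t tT.
have [zzd cl] := near_zd e z e01 zdiff near_z.
have e0 : 0 <= e by case/andP: e01.
have [clf zzf] := Hflow e _ _ _ _ e0 zzd zd cl.
have cs := coupled_flow_solutions b_Cb b_unif T0 eps0 L0 C0 sb B0 HB Lb0 HLb k0_gt k0_kappa M0 Cf0
  zd zdiff zf zzf clf sT ga xs xs'.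
apply: (HA _ _ _ _ _ _ _ _ _ e0 _ _ cs t tT); first by lra.
have [s0 sT'] := andP sT.
rewrite (initial_value sT' xs); have [_ /(_ s)] := xs'.
rewrite lexx sT' => /(_ isT)[I /is_rough_integral_start -> ->].
have -> : drift b gamma x' s s = 0; last by rewrite !addr0.
by apply/matrixP => i j; rewrite !mxE set_itv1 Rintegral_set1.
Qed.

Theorem theorem4p23 (R : realType) (m d k : nat)
  (U : pmetricType R) (emb : U -> 'cV[R]_k)
  (T alpha kappa eps L : R)
  (zeta : R -> 'cV[R]_d) (zeta2 : R -> R -> 'M[R]_d)
  (zetan : nat -> R -> 'cV[R]_d)
  (K : set (P2 U))
  (sigma : R -> 'cV[R]_m -> 'M[R]_(m, d))
  (b : R -> 'cV[R]_m -> U -> 'cV[R]_m)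
  (F : R -> 'cV[R]_m -> P2 U -> R) (G : 'cV[R]_m -> R)
  (Xn : nat -> R -> 'cV[R]_m -> (R -> P2 U) -> R -> 'cV[R]_m)
  (X : R -> 'cV[R]_m -> (R -> P2 U) -> R -> 'cV[R]_m)
  (emb_inj : injective emb)
  (T_gt0 : 0 < T) (alpha_gt : 3^-1 < alpha) (kappa_bounds : 3^-1 < kappa < alpha)
  (eps_gt0 : 0 < eps) (L_gt0 : 0 < L)
  (zeta_rough : rough_path alpha T zeta zeta2)
  (zetan_diff : forall n, differentiable_path T (zetan n))
  (zetan_cvg :
    (fun n => (holder1_norm alpha 0 T (fun t => zetan n t - zeta t)%R
               + holder2_norm (2 * alpha)%R 0 T
                   (fun s t => iterated_integral T (zetan n) s t - zeta2 s t)%R)%E)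
      @ \oo --> 0%E)
  (K_compact : compact K)
  (sigma_Cb : Cb T 1 3 sigma)
  (b_Cb : Cb011 emb T b)
  (b_unif : forall x (e : R), 0 < e -> exists2 h : R, 0 < h &
    forall u1 u2, 0 <= u1 <= T -> 0 <= u2 <= T -> `|u2 - u1| < h ->
      forall a, `|b u2 x a - b u1 x a| <= e)
  (F_bounded : exists C : R, forall t x mu,
    0 <= t <= T -> K mu -> `|F t x mu| <= C)
  (F_measurable : forall x mu, K mu -> measurable_fun `[0, T] (fun t => F t x mu))
  (F_lipschitz_x : exists C : R, forall t x x' mu,
    0 <= t <= T -> K mu -> `|F t x mu - F t x' mu| <= C * `|x - x'|)
  (F_lipschitz_mu : forall x, exists2 C : R, 0 <= C & forall t mu nu,
    0 <= t <= T -> K mu -> K nu ->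
    (`|F t x mu - F t x nu|%:E <= C%:E * W2 mu nu)%E)
  (G_bounded : exists C : R, forall x, `|G x| <= C)
  (G_continuous : continuous G)
  (Xn_solution : forall n s y gamma, 0 <= s <= T -> admissible K eps L s T gamma ->
    smooth_solution T b sigma (zetan n) s y gamma (Xn n s y gamma))
  (X_solution : forall s y gamma, 0 <= s <= T -> admissible K eps L s T gamma ->
    rough_solution kappa T b sigma zeta zeta2 s y gamma (X s y gamma)) :
  forall p : R * 'cV[R]_m, 0 <= p.1 <= T ->
    exists2 O, nbhs p O &
      {uniform O `&` [set q | 0 <= q.1 <= T],
        (fun n q => value K eps L T F G (Xn n) q.1 q.2) @ \oo -->
        (fun q => value K eps L T F G X q.1 q.2)}.
Proof.
move=> p p1.
have [CF CF0 [Fb Fx]] : exists2 CF, 0 <= CF &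
    (forall t x nu, 0 <= t <= T -> K nu -> `|F t x nu| <= CF) /\
    (forall t x x' nu, 0 <= t <= T -> K nu -> `|F t x nu - F t x' nu| <= CF * `|x - x'|).
  have [C1 H1] := F_bounded; have [C2 H2] := F_lipschitz_x.
  exists (`|C1| + `|C2|); first by rewrite addr_ge0.
  split=> [t x nu t0 Kn|t x x' nu t0 Kn].
    by apply: le_trans (H1 t x nu t0 Kn) _; apply: le_trans (ler_norm _) _; rewrite lerDl.
  apply: le_trans (H2 t x x' nu t0 Kn) _; apply: ler_wpM2r => //.
  by apply: le_trans (ler_norm _) _; rewrite lerDr.
have [CG HG] := G_bounded.
have [A A0 HA] := @states_close _ _ _ _ _ emb T alpha kappa eps L zeta zeta2 K sigma b
  T_gt0 kappa_bounds eps_gt0 L_gt0 zeta_rough sigma_Cb b_Cb b_unif.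
have [C C0 sb] := Cb_coefficient_bounds T_gt0 sigma_Cb.
have [B B0 HB] := mean_drift_bounded b_Cb.
(* The states stay in a bounded set that depends neither on the control nor on
   the starting point, being close to those driven by one fixed smooth path. *)
have [rho Hrho] : exists rho : R, forall s y gamma, 0 <= s <= T -> `|y - p.2| < 1 ->
    admissible K eps L s T gamma -> `|X s y gamma T| <= rho.
  have [N _ HN] := cvg_to0_lt zetan_cvg ltr01.
  have := HN N (leqnn N) => nearN.
  exists (`|p.2| + 1 + (B + d%:R * C) * (clock T (zetan N) T - clock T (zetan N) 0) + A).
  move=> s y gamma sT yp ga; have [s0 sT'] := andP sT.
  have xs := Xn_solution N s y gamma sT ga; have xs' := X_solution s y gamma sT ga.
  have TT : s <= T <= T by rewrite sT' lexx.
  have H1 := HA 1 _ s y gamma _ _ ltac:(lra) (zetan_diff N) nearN sT ga xs xs' T TT.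
  have H2 := smooth_increment_clock b_Cb b_unif eps_gt0 L_gt0 C0 sb s0 ga (zetan_diff N) xs
    B0 HB (lexx s) sT' (lexx T).
  rewrite (initial_value sT' xs) in H2.
  have H3 := clock_ge (zetan_diff N) (lexx 0) s0 sT'.
  have H4 : (B + d%:R * C) * (clock T (zetan N) T - clock T (zetan N) s)
      <= (B + d%:R * C) * (clock T (zetan N) T - clock T (zetan N) 0).
    apply: ler_wpM2l; first by rewrite addr_ge0 ?mulr_ge0.
    by apply: lerB => //; rewrite -subr_ge0; apply: le_trans H3; rewrite subr0.
  have -> : X s y gamma T = p.2 + (y - p.2) + (Xn N s y gamma T - y)
      - (Xn N s y gamma T - X s y gamma T).
    by rewrite [p.2 + _]addrC subrK [y + _]addrC subrK opprB addrC subrK.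
  rewrite mulr1 in H1.
  apply: le_trans (ler_normB _ _) _; apply: lerD => //.
  apply: le_trans (ler_normD _ _) _; apply: lerD; last exact: le_trans H2 H4.
  by apply: le_trans (ler_normD _ _) _; apply: lerD => //; exact: ltW.
exists (ball p 1); first exact: nbhsx_ballx.
move=> Q /uniform_nbhs[E [entE EQ]].
move: entE; rewrite -entourage_ballE => -[e /= e0 He].
have e3 : 0 < e / 3 by rewrite divr_gt0.
have [h h0 Hh] := continuous_uniform_on_balls (rho + A) G_continuous e3.
have A1 : 0 < A + 1 by rewrite ltr_wpDl.
have CAT1 : 0 < CF * A * T + 1.
  by rewrite ltr_wpDl // !mulr_ge0 // ltW.
pose eta := Num.min 1 (Num.min (h / (A + 1)) (e / 3 / (CF * A * T + 1))).
have eta0 : 0 < eta by rewrite !lt_min ltr01 !divr_gt0.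
have eta1 : eta <= 1 by rewrite /eta ge_min lexx.
have etah : A * eta < h.
  have : eta * (A + 1) <= h by rewrite -ler_pdivlMr // /eta !ge_min lexx orbT.
  by rewrite mulrDr mulr1 [eta * A]mulrC; lra.
have etae : CF * (A * eta) * T <= e / 3.
  have : eta * (CF * A * T + 1) <= e / 3 by rewrite -ler_pdivlMr // /eta !ge_min lexx !orbT.
  have -> : CF * (A * eta) * T = eta * (CF * A * T + 1) - eta by ring.
  lra.
clearbody eta.
have := cvg_to0_lt zetan_cvg eta0; apply: filterS => n near_n.
apply: EQ => q [qp q1]; apply: He; rewrite -ball_normE /= distrC.
have [q10 q1T] := andP q1.
have qp2 : `|q.2 - p.2| < 1 by case: qp => _; rewrite -ball_normE /= distrC.
have TT : q.1 <= T <= T by rewrite q1T lexx.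
have close gamma (ga : admissible K eps L q.1 T gamma) r : q.1 <= r <= T ->
    `|Xn n q.1 q.2 gamma r - X q.1 q.2 gamma r| <= A * eta.
  move=> rT; apply: (HA eta (zetan n) q.1 q.2 gamma) => //; first by rewrite ltW.
  - exact: Xn_solution.
  - exact: X_solution.
have contn gamma : admissible K eps L q.1 T gamma ->
    {within `[q.1, T], continuous (Xn n q.1 q.2 gamma)}.
  by move=> ga; have [] := Xn_solution n q.1 q.2 gamma q1 ga.
have contX gamma : admissible K eps L q.1 T gamma ->
    {within `[q.1, T], continuous (X q.1 q.2 gamma)}.
  move=> ga; have [cx _] := X_solution q.1 q.2 gamma q1 ga.
  apply: (holder_path_continuous _ q1T (controlled_path cx)).
  by case/andP: kappa_bounds => k3 _; apply: lt_trans k3; rewrite invr_gt0 ltr0n.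
apply: (@le_lt_trans _ _ (e / 3 + e / 3)); last exact: two_thirds_lt.
apply: (@sup_close _ _ _ _ _ (CF * T + CG)); first by rewrite addr_ge0 ?ltW.
- move=> gamma ga; apply: le_trans (ler_normD _ _) (lerD _ (HG _)).
  exact: (running_payoff_bounded eps_gt0 L_gt0 Fb F_measurable Fx F_lipschitz_mu CF0 q1 ga (contn _ ga)).
- move=> gamma ga; apply: le_trans (ler_normD _ _) (lerD _ (HG _)).
  exact: (running_payoff_bounded eps_gt0 L_gt0 Fb F_measurable Fx F_lipschitz_mu CF0 q1 ga (contX _ ga)).
move=> gamma ga; rewrite opprD addrACA; apply: le_trans (ler_normD _ _) _; apply: lerD.
  apply: le_trans etae.
  exact: (running_payoff_close eps_gt0 L_gt0 Fb F_measurable Fx F_lipschitz_mu CF0 q1 ga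
    (contn _ ga) (contX _ ga) (close _ ga)).
have XT := Hrho q.1 q.2 gamma q1 qp2 ga.
have cT := close gamma ga T TT.
apply/ltW/Hh; last exact: le_lt_trans cT etah.
  have -> : Xn n q.1 q.2 gamma T = X q.1 q.2 gamma T + (Xn n q.1 q.2 gamma T - X q.1 q.2 gamma T).
    by rewrite [RHS]addrC subrK.
  apply: le_trans (ler_normD _ _) _; apply: lerD => //; apply: le_trans cT _.
  exact: ler_piMr.
by apply: le_trans XT _; rewrite lerDl.
Qed.
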